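(* Let $p$ be an odd prime, $q:=2^p$, $G=\mathrm{Sz}(2^p)$, and $q_{\pm}:=q\pm\sqrt{2q}+1$. Let $x\in G$ be a non-identity element. Then $|x|=2$, or $|x|=4$, or $|x|$ divides one of $q-1$, $q_+$, $q_-$. Every maximal subgroup of $G$ is isomorphic to one of $(C_2^p.C_2^p)\rtimes C_{q-1}$, $D_{2(q-1)}$, $C_{q_+}\rtimes C_4$, $C_{q_-}\rtimes C_4$, and $\mathrm{Sol}_G(x)$ is the union of the maximal subgroups of $G$ containing $x$. The numbers of maximal subgroups of $G$ containing $x$ of these four types (in this order), the isomorphism types of pairwise intersections of distinct maximal subgroups containing $x$, and $|\mathrm{Sol}_G(x)|$ are as follows. (1) If $|x|=2$: $\left(1,\frac{q^2}{2},\frac{q^2}{4},\frac{q^2}{4}\right)$; each intersection is isomorphic to $C_2$ or $C_4$; $|\mathrm{Sol}_G(x)|=q^2(4q-3)$. (2) If $|x|=4$: $\left(1,0,\frac q2,\frac q2\right)$; each intersection is isomorphic to $C_4$; $|\mathrm{Sol}_G(x)|=q^2(q+3)$. (3) If $|x|$ divides $q-1$: $(2,1,0,0)$; each intersection is isomorphic to $C_{q-1}$; $|\mathrm{Sol}_G(x)|=2q^2(q-1)$. (4) If $|x|$ divides $q_+$: $(0,0,1,0)$; $|\mathrm{Sol}_G(x)|=4q_+$. (5) If $|x|$ divides $q_-$: $(0,0,0,1)$; $|\mathrm{Sol}_G(x)|=4q_-$.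
   Context: For a finite group $G$ and $x\in G$, the solubilizer of $x$ is the set $\mathrm{Sol}_G(x)=\{y\in G\mid \langle x,y\rangle \text{ is soluble}\}$. $|x|$ is the order of $x$. $\mathrm{Sz}(2^p)$ is the Suzuki group over the field with $2^p$ elements, of order $q^2(q^2+1)(q-1)$. $C_n$ is the cyclic group of order $n$, $D_{2n}$ is the dihedral group of order $2n$, and $(C_2^p.C_2^p)\rtimes C_{q-1}$ denotes the normalizer of a Sylow $2$-subgroup, where $C_2^p.C_2^p$ (a nonsplit extension of order $q^2$) is the Sylow $2$-subgroup. $C_{q_\pm}\rtimes C_4$ denotes the normalizer of a cyclic subgroup of order $q_\pm$, of order $4q_\pm$. *)

(* Defs.v *)
From HB Require Import structures.
From mathcomp Require Import all_boot all_order all_algebra.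
From mathcomp Require Import all_fingroup all_solvable all_field.

Set Implicit Arguments.
Unset Strict Implicit.
Unset Printing Implicit Defensive.

Import GRing.Theory.
Local Open Scope nat_scope.

(* The integer sqrt(2q) for q = 2^p, p odd. *)
Definition sqrt2q (p : nat) : nat := 2 ^ (p.+1)./2.

Lemma sqrt2qE (p : nat) : odd p -> sqrt2q p ^ 2 = 2 * 2 ^ p.
Proof.
by move=> p_odd; rewrite /sqrt2q -expnM -expnS muln2 halfK /= p_odd subn0.
Qed.

Definition q_plus (p : nat) : nat := 2 ^ p + sqrt2q p + 1.
Definition q_minus (p : nat) : nat := 2 ^ p - sqrt2q p + 1.

(* Suzuki's 4 x 4 matrix group over the field F with 2^p elements, generated   *)
(* as in Huppert-Blackburn, Finite Groups III, XI.3.  There M is parametrized  *)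
(* by k, with diagonal z1, z2, z2^-1, z1^-1 given by z1^theta = k^(1+theta)    *)
(* and z2^theta = k; here it is parametrized by z2, so that z1 = z2^(1+theta). *)
Section SuzukiGroup.

Variables (p : nat) (F : finFieldType).

Local Open Scope ring_scope.

(* theta (theta a) = a ^+ 2 when #|F| = 2^p and p is odd. *)
Definition theta (a : F) : F := a ^+ sqrt2q p.

Definition mx4 (s : seq (seq F)) : 'M[F]_4 :=
  \matrix_(i < 4, j < 4) nth 0 (nth [::] s i) j.

Definition suzuki_S (a b : F) : 'M[F]_4 :=
  mx4 [:: [:: 1; 0; 0; 0];
          [:: a; 1; 0; 0];
          [:: b; theta a; 1; 0];
          [:: a ^+ 2 * theta a + a * b + theta b; a * theta a + b; a; 1]].

Definition suzuki_M (l : F) : 'M[F]_4 :=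
  mx4 [:: [:: l * theta l; 0; 0; 0];
          [:: 0; l; 0; 0];
          [:: 0; 0; l^-1; 0];
          [:: 0; 0; 0; (l * theta l)^-1]].

Definition suzuki_T : 'M[F]_4 :=
  mx4 [:: [:: 0; 0; 0; 1];
          [:: 0; 0; 1; 0];
          [:: 0; 1; 0; 0];
          [:: 1; 0; 0; 0]].

Definition suzuki_gens : {set {'GL_4[F]}} :=
  [set g : {'GL_4[F]} |
    [|| [exists a : F, exists b : F, GLval g == suzuki_S a b],
        [exists l : F, (l != 0) && (GLval g == suzuki_M l)]
      | GLval g == suzuki_T]].

Definition Sz : {group {'GL_4[F]}} := <<suzuki_gens>>%G.

End SuzukiGroup.

Section MaximalSubgroups.

Variable gT : finGroupType.
Implicit Types (A : {set gT}) (G H M P : {group gT}) (x : gT).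

Local Open Scope group_scope.

Definition solubilizer G x : {set gT} :=
  [set y in G | solvable <<[set x; y]>>].

(* A is isomorphic to the cyclic group C_n. *)
Definition is_C (n : nat) A : bool := cyclic A && (#|A| == n).

(* P is a nonsplit extension C_2^p.C_2^p. *)
Definition is_C2p_C2p (p : nat) P : bool :=
  [exists E : {group gT},
    [&& E <| P, 2.-abelem E, #|E| == (2 ^ p)%N,
        2.-abelem (P / E), #|P / E| == (2 ^ p)%N & ~~ [splits P, over E]]].

(* M is isomorphic to (C_2^p.C_2^p) : C_(q-1), the normalizer in G of a Sylow  *)
(* 2-subgroup.                                                                 *)
Definition borel_type (p : nat) G M : bool :=
  [exists P : {group gT}, exists C : {group gT},
    [&& 2.-Sylow(G) P, is_C2p_C2p p P, is_C (2 ^ p - 1)%N C,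
        P ><| C == 'N_G(P) & M \isog 'N_G(P)]].

Definition dihedral_type (p : nat) M : bool :=
  M \isog 'D_(2 * (2 ^ p - 1))%N.

(* M is isomorphic to C_n : C_4, the normalizer in G of a cyclic subgroup of   *)
(* order n.                                                                    *)
Definition frobenius_type (n : nat) G M : bool :=
  [exists K : {group gT}, exists C : {group gT},
    [&& K \subset G, is_C n K, is_C 4 C,
        K ><| C == 'N_G(K) & M \isog 'N_G(K)]].

Definition maximals_containing G x : {set {group gT}} :=
  [set M : {group gT} | maximal M G && (x \in M)].

Definition maximal_counts (p : nat) G x : nat * nat * nat * nat :=
  (#|[set M in maximals_containing G x | borel_type p G M]|,
   #|[set M in maximals_containing G x | dihedral_type p M]|,
   #|[set M in maximals_containing G x | frobenius_type (q_plus p) G M]|,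
   #|[set M in maximals_containing G x | frobenius_type (q_minus p) G M]|).

Definition pairwise_intersections G x (Q : {set gT} -> Prop) : Prop :=
  forall M N : {group gT},
    M \in maximals_containing G x -> N \in maximals_containing G x ->
    M != N -> Q (M :&: N).

End MaximalSubgroups.

(* Main.v *)
(* The lower triangular matrices S(a,b) form a group S of order q^2 which, with the
   diagonal group H of order q - 1, spans a Frobenius group B = S H; the identity for
   T S(a,b) T gives the Bruhat decomposition G = B u B T S.  Hence S is a TI Sylow
   2-subgroup, |G| = q^2 (q^2 + 1) (q - 1), elements of even order are conjugate into S,
   and an element x <> 1 of odd order is conjugate into H or has order dividing q^2 + 1.
   In the latter case x acts irreducibly on F^4, so F[x] is a field: C_G(x) is cyclic
   and, conjugates of x being roots of its characteristic polynomial, has index at most 4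
   in its normaliser.  The centralisers of elements of odd order are therefore TI, and
   counting elements of G leaves exactly two classes of them besides H, of orders
   q + r + 1 and q - r + 1 with r^2 = 2 q and index 4.  The same count inside a proper
   subgroup U shows that U lies in a conjugate of B or in the normaliser N(C) of some
   such centraliser C, which identifies the maximal subgroups.

   Two distinct maximal subgroups containing a 2-element x of S meet inside S, in a cyclic
   group, and double counting pairs (x, N(C)) gives the numbers of N(C) above x.  As G is
   not soluble, the solubilizer of x is the union of the maximal subgroups above x, and its
   cardinality follows because these meet pairwise inside one fixed subgroup. *)

Require Import Defs.
From mathcomp Require Import all_boot all_order all_algebra.
From mathcomp Require Import all_fingroup all_solvable all_field.
From mathcomp Require Import zify ring.

Set Implicit Arguments.
Unset Strict Implicit.
Unset Printing Implicit Defensive.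

(** * Arithmetic of the counting equations *)

Section Arith.

(** The group theory is done for an abstract group with subgroups S, H and an involution t, and
    applied to matrices only at the end. In a subgroup U, the conjugates of a centraliser of order
    a, of index e in its normaliser, contain (a - 1) |U| / (a e) non-identity elements. Since 3 does
    not divide |G|, a is at least 5 and e is 1, 2 or 4, so every class has at least |U| / 5 elements
    and only few can coexist. Subgroups are thus classified by elementary inequalities, without
    characters. Primality of p enters when U meets B in P D with D nontrivial: |P| is then q or q^2,
    so no Suzuki group over a proper subfield interferes. One numerical solution has the order q (q
    - 1) (q + 1) of SL(2,q); it would need a centraliser of order q + 1, which divides neither q - 1
    nor q^2 + 1. Elements of order 4 are conjugate only up to inversion. This does not disturb the
    counts, as x and x^-1 lie in the same subgroups. *)

Lemma coprime_sqr_succ_pred n : ~~ odd n -> 0 < n -> coprime (n ^ 2 + 1) (n - 1).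
Proof.
case: n => // n /=; rewrite negbK => n_odd _; rewrite subSS subn0.
have -> : n.+1 ^ 2 + 1 = (n + 2) * n + 2 by ring.
by rewrite coprime_sym /coprime gcdnMDl -/(coprime _ _) coprimen2.
Qed.

Lemma coprime_sqr_succ_succ n : ~~ odd n -> coprime (n ^ 2 + 1) (n + 1).
Proof.
case: n => // n n_even; rewrite coprime_sym /coprime.
have -> : n.+1 ^ 2 + 1 = n * (n.+1 + 1) + 2 by rewrite -mulnn; ring.
by rewrite gcdnMDl -/(coprime _ _) coprimen2 addn1 oddS.
Qed.

Lemma coprime_sqr_succ n : coprime (n ^ 2 + 1) n.
Proof.
rewrite coprime_sym addn1; apply: coprime_dvdl (coprimenS _).
exact: dvdn_mulr.
Qed.

Lemma coprime_pred n : 0 < n -> coprime n (n - 1).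
Proof. by case: n => // n _; rewrite subSS subn0 coprime_sym coprimenS. Qed.

Lemma dvdn_pred_exp2_prime r p k : prime r -> prime p ->
  r %| 2 ^ p - 1 -> r %| 2 ^ k - 1 -> p %| k.
Proof.
move=> r_pr p_pr r_p r_k; apply: contraT; rewrite -prime_coprime //.
case/coprimeP=> [|[u v] /= uv]; first exact: prime_gt0.
have mod1 n : r %| 2 ^ n - 1 -> forall m, 2 ^ (m * n) = 1 %[mod r].
  rewrite -eqn_mod_dvd ?expn_gt0 // => /eqP n1 m.
  by rewrite mulnC expnM -modnXm n1 modnXm exp1n.
have Duv : u * p = (v * k).+1 by lia.
have := mod1 p r_p u; rewrite Duv expnS -modnMmr (mod1 k r_k v) modnMmr muln1.
move/eqP; rewrite eqn_mod_dvd // subn1 /= dvdn1.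
by rewrite gtn_eqF ?prime_gt1.
Qed.

(** Here [f] is the number of non-identity elements in the conjugates of a centraliser of order [a]
    and of index [e] in its normaliser, and [u] is the order of the group. As 4/5 <= (a - 1) / a <
    1, the proportion f / u lies between 4 / (5 e) and 1 / e. *)
Lemma class_arith a e f u : 5 <= a -> f * (a * e) = (a - 1) * u ->
  [/\ e = 1 -> 4 * u <= 5 * f, e = 2 -> 2 * u <= 5 * f, e = 4 -> u <= 5 * f,
      e = 2 -> 2 * f <= u & e = 4 -> 4 * f <= u].
Proof.
move=> a5 fE; have a_gt0 : 0 < a by apply: leq_trans a5.
have upper k : k * (a * f) = (a - 1) * u -> k * f <= u.
  by move=> kfE; rewrite -(leq_pmul2l a_gt0) mulnCA kfE leq_mul2r leq_subr orbT.
have lower k : k * (a * f) = (a - 1) * u -> 4 * u <= 5 * (k * f).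
  move=> kfE; rewrite -(leq_pmul2l a_gt0).
  have -> : a * (5 * (k * f)) = 5 * ((a - 1) * u) by rewrite -kfE; ring.
  by rewrite mulnA (mulnA 5) leq_mul2r; apply/orP; right; lia.
have kE k : e = k -> k * (a * f) = (a - 1) * u by move=> <-; rewrite -fE; ring.
split=> /kE kfE.
- by have := lower 1 kfE; rewrite mul1n.
- by have := lower 2 kfE; lia.
- by have := lower 4 kfE; lia.
- exact: upper.
exact: upper.
Qed.

Lemma small_two_arith s u n2 o : 0 < s -> u = 1 + n2 + o -> n2 * s = (s - 1) * u ->
  s * (1 + o) = u.
Proof.
case: s => // s _ uE; rewrite subSS subn0 => n2E.
have : s.+1 * u = s.+1 * (1 + o) + s * u by rewrite {1}uE -n2E; ring.
by lia.
Qed.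

(** [s] and [c] are the orders of P and D in U ∩ B = P D, where D is its own normaliser in U. The
    classes of P and D have proportions (s - 1) / (s c) and (c - 1) / c, which leaves exactly u / (s
    c) for 1 + (o - f). *)
Lemma Frobenius_arith s c u n2 o f (fc : f * c = (c - 1) * u) :
    0 < s -> 0 < c -> u = 1 + n2 + o -> n2 * (s * c) = (s - 1) * u -> f <= o ->
  u = s * c * (1 + (o - f)).
Proof.
case: s => // s; case: c fc => // c; rewrite !subSS !subn0 => fc _ _ uE n2E le_fo.
have [d oE] : exists d, o = f + d by exists (o - f); rewrite subnKC.
rewrite oE addKn in uE *.
have : s.+1 * c.+1 * u = s.+1 * c.+1 * (1 + d) + s * u + s.+1 * (c * u).
  rewrite {1}uE -n2E -fc; ring.
lia.
Qed.

(* [u] is the order of a subgroup whose Sylow 2-subgroup has order [q], [q * c] that of its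
   intersection with B; [f] and [f'] count two classes of odd elements, both with [e = 2]. *)
Lemma second_class_arith q n c b f f' u n2 : 2 <= q -> 0 < c -> 0 < b -> 0 < n ->
    u = q * c * n -> u = 1 + n2 + (f + f') -> n2 * (q * c) = (q - 1) * u ->
    f * (c * 2) = (c - 1) * u -> f' * (b * 2) = (b - 1) * u ->
  b * (2 + n * (q - 2)) = q * n * c.
Proof.
case: q => [|[|q]] // _; case: c => // c _; case: b => // b _ n_gt0.
rewrite !subSS !subn0 => uE uS n2E fE f'E.
have {}n2E : n2 = q.+1 * n.
  have /eqP : q.+2 * c.+1 * n2 = q.+2 * c.+1 * (q.+1 * n) by rewrite mulnC n2E uE; ring.
  by rewrite eqn_pmul2l // => /eqP.
have {}fE : f * 2 = c * (q.+2 * n).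
  have /eqP : c.+1 * (f * 2) = c.+1 * (c * (q.+2 * n)) by rewrite mulnCA fE uE; ring.
  by rewrite eqn_pmul2l // => /eqP.
have : 2 * b.+1 * u = b.+1 * (2 + 2 * (q.+1 * n) + c * (q.+2 * n)) + b * u.
  by rewrite {1}uS n2E -fE -f'E; ring.
rewrite uE; lia.
Qed.

(** As n is odd, 2 + n (q - 2) is prime to n and divides q c <= q (q - 1). With q <= n this forces n
    = q + 1 and then c = q - 1: the numbers of SL(2,q), where b is the order of a non-split
    torus. *)
Lemma Zassenhaus_arith q c n b : 8 <= q -> ~~ odd q -> odd n -> q <= n -> 0 < c ->
    c %| q - 1 -> b * (2 + n * (q - 2)) = q * n * c ->
  b = q + 1.
Proof.
move=> q8 q_even n_odd le_qn c_gt0 c_dvd; have [r qE] : exists r, q = r + 2.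
  by exists (q - 2); lia.
rewrite qE addnK in q8 q_even le_qn c_dvd * => bE.
have r_gt0 : 0 < r by lia.
have le_cq : c <= r + 1 by have := dvdn_leq _ c_dvd; lia.
have cop_n : coprime (2 + n * r) n.
  by rewrite coprime_sym /coprime addnC mulnC gcdnMDl -/(coprime _ _) coprimen2.
have dvd_qc : 2 + n * r %| (r + 2) * c.
  by rewrite -(Gauss_dvdl _ cop_n) -mulnA (mulnC c) mulnA -bE dvdn_mull.
have le_qc : 2 + n * r <= (r + 2) * (r + 1).
  apply: leq_trans (leq_mul (leqnn _) le_cq).
  by apply: dvdn_leq dvd_qc; rewrite muln_gt0 c_gt0 addn2.
have nE : n = r + 3.
  have : n * r <= (r + 3) * r by lia.
  rewrite leq_pmul2r // => le_n.
  have : n != r + 2 by apply: contraNneq q_even => <-.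
  by lia.
have bE' : b * (r + 1) = (r + 3) * c.
  have : (r + 2) * (b * (r + 1)) = (r + 2) * ((r + 3) * c).
    by rewrite nE in bE; rewrite [RHS]mulnA -bE; ring.
  by move/eqP; rewrite eqn_pmul2l ?addn2 // => /eqP.
have r1E : r + 2 - 1 = r + 1 by lia.
have cop_q1 : coprime (r + 1) (r + 3).
  have -> : r + 3 = r + 1 + 2 by lia.
  rewrite /coprime gcdnDl -/(coprime _ _) coprimen2.
  by move: q_even; rewrite !oddD addbF addbT => ->.
have : r + 1 %| c by rewrite -(Gauss_dvdr _ cop_q1) -bE' dvdn_mull.
move/(dvdn_leq c_gt0) => le_qc'; have cE : c = r + 1 by lia.
by rewrite cE in bE'; move/eqP: bE'; rewrite eqn_pmul2r ?addn1 // => /eqP; lia.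
Qed.

Lemma class_lower a e f u : 5 <= a -> e \in [:: 1; 2; 4] ->
  f * (a * e) = (a - 1) * u -> u <= 5 * f.
Proof.
move=> a5 e124 fE; have [b1 b2 b4 _ _] := class_arith a5 fE.
by move: e124; rewrite !inE => /or3P[] /eqP De; [have := b1 De | have := b2 De | have := b4 De]; lia.
Qed.

(** The case where U ∩ B is a 2-group of order [s]: the elements of odd order, 1 included, make up u
    / s. A class of proportion at least 4 / (5 e) fits only if e >= s, hence e = s by the remaining
    restrictions, and leaves no room for a second one. *)
Lemma self_centralised_arith s u a e f o : s * (1 + o) = u -> 0 < u ->
    [\/ s = 2, s = 4 | 8 <= s] -> 5 <= a -> e \in [:: 1; 2; 4] -> (s = 2 -> e <> 4) ->
    f * (a * e) = (a - 1) * u -> f <= o -> (f < o -> 5 * f + u <= 5 * o) ->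
  u = a * e.
Proof.
move=> uE u_gt0 s_cases a5 e124 s2e4 fE le_fo lt_fo.
have [b1 b2 b4 _ _] := class_arith a5 fE; have le5 := class_lower a5 e124 fE.
have eq_fo k : s = k -> e = k -> f = o -> 0 < k -> u = a * e.
  move=> sk ek fo k_gt0; have : k * (f * a) + k * a = k * (a * (1 + o)) by rewrite fo; ring.
  have -> : k * (f * a) = (a - 1) * u by rewrite -fE ek; ring.
  have -> : k * (a * (1 + o)) = a * u by rewrite -uE sk; ring.
  by case: a a5 {fE b1 b2 b4} => // a _; rewrite subSS subn0 ek; lia.
have se : s = e /\ (s = 4 \/ s = 2 /\ 2 * u <= 5 * f).
  move: e124; rewrite !inE; case: s_cases => [s2|s4|s8].
  - rewrite s2 in uE; case/or3P=> /eqP De; first by have := b1 De; lia.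
      by have := b2 De; lia.
    by case: (s2e4 s2 De).
  - rewrite s4 in uE; case/or3P=> /eqP De; last by lia.
      by have := b1 De; lia.
    by have := b2 De; lia.
  have : 8 * (1 + o) <= u by rewrite -uE leq_mul2r s8 orbT.
  lia.
have fo : f = o.
  apply/eqP; rewrite eqn_leq le_fo leqNgt; apply/negP => /lt_fo {}lt_fo.
  by case: se => _ [s4|[s2 le2]]; [rewrite s4 in uE | rewrite s2 in uE]; lia.
case: se => De _; apply: (eq_fo s) => //.
by case: s_cases => [->|->|]; lia.
Qed.

(** A second class would put at least u / 5 elements into o - f, whereas 1 + (o - f) = u / (s c) is
    at most u / 10. *)
Lemma Frobenius_arith_full s c u n2 o f : 10 <= s * c ->
    u = 1 + n2 + o -> n2 * (s * c) = (s - 1) * u -> f * c = (c - 1) * u -> f <= o ->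
    (f < o -> 5 * f + u <= 5 * o) ->
  u = s * c.
Proof.
move=> sc10 uE n2E fE le_fo lt_fo.
have [s_gt0 c_gt0] : 0 < s /\ 0 < c by apply/andP; rewrite -muln_gt0; lia.
have := Frobenius_arith fE s_gt0 c_gt0 uE n2E le_fo.
case: (ltnP f o) => [/lt_fo {}lt_fo uE' | ge_fo ->].
  have : 10 * (1 + (o - f)) <= u by rewrite uE' leq_mul2r sc10 orbT.
  lia.
have -> : o - f = 0 by lia.
by rewrite addn0 muln1.
Qed.

Lemma one_class_arith q n c f u n2 : 2 <= q -> 2 <= c -> 0 < n ->
    u = q * c * n -> u = 1 + n2 + f -> n2 * (q * c) = (q - 1) * u ->
    f * (c * 2) = (c - 1) * u -> False.
Proof.
case: q => [|[|q]] // _; case: c => [|[|c]] // _; case: n => // n _.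
rewrite !subSS !subn0 => uE uS n2E fE.
have {}n2E : n2 = q.+1 * n.+1.
  have /eqP : q.+2 * c.+2 * n2 = q.+2 * c.+2 * (q.+1 * n.+1) by rewrite mulnC n2E uE; ring.
  by rewrite eqn_pmul2l // => /eqP.
have {}fE : f * 2 = c.+1 * (q.+2 * n.+1).
  have /eqP : c.+2 * (f * 2) = c.+2 * (c.+1 * (q.+2 * n.+1)) by rewrite mulnCA fE uE; ring.
  by rewrite eqn_pmul2l // => /eqP.
have : 2 * u = 2 + 2 * (q.+1 * n.+1) + c.+1 * (q.+2 * n.+1).
  by rewrite {1}uS n2E -fE; ring.
rewrite uE; lia.
Qed.

Lemma two_class_max u f f' o : 2 * u <= 5 * f -> 4 * u <= 5 * f' -> f + f' <= o ->
  o < u -> False.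
Proof. lia. Qed.

Lemma three_class_max u f f' f'' o : 2 * u <= 5 * f -> 2 * u <= 5 * f' ->
  u <= 5 * f'' -> f + f' + f'' <= o -> o < u -> False.
Proof. lia. Qed.

Lemma odd_order_arith u o f a : 5 <= a -> u = 1 + o -> f * (a * 1) = (a - 1) * u ->
  f <= o -> (f < o -> exists f', f + f' <= o /\ 4 * u <= 5 * f') -> u = a * 1.
Proof.
move=> a5 uE fE le_fo lt_fo; have [/(_ erefl) b1 _ _ _ _] := class_arith a5 fE.
have fo : f = o.
  apply/eqP; rewrite eqn_leq le_fo leqNgt; apply/negP => /lt_fo[f' []].
  by move: b1 uE; clear; lia.
rewrite -fo in uE; case: a a5 fE {b1} => // a _; rewrite subSS subn0 uE; lia.
Qed.

(** [n2] counts the 2-elements other than 1 and [f] the non-identity elements of conjugates of H, so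
    q^3 (q - 1)^2 / 2 elements of odd order remain. *)
Lemma total_arith q g n2 o f : 2 <= q -> g = q ^ 2 * (q ^ 2 + 1) * (q - 1) ->
    g = 1 + n2 + o -> n2 * (q ^ 2 * (q - 1)) = (q ^ 2 - 1) * g ->
    f * ((q - 1) * 2) = (q - 1 - 1) * g ->
  2 * o = 2 * f + q ^ 3 * (q - 1) ^ 2.
Proof.
have -> : q ^ 2 - 1 = (q - 1) * (q + 1) by rewrite -subn_sqr exp1n.
case: q => [|[|r]] // _; rewrite !subSS !subn0 addn1.
move=> gE gS n2E fE; have r1_gt0 : 0 < r.+2 ^ 2 * r.+1 by rewrite muln_gt0 sqrn_gt0.
have {}n2E : n2 = r.+1 * r.+3 * (r.+2 ^ 2 + 1).
  apply/eqP; rewrite -(eqn_pmul2r r1_gt0) n2E gE; apply/eqP; ring.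
have {}fE : 2 * f = r * (r.+2 ^ 2 * (r.+2 ^ 2 + 1)).
  apply/eqP; rewrite -(eqn_pmul2l (ltn0Sn r)); apply/eqP.
  transitivity (f * (r.+1 * 2)); first ring.
  by rewrite fE gE; ring.
have : 2 * g = 2 + 2 * n2 + 2 * o by rewrite gS; ring.
rewrite gE n2E fE; lia.
Qed.

(** The elements of odd order not conjugate into H make up between 2/5 and 1/2 of G: too few for a
    class with e = 1, too many for a single class with e = 4. *)
Lemma rest_bounds q g o f : 8 <= q -> g = q ^ 2 * (q ^ 2 + 1) * (q - 1) ->
  2 * o = 2 * f + q ^ 3 * (q - 1) ^ 2 ->
  [/\ f < o, 2 * o < 2 * f + g & 4 * g + 10 * f < 10 * o].
Proof.
move=> q8; have [r ->] : exists r, q = r + 8 by exists (q - 8); rewrite subnK.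
have -> : r + 8 - 1 = r + 7 by lia.
move=> gE oE; rewrite -mulnn in gE; rewrite !expnS expn0 in oE; split; nia.
Qed.

(** Serves to exclude that the rest is a single class with e = 2, because q + 1 is prime to q^2 +
    1. *)
Lemma index2_rest_arith q g b f : 2 <= q -> 0 < b -> g = q ^ 2 * (q ^ 2 + 1) * (q - 1) ->
  2 * f = q ^ 3 * (q - 1) ^ 2 -> f * (b * 2) = (b - 1) * g -> q ^ 2 + 1 = b * (q + 1).
Proof.
case: q => [|[|r]] // _; case: b => // b _; rewrite !subSS !subn0 => gE fE bE.
have c_gt0 : 0 < r.+2 ^ 2 * r.+1 by rewrite muln_gt0 sqrn_gt0.
have : r.+2 ^ 2 * r.+1 * (b.+1 * (r.+2 * r.+1)) = r.+2 ^ 2 * r.+1 * (b * (r.+2 ^ 2 + 1)).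
  transitivity (b * g); last by rewrite gE; ring.
  by rewrite -bE; transitivity (b.+1 * (2 * f)); [rewrite fE | ]; ring.
by move/eqP; rewrite eqn_pmul2l // => /eqP; lia.
Qed.

Lemma index4_rest_arith q g k1 k2 f1 f2 : 2 <= q -> 0 < k1 -> 0 < k2 ->
    g = q ^ 2 * (q ^ 2 + 1) * (q - 1) -> 2 * (f1 + f2) = q ^ 3 * (q - 1) ^ 2 ->
    f1 * (k1 * 4) = (k1 - 1) * g -> f2 * (k2 * 4) = (k2 - 1) * g ->
  (k1 + k2) * (q ^ 2 + 1) = 2 * (q + 1) * (k1 * k2).
Proof.
case: q => [|[|r]] // _; case: k1 => // k1 _; case: k2 => // k2 _.
rewrite !subSS !subn0 => gE fE f1E f2E.
have c_gt0 : 0 < r.+2 ^ 2 * r.+1 by rewrite muln_gt0 sqrn_gt0.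
have : r.+2 ^ 2 * r.+1 * (2 * k1.+1 * k2.+1 * (r.+2 * r.+1)) =
    r.+2 ^ 2 * r.+1 * ((k1 * k2.+1 + k2 * k1.+1) * (r.+2 ^ 2 + 1)).
  transitivity ((k1 * g) * k2.+1 + (k2 * g) * k1.+1); last by rewrite gE; ring.
  rewrite -f1E -f2E; transitivity (2 * k1.+1 * k2.+1 * (2 * (f1 + f2))); last ring.
  by rewrite fE; ring.
by move/eqP; rewrite eqn_pmul2l // => /eqP; lia.
Qed.

(** With w = (q^2 + 1) / (k1 k2) the equation becomes w (k1 + k2) = 2 (q + 1). The right side is
    prime to q^2 + 1, a multiple of w, so w = 1. *)
Lemma torus_order_arith q k1 k2 : ~~ odd q -> 0 < k1 -> 0 < k2 -> coprime k1 k2 ->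
    k1 %| q ^ 2 + 1 -> k2 %| q ^ 2 + 1 ->
    (k1 + k2) * (q ^ 2 + 1) = 2 * (q + 1) * (k1 * k2) ->
  k1 * k2 = q ^ 2 + 1 /\ k1 + k2 = 2 * (q + 1).
Proof.
move=> q_even k1_gt0 k2_gt0 cop dvd1 dvd2 kE.
have /dvdnP[w Dw] : k1 * k2 %| q ^ 2 + 1 by rewrite Gauss_dvd ?dvd1.
have wE : w * (k1 + k2) = 2 * (q + 1).
  have k_gt0 : 0 < k1 * k2 by rewrite muln_gt0 k1_gt0.
  by apply/eqP; rewrite -(eqn_pmul2r k_gt0) -kE Dw; apply/eqP; ring.
have w_dvd : w %| q ^ 2 + 1 by rewrite Dw dvdn_mulr.
have cop2 : coprime (q ^ 2 + 1) (2 * (q + 1)).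
  by rewrite coprimeMr coprime_sqr_succ_succ // coprimen2 addn1 oddS oddX (negPf q_even).
have w1 : w = 1.
  apply/eqP; rewrite -dvdn1 -(eqP cop2) dvdn_gcd w_dvd -wE dvdn_mulr //.
by rewrite w1 !mul1n in wE Dw; rewrite Dw.
Qed.

(** Sum and product give (k1 - k2)^2 = 4 (q + 1)^2 - 4 (q^2 + 1) = 8 q = (2 r)^2. *)
Lemma torus_order_solve q r k1 k2 : r <= q -> r ^ 2 = 2 * q -> k2 <= k1 ->
  k1 * k2 = q ^ 2 + 1 -> k1 + k2 = 2 * (q + 1) -> k1 = q + r + 1 /\ k2 = q - r + 1.
Proof.
move=> le_rq rE le21 kM kD; have [d Dd] : exists d, k1 = k2 + d by exists (k1 - k2); rewrite subnKC.
have : (d ^ 2 = (2 * r) ^ 2)%N.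
  have : (k1 + k2) ^ 2 = 4 * (k1 * k2) + d ^ 2 by rewrite Dd; ring.
  rewrite kD kM (expnMn 2 r) rE.
  have -> : (2 * (q + 1)) ^ 2 = 4 * (q ^ 2 + 1) + 2 ^ 2 * (2 * q) by ring.
  by move/addnI.
move/eqP; rewrite eqn_exp2r // => /eqP; lia.
Qed.

Lemma rest_overflow g o fh s : 2 * o < 2 * fh + g -> 3 * g <= 5 * s -> fh + s <= o -> False.
Proof. lia. Qed.

Lemma rest_underflow g o fh f : 4 * f <= g -> 4 * g + 10 * fh < 10 * o -> fh + f < o.
Proof. lia. Qed.

(** The bound 4 (2 q + 1) covers the orders of all normalisers of centralisers of odd elements, so
    that none of these contains a conjugate of B. *)
Lemma torus_small q k : 8 <= q -> k <= 4 * (2 * q + 1) -> k < q ^ 2 * (q - 1).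
Proof.
move=> q8 le_k; apply: leq_ltn_trans le_k _.
apply: (@leq_trans (8 * 8 * (q - 1))); first by lia.
by rewrite leq_mul2r -mulnn leq_mul ?orbT.
Qed.

Lemma torus_orders_neq q r : 8 <= q -> ~~ odd q -> 0 < r -> r <= q ->
  [/\ (q - 1) * 2 != (q + r + 1) * 4, (q - 1) * 2 != (q - r + 1) * 4 &
      (q + r + 1) * 4 != (q - r + 1) * 4].
Proof.
move=> q8 q_even r_gt0 le_rq; have [m Dm] : exists m, q = m.*2.
  by exists q./2; rewrite even_halfK.
by split; apply/eqP; lia.
Qed.

Lemma count2_arith q k e m n : 2 <= q -> 0 < e ->
    q ^ 2 * (q ^ 2 + 1) * (q - 1) = k * e * m -> m * (k * 1) = (q ^ 2 + 1) * (q - 1) * n ->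
  n = q ^ 2 %/ e.
Proof.
move=> q2 e_gt0 gE mE; have c_gt0 : 0 < (q ^ 2 + 1) * (q - 1).
  by rewrite muln_gt0 addn1 subn_gt0.
suffices -> : q ^ 2 = n * e by rewrite mulnK.
apply/eqP; rewrite -(eqn_pmul2r c_gt0) mulnA gE; apply/eqP.
transitivity (e * (m * (k * 1))); [ring | rewrite mE; ring].
Qed.

Lemma count4_arith q k m n : 2 <= q -> 
    q ^ 2 * (q ^ 2 + 1) * (q - 1) = k * 4 * m -> m * (k * 2) = (q ^ 2 + 1) * (q ^ 2 - q) * n ->
  n = q %/ 2.
Proof.
move=> q2 gE mE; have c_gt0 : 0 < q * (q ^ 2 + 1) * (q - 1).
  by rewrite !muln_gt0 addn1 subn_gt0 q2 (ltn_trans _ q2).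
suffices -> : q = n * 2 by rewrite mulnK.
apply/eqP; rewrite -(eqn_pmul2r c_gt0); apply/eqP.
transitivity (q ^ 2 * (q ^ 2 + 1) * (q - 1)); first ring.
rewrite gE; transitivity (2 * (m * (k * 2))); [ring | rewrite mE].
have -> : q ^ 2 - q = q * (q - 1) by rewrite mulnBr muln1 mulnn.
ring.
Qed.

Lemma torus_orders_mul q r : r <= q -> r ^ 2 = 2 * q -> (q + r + 1) * (q - r + 1) = q ^ 2 + 1.
Proof.
move=> le_rq rE; have [d Dd] : exists d, q = r + d by exists (q - r); rewrite subnKC.
have dE : q - r = d by rewrite Dd addKn.
have -> : q ^ 2 = r ^ 2 + 2 * r * d + d ^ 2 by rewrite Dd; ring.
by rewrite dE rE Dd; ring.
Qed.

Lemma torus_orders_coprime q r : ~~ odd q -> r <= q -> r ^ 2 = 2 * q ->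
  coprime (q + r + 1) (q - r + 1).
Proof.
move=> q_even le_rq rE; have r_even : ~~ odd r.
  by move: (congr1 odd rE); rewrite oddX oddM /= => ->.
have -> : q + r + 1 = q - r + 1 + 2 * r by lia.
rewrite coprime_sym /coprime gcdnDl -/(coprime _ _) coprimeMr coprimen2.
have -> /= : odd (q - r + 1) by rewrite addn1 oddS oddB // (negPf r_even) (negPf q_even).
have Dr : r = 2 * r./2 by rewrite mul2n even_halfK.
have /dvdnP[m Dm] : r %| q - r.
  rewrite dvdn_sub //; apply/dvdnP; exists r./2; apply/eqP.
  by rewrite -(eqn_pmul2l (isT : 0 < 2)) -rE mulnA -Dr mulnn.
by rewrite Dm coprime_sym /coprime gcdnMDl gcdn1.
Qed.

(** The conjugate of B above x counts in full; every other maximal subgroup adds its order less that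
    of its intersection with it, which is 2 or 4. *)
Lemma card_sol2_arith q r : 8 <= q -> ~~ odd q -> r <= q ->
  q ^ 2 * (q - 1) + q ^ 2 %/ 2 * ((q - 1) * 2 - 2) + q ^ 2 %/ 4 * ((q + r + 1) * 4 - 4)
    + q ^ 2 %/ 4 * ((q - r + 1) * 4 - 4) = q ^ 2 * (4 * q - 3).
Proof.
move=> q8 q_even le_rq; have [k Dk] : exists k, q = 2 * k.
  by exists q./2; rewrite mul2n even_halfK.
have q2E : q ^ 2 = k ^ 2 * 4 by rewrite Dk; ring.
have -> : q ^ 2 %/ 2 = k ^ 2 * 2 by rewrite q2E -[4]/(2 * 2) mulnA mulnK.
have -> : q ^ 2 %/ 4 = k ^ 2 by rewrite q2E mulnK.
rewrite q2E; move: (k ^ 2) => m; rewrite -!mulnA -!mulnDr; congr (_ * _); lia.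
Qed.

Lemma card_sol4_arith q r : 8 <= q -> ~~ odd q -> r <= q ->
  q ^ 2 * (q - 1) + q %/ 2 * ((q + r + 1) * 4 - 4) + q %/ 2 * ((q - r + 1) * 4 - 4)
    = q ^ 2 * (q + 3).
Proof.
move=> q8 q_even le_rq; have [k Dk] : exists k, q = k * 2.
  by exists q./2; rewrite muln2 even_halfK.
have -> : q %/ 2 = k by rewrite Dk mulnK.
rewrite -addnA -mulnDr; have -> : (q + r + 1) * 4 - 4 + ((q - r + 1) * 4 - 4) = 2 * q * 4 by lia.
have -> : k * (2 * q * 4) = q ^ 2 * 4 by rewrite [in RHS]Dk -mulnn Dk; ring.
by rewrite -mulnDr; congr (_ * _); lia.
Qed.

End Arith.

(** * The Bruhat decomposition and centralisers *)

Section Suzuki.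

Import GroupScope.

(** In the matrix model S consists of the S(a,b), Z of the S(0,b), H of the diagonal matrices, and t
    is the matrix T. [tiBt] makes H the stabiliser of two points in the action on the conjugates of
    B. [conj4] allows inversion because conjugation in B carries an element of order 4 only to half
    of [S :\: Z]. *)
Variables (gT : finGroupType) (G S Z H : {group gT}) (t : gT) (p : nat).
Local Notation q := (2 ^ p)%N.
Local Notation B := (S <*> H).

Hypotheses (p_pr : prime p) (p_odd : odd p).
Hypotheses (cardS : #|S| = (q ^ 2)%N) (cardZ : #|Z| = q) (cardH : #|H| = (q - 1)%N).
Hypotheses (cycH : cyclic H) (sZS : Z \subset S).
Hypotheses (sqS : {in S, forall x, x ^+ 2 \in Z}).
Hypotheses (ZE : {in S, forall x, (x ^+ 2 == 1) = (x \in Z)}).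
Hypotheses (nSH : H \subset 'N(S)) (regSH : {in H^#, forall h, 'C_S[h] = 1}).
Hypotheses (tG : t \in G) (tt : t * t = 1) (tH : {in H, forall h, h ^ t = h^-1}).
Hypotheses (tiBt : B :&: B :^ t = H) (sBG : B \subset G).
Hypotheses (GE : G \subset B :|: B :* t * S).
Hypotheses (conjZ : {in Z^# &, forall x y, exists2 g, g \in H & y = x ^ g}).
Hypotheses (conj4 : {in S :\: Z &, forall x y,
  exists2 g, g \in B & y = x ^ g \/ y = x^-1 ^ g}).
Hypotheses (torus : forall x, x \in G -> x != 1 -> #[x] %| (q ^ 2 + 1)%N ->
  cyclic 'C_G[x] /\ #|'N_G('C_G[x]) : 'C_G[x]| <= 4).

Lemma q_even : ~~ odd q.
Proof. by rewrite oddX orbF -lt0n prime_gt0. Qed.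

Lemma q_gt0 : 0 < q. Proof. by rewrite expn_gt0. Qed.

Lemma q_ge8 : 8 <= q.
Proof.
rewrite -[8]/(2 ^ 3)%N leq_exp2l //; have := prime_gt1 p_pr.
by case: p p_odd => [|[|[|]]].
Qed.

Lemma q1_gt0 : 0 < q - 1.
Proof. by rewrite subn_gt0 (leq_trans _ q_ge8). Qed.

Lemma q_mod3 : (q = 2 %[mod 3])%N.
Proof.
have -> : q = (4 ^ p./2 * 2)%N.
  by rewrite -{1}[p]odd_double_half p_odd add1n expnS -muln2 (mulnC p./2) expnM mulnC.
by rewrite -modnMml -modnXm exp1n.
Qed.

Lemma S_neq1 : S :!=: 1.
Proof. by rewrite trivg_card1 cardS (eqn_exp2r _ 1) // gtn_eqF // (leq_trans _ q_ge8). Qed.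

Lemma H_neq1 : H :!=: 1.
Proof. by rewrite trivg_card1 cardH gtn_eqF // ltn_subRL (leq_trans _ q_ge8). Qed.

Lemma coprime_SH : coprime #|S| #|H|.
Proof. by rewrite cardS cardH coprimeXl // coprime_pred ?q_gt0. Qed.

Lemma tiSH : S :&: H = 1. Proof. exact: coprime_TIg coprime_SH. Qed.

Lemma sdB : S ><| H = B.
Proof. by rewrite sdprodEY ?tiSH. Qed.

Lemma BE : S * H = B. Proof. by case/sdprodP: sdB. Qed.

Lemma cardB : #|B| = (q ^ 2 * (q - 1))%N.
Proof. by rewrite -(sdprod_card sdB) cardS cardH. Qed.

Lemma sSB : S \subset B. Proof. exact: joing_subl. Qed.
Lemma sHB : H \subset B. Proof. exact: joing_subr. Qed.
Lemma sSG : S \subset G. Proof. exact: subset_trans sSB sBG. Qed.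
Lemma sHG : H \subset G. Proof. exact: subset_trans sHB sBG. Qed.
Lemma nsSB : S <| B. Proof. by case/sdprod_context: sdB. Qed.

Lemma FrobB : [Frobenius B = S ><| H].
Proof. by apply/Frobenius_semiregularP; rewrite ?sdB ?S_neq1 ?H_neq1. Qed.

Lemma tiH_conj : {in H^# & B, forall h b, (h ^ b \in H) = (b \in H)}.
Proof.
have [_ _ /normedTI_memJ_P[_ _ tiH]] := and3P FrobB.
move=> h b Hh Bb; rewrite -(tiH h b Hh Bb) !inE conjg_eq1.
by have /setD1P[-> _] := Hh.
Qed.

Lemma B_elt x : x \in B -> x \notin S ->
  exists h s, [/\ h \in H^#, s \in S & x = h ^ s].
Proof.
move=> Bx nSx; have /and3P[/eqP covB _ _] := Frobenius_partition FrobB.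
move: Bx; rewrite -covB => /bigcupP[_ /setU1P[-> | /imsetP[s Ss ->]] Xx].
  by rewrite Xx in nSx.
by have /imsetP[h Hh ->] := Xx; exists h, s.
Qed.

Lemma tV : t^-1 = t.
Proof. by apply: (mulgI t); rewrite mulgV tt. Qed.

Lemma tiBSt : B :&: S :^ t = 1.
Proof.
have tiHSt : H :&: S :^ t = 1.
  by rewrite coprime_TIg // cardJg coprime_sym coprime_SH.
apply/trivgP; rewrite -tiHSt subsetI subsetIr andbT.
have tiBt_sub : B :&: B :^ t \subset H by rewrite tiBt.
by apply: subset_trans tiBt_sub; rewrite setIS // conjSg sSB.
Qed.

Lemma t_notin_B : t \notin B.
Proof.
apply/negP => Bt; have : #|B :&: B :^ t| = #|H| by rewrite tiBt.
rewrite conjGid // setIid cardB cardH -{2}[q - 1]mul1n => /eqP.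
by rewrite eqn_pmul2r ?q1_gt0 // (eqn_exp2r _ 1) // gtn_eqF // (leq_trans _ q_ge8).
Qed.

Lemma G_eq : G :=: B :|: B :* t * S.
Proof.
apply/eqP; rewrite eqEsubset GE subUset sBG /=.
by rewrite !mul_subG ?sSG ?sub1set.
Qed.

Lemma card_BtS : #|B :* t * S| = (q ^ 2 * (q - 1) * q ^ 2)%N.
Proof.
have -> : B :* t * S = (B * S :^ t) :* t.
  by rewrite conjsgE tV -!mulgA mulg_set1 tt mulg1.
rewrite card_rcoset TI_cardMg ?tiBSt // cardJg cardB cardS //.
Qed.

Lemma cardG : #|G| = (q ^ 2 * (q ^ 2 + 1) * (q - 1))%N.
Proof.
rewrite G_eq cardsU card_BtS cardB.
have -> : B :&: (B :* t * S) = set0.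
  apply/setP=> x; rewrite !inE; apply/negP => /andP[Bx].
  case/mulsgP=> _ s /rcosetP[b Bb ->] Ss Dx.
  case/negP: t_notin_B; rewrite -(groupMl _ Bb) -(groupMr _ (subsetP sSB s Ss)).
  by rewrite -Dx.
rewrite cards0 subn0; ring.
Qed.

Lemma G_notinB g : g \in G -> g \notin B ->
  exists b s, [/\ b \in B, s \in S & g = b * t * s].
Proof.
rewrite G_eq inE => /orP[-> //|/mulsgP[_ s /rcosetP[b Bb ->] Ss ->] _].
by exists b, s.
Qed.

Lemma tiBSg g : g \in G -> g \notin B -> B :&: S :^ g = 1.
Proof.
move=> Gg /(G_notinB Gg)[b [s [Bb Ss ->]]]; rewrite -mulgA conjsgM.
rewrite (normsP (normal_norm nsSB) b Bb) conjsgM.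
by have := congr1 (fun A => A :^ s) tiBSt; rewrite /= conjIg conjs1g (conjGid (subsetP sSB s Ss)).
Qed.

Lemma NGS : 'N_G(S) = B.
Proof.
apply/eqP; rewrite eqEsubset andbC subsetI sBG (normal_norm nsSB) /=.
apply/subsetP=> g /setIP[Gg nSg]; apply: contraT => nBg.
have := tiBSg Gg nBg; rewrite (normP nSg) => tiSB; case/eqP: S_neq1.
by rewrite -tiSB; apply/esym/setIidPr/sSB.
Qed.

Lemma tiS : normedTI S^# G B.
Proof.
apply/normedTI_P; split.
- by rewrite setD_eq0 subG1 S_neq1.
- by rewrite normD1 NGS.
move=> g Gg; apply: contraR => nBg; rewrite -setI_eq0 conjD1g -setDIl.
rewrite setD_eq0; apply: subset_trans (setSI _ sSB) _.
by rewrite (tiBSg Gg nBg).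
Qed.

Lemma cop_S_plus : coprime (q ^ 2) (q ^ 2 + 1).
Proof. by rewrite coprimeXl // coprime_sym coprime_sqr_succ. Qed.

Lemma cop_H_plus : coprime (q - 1) (q ^ 2 + 1).
Proof. by rewrite coprime_sym coprime_sqr_succ_pred ?q_even ?q_gt0. Qed.

Lemma cop_S_H : coprime (q ^ 2) (q - 1).
Proof. by rewrite -cardS -cardH coprime_SH. Qed.

Lemma sylS : 2.-Sylow(G) S.
Proof.
have m_gt0 : 0 < q ^ 2 by rewrite sqrn_gt0 q_gt0.
have h_gt0 : 0 < (q ^ 2 + 1) * (q - 1) by rewrite muln_gt0 q1_gt0 addn1.
rewrite pHallE sSG cardS cardG -mulnA (partnM _ m_gt0 h_gt0).
have odd_part : odd ((q ^ 2 + 1) * (q - 1)).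
  by rewrite oddM addn1 oddS oddX (negPf q_even) /= oddB ?q_gt0 // (negPf q_even).
rewrite part_pnat_id ?pnatX ?pnat_id // part_p'nat ?muln1 //.
  by rewrite eqxx.
by rewrite -odd_2'nat.
Qed.

(** As q - 1 is prime to q^2 (q^2 + 1), a Sylow r-subgroup of H is one of G. *)
Lemma sylH r : prime r -> r %| (q - 1)%N ->
  forall x, x \in G -> r.-elt x -> exists2 g, g \in G & x \in H :^ g.
Proof.
move=> r_pr r_q x Gx r_x; have [R sylR] := Sylow_exists r H.
have r_odd2 : coprime r (q ^ 2 * (q ^ 2 + 1)).
  by apply: coprime_dvdl r_q _; rewrite coprimeMr coprime_sym cop_S_H cop_H_plus.
have sylRG : r.-Sylow(G) R.
  rewrite pHallE (subset_trans (pHall_sub sylR) sHG) (card_Hall sylR).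
  have m_gt0 : 0 < q ^ 2 * (q ^ 2 + 1) by rewrite muln_gt0 sqrn_gt0 q_gt0 addn1.
  have h_gt0 := q1_gt0.
  rewrite cardH cardG (partnM _ m_gt0 h_gt0).
  have -> : ((q ^ 2 * (q ^ 2 + 1))`_r = 1)%N.
    by apply: part_p'nat; rewrite p'natE // -prime_coprime.
  by rewrite mul1n eqxx.
have sxG : <[x]> \subset G by rewrite cycle_subG.
have [g Gg sxR] := Sylow_subJ sylRG sxG r_x; exists g => //.
by rewrite -cycle_subG (subset_trans sxR) // conjSg (pHall_sub sylR).
Qed.

Lemma elt2_S x : x \in G -> 2.-elt x -> exists2 g, g \in G & x \in S :^ g.
Proof.
move=> Gx x2; have sxG : <[x]> \subset G by rewrite cycle_subG.
by have [g Gg] := Sylow_subJ sylS sxG x2; rewrite cycle_subG; exists g.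
Qed.

Lemma memJS x y g : g \in G -> x \in S :^ g -> x != 1 -> y \in G ->
  x ^ y \in S :^ g -> y \in B :^ g.
Proof.
have [_ _ tiSJ] := normedTI_memJ_P tiS.
rewrite !mem_conjg => Gg Sx nt_x Gy Sxy; rewrite -(tiSJ (x ^ g^-1)) ?groupJ ?groupV //.
  by rewrite -conjJg !inE conjg_eq1 conjg_eq1 nt_x Sxy.
by rewrite !inE conjg_eq1 nt_x.
Qed.

Lemma cent_S x y g : g \in G -> x \in S :^ g -> x != 1 -> y \in 'C_G[x] ->
  y \in B :^ g.
Proof.
move=> Gg Sx nt_x /setIP[Gy /cent1P cxy].
by apply: (memJS Gg Sx nt_x Gy); rewrite /conjg -cxy mulKg.
Qed.

Lemma H_odd : odd #|H|.
Proof. by rewrite cardH oddB ?q_gt0 // (negPf q_even). Qed.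

Lemma B_even x : x \in B -> ~~ odd #[x] -> x \in S.
Proof.
move=> Bx; apply: contraR => /(B_elt Bx)[h [s [/setD1P[_ Hh] Ss ->]]].
by rewrite orderJ (dvdn_odd (order_dvdG Hh)) ?H_odd.
Qed.

(** A power of x is an involution in some conjugate of S; x centralises it, hence lies in that
    conjugate of B, whose elements of even order are in S. In particular every element of even order
    is a 2-element. *)
Lemma even_S x : x \in G -> ~~ odd #[x] -> exists2 g, g \in G & x \in S :^ g.
Proof.
move=> Gx x_even; pose z := x ^+ (#[x] %/ 2).
have x2 : 2 %| #[x] by rewrite dvdn2.
have oz : #[z] = 2 by rewrite orderXdiv ?dvdn_div // divnA // mulKn.
have Gz : z \in G by rewrite groupX.
have [g Gg Sz] : exists2 g, g \in G & z \in S :^ g.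
  by apply: elt2_S => //; rewrite /p_elt oz.
have nt_z : z != 1 by rewrite -order_eq1 oz.
exists g => //; have : x \in B :^ g.
  apply: (cent_S Gg Sz nt_z); rewrite inE Gx; apply/cent1P.
  exact: commuteX.
by rewrite !mem_conjg => /B_even -> //; rewrite orderJ.
Qed.

Lemma tH_neq h : h \in H^# -> h ^ t != h.
Proof.
case/setD1P=> nt_h Hh; apply: contraNneq nt_h; rewrite tH // => hV.
rewrite -order_eq1 -dvdn1 -(eqP (_ : coprime #[h] 2)).
  by rewrite dvdn_gcd dvdnn order_dvdn expgS expg1 -{1}hV mulVg /=.
by rewrite coprimen2 (dvdn_odd (order_dvdG Hh)) ?H_odd.
Qed.

Lemma H_conjS h s : h \in H^# -> s \in S -> h ^ s \in H -> s = 1.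
Proof.
move=> Hh Ss; rewrite tiH_conj // ?(subsetP sSB) // => Hs.
by apply/set1P; rewrite -set1gE -tiSH inE Ss.
Qed.

(* The conjugates of B are the point stabilisers of a doubly transitive action in
   which an element of H^# fixes exactly two points, those of B and B :^ t. *)
Lemma H_twopoints h g : h \in H^# -> g \in G -> h ^ g \in H -> g \in H \/ g * t \in H.
Proof.
move=> Hh Gg Hhg; have [nt_h Hh'] := setD1P Hh.
have [Bg|nBg] := boolP (g \in B); first by left; rewrite -(tiH_conj Hh).
have Hh2 : h ^ g \in H^# by rewrite !inE conjg_eq1 nt_h.
have [b [s [Bb Ss Dg]]] := G_notinB Gg nBg.
have Bhg : h ^ g \in B :&: B :^ (t * s).
  rewrite inE (subsetP sHB) // Dg -mulgA conjgM memJ_conjg.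
  by rewrite groupJ // (subsetP sHB).
have tiBts : B :&: B :^ (t * s) = H :^ s.
  have := congr1 (fun A => A :^ s) tiBt.
  by rewrite /= conjIg (conjGid (subsetP sSB s Ss)) conjsgM.
have s1 : s = 1.
  apply: invg_inj; rewrite invg1; apply: (H_conjS Hh2); rewrite ?groupV //.
  by rewrite -mem_conjg -tiBts.
right; rewrite Dg s1 mulg1 -mulgA tt mulg1 -(tiH_conj Hh) //.
have -> : h ^ b = (h ^ g) ^ t^-1 by rewrite Dg s1 mulg1 -conjgM mulgK.
by rewrite tV tH ?groupV.
Qed.

(** The second alternative of [H_twopoints] would give h ^ t = h, but t inverts h, which has odd
    order. *)
Lemma cent_H h : h \in H^# -> 'C_G[h] = H.
Proof.
move=> Hh; have [nt_h Hh'] := setD1P Hh; apply/eqP; rewrite eqEsubset andbC.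
apply/andP; split.
  by rewrite subsetI sHG sub_cent1 (subsetP (cyclic_abelian cycH)).
apply/subsetP=> g /setIP[Gg /cent1P cgh].
have hg : h ^ g = h by rewrite /conjg -cgh mulKg.
have Hhg : h ^ g \in H by rewrite hg.
have [//|Hgt] := H_twopoints Hh Gg Hhg.
have := tH_neq Hh; rewrite -{1}hg -conjgM.
suffices -> : h ^ (g * t) = h by rewrite eqxx.
by apply/conjg_fixP/commgP; apply: (centsP (cyclic_abelian cycH)).
Qed.

Lemma norm_H : 'N_G(H) = H :|: H :* t.
Proof.
apply/setP=> g; apply/setIP/setUP=> [[Gg nHg]|].
  have [h Hh] : exists h, h \in H^#.
    by apply/set0Pn; rewrite setD_eq0 subG1 H_neq1.
  have [nt_h Hh'] := setD1P Hh.
  have Hhg : h ^ g \in H by rewrite memJ_norm.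
  have [Hg|Hgt] := H_twopoints Hh Gg Hhg; first by left.
  by right; rewrite mem_rcoset tV.
have nHt : t \in 'N(H).
  by rewrite inE; apply/subsetP=> _ /imsetP[h Hh ->]; rewrite tH ?groupV.
case=> [Hg|/rcosetP[h Hh ->]]; split.
- exact: (subsetP sHG).
- exact: (subsetP (normG H)).
- by rewrite groupM // (subsetP sHG).
by rewrite groupM // (subsetP (normG H)).
Qed.

Lemma card_norm_H : #|'N_G(H)| = (2 * (q - 1))%N.
Proof.
rewrite norm_H cardsU card_rcoset cardH.
have -> : H :&: H :* t = set0.
  apply/setP=> x; rewrite !inE mem_rcoset tV; apply/negP=> /andP[Hx].
  by rewrite groupMl // => Ht; case/negP: t_notin_B; rewrite (subsetP sHB).
by rewrite cards0 subn0 addnn mul2n.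
Qed.

Lemma cent_HJ h g : g \in G -> h \in H :^ g -> h != 1 -> 'C_G[h] = H :^ g.
Proof.
move=> Gg; rewrite mem_conjg => Hh nt_h.
have Hh' : h ^ g^-1 \in H^# by rewrite !inE conjg_eq1 nt_h.
rewrite -(cent_H Hh') conjIg (conjGid Gg) -cent1J conjgKV //.
Qed.

Lemma prime_elt (x : gT) r : prime r -> r %| #[x] -> #[x ^+ (#[x] %/ r)] = r.
Proof.
move=> r_pr r_x; rewrite orderXdiv ?dvdn_div // divnA // mulKn //.
Qed.

Lemma cent_prime_H x r : x \in G -> prime r -> r %| #[x] -> r %| (q - 1)%N ->
  exists2 g, g \in G & x \in H :^ g.
Proof.
move=> Gx r_pr r_x r_q; pose y := x ^+ (#[x] %/ r).
have oy : #[y] = r by apply: prime_elt.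
have Gy : y \in G by rewrite groupX.
have [|g Gg Hy] := sylH r_pr r_q Gy; first by rewrite /p_elt oy pnat_id.
have nt_y : y != 1 by rewrite -order_eq1 oy neq_ltn prime_gt1 ?orbT.
exists g => //; rewrite -(cent_HJ Gg Hy nt_y) inE Gx; apply/cent1P; exact: commuteX.
Qed.

Lemma cent_prime_S x r : x \in G -> prime r -> r %| #[x] -> r %| q ->
  exists2 g, g \in G & x \in S :^ g.
Proof.
move=> Gx r_pr r_x; rewrite Euclid_dvdX // dvdn_prime2 // => /andP[/eqP r2 _].
by apply: even_S; rewrite // -dvdn2 -r2.
Qed.

Lemma odd_type x : x \in G -> odd #[x] ->
  (exists2 g, g \in G & x \in H :^ g) \/ #[x] %| (q ^ 2 + 1)%N.
Proof.
move=> Gx x_odd; have [|copH] := boolP (~~ coprime #[x] (q - 1)).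
  rewrite coprime_has_primes ?order_gt0 ?q1_gt0 //.
  rewrite negbK => /hasP[r]; rewrite !mem_primes => /and3P[r_pr _ r_q] /and3P[_ _ r_x].
  by left; apply: (cent_prime_H Gx r_pr r_x r_q).
right; have : #[x] %| #|G| by apply: order_dvdG.
rewrite cardG Gauss_dvdl; last by rewrite negbK in copH.
by rewrite Gauss_dvdr // !coprimeXr // coprimen2.
Qed.

(** A prime dividing both the order of the centraliser and q^2 (q - 1) yields an element y of that
    order commuting with x. Then x lies in a conjugate of B or of H, whose orders are prime to q^2 +
    1. *)
Lemma card_cent_torus x : x \in G -> x != 1 -> #[x] %| (q ^ 2 + 1)%N ->
  #|'C_G[x]| %| (q ^ 2 + 1)%N.
Proof.
move=> Gx nt_x ox.
have dvd_ox r : prime r -> r %| #[x] -> r %| (q ^ 2 + 1)%N.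
  by move=> _ r_x; apply: dvdn_trans ox.
have cop_x n : coprime n (q ^ 2 + 1) -> #[x] %| n -> x = 1.
  move=> cop dvd_n; apply/eqP; rewrite -order_eq1 -dvdn1 -(eqP cop).
  by rewrite dvdn_gcd dvd_n.
have no_prime r : prime r -> r %| #|'C_G[x]| -> ~~ (r %| q ^ 2 * (q - 1)).
  move=> r_pr /(Cauchy r_pr)[y /setIP[Gy /cent1P cyx] oy].
  have nt_y : y != 1 by rewrite -order_eq1 oy neq_ltn prime_gt1 ?orbT.
  have Cx : x \in 'C_G[y] by rewrite inE Gx; apply/cent1P.
  rewrite Euclid_dvdM // Euclid_dvdX //= andbT; apply/negP=> /orP[] r_q.
    have [|g Gg Sy] := @cent_prime_S y r Gy r_pr _ r_q; first by rewrite oy.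
    case/eqP: nt_x; apply: (cop_x #|B|).
      by rewrite cardB coprimeMl cop_S_plus cop_H_plus.
    by rewrite -(cardJg _ g) order_dvdG // (cent_S Gg Sy).
  have [|g Gg Hy] := @cent_prime_H y r Gy r_pr _ r_q; first by rewrite oy.
  case/eqP: nt_x; apply: (cop_x #|H|); first by rewrite cardH cop_H_plus.
  have Hx : x \in H :^ g by rewrite -(cent_HJ Gg Hy nt_y).
  by rewrite -(cardJg _ g) order_dvdG.
have copC : coprime #|'C_G[x]| (q ^ 2 * (q - 1)).
  rewrite coprime_has_primes ?cardG_gt0 ?muln_gt0 ?sqrn_gt0 ?q_gt0 ?q1_gt0 //.
  apply/hasPn=> r; rewrite !mem_primes => /and3P[r_pr _ r_q].
  by apply/negP=> /and3P[_ _ /(no_prime r r_pr)]; rewrite r_q.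
have : #|'C_G[x]| %| #|G| by rewrite cardSg ?subsetIl.
by rewrite cardG mulnAC Gauss_dvdr.
Qed.

(** These are the properties shared by the conjugates of H and the other centralisers of odd
    elements; the counting treats both kinds alike. *)
Lemma odd_cent x : x \in G -> x != 1 -> odd #[x] ->
  [/\ cyclic 'C_G[x], odd #|'C_G[x]|, #|'N_G('C_G[x]) : 'C_G[x]| <= 4 &
    (exists2 g, g \in G & 'C_G[x] = H :^ g) \/ #|'C_G[x]| %| (q ^ 2 + 1)%N].
Proof.
move=> Gx nt_x x_odd; have [[g Gg Hx]|ox] := odd_type Gx x_odd.
  rewrite (cent_HJ Gg Hx nt_x) cyclicJ cardJg H_odd; split=> //; last by left; exists g.
  have -> : 'N_G(H :^ g) = 'N_G(H) :^ g by rewrite conjIg (conjGid Gg) normJ.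
  rewrite indexJg -divgS ?subsetI ?sHG ?normG //.
  by rewrite card_norm_H cardH mulnK ?q1_gt0.
have dvdC := card_cent_torus Gx nt_x ox.
have [cycC leC] := torus Gx nt_x ox; split=> //; last by right.
by apply: dvdn_odd dvdC _; rewrite addn1 oddS oddX (negPf q_even).
Qed.

(** Both centralisers are abelian and contain x and y, so each lies in the other. Hence distinct
    centralisers of odd elements meet trivially. *)
Lemma odd_cent_dvd x y : x \in G -> x != 1 -> odd #[x] -> y \in 'C_G[x] -> y != 1 ->
  'C_G[y] = 'C_G[x].
Proof.
move=> Gx nt_x x_odd Cy nt_y; have [cycC oddC _ _] := odd_cent Gx nt_x x_odd.
have Gy : y \in G by case/setIP: Cy.
have y_odd : odd #[y] by apply: dvdn_odd (order_dvdG Cy) _.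
have [cycCy _ _ _] := odd_cent Gy nt_y y_odd.
have cxy : commute x y by case/setIP: Cy => _ /cent1P cyx; apply: commute_sym.
apply/eqP; rewrite eqEsubset !subsetI !subsetIl /= !sub_cent1.
rewrite (subsetP (cyclic_abelian cycCy)) ?(subsetP (cyclic_abelian cycC)) //.
by rewrite inE Gx; apply/cent1P.
Qed.

(** q is 2 modulo 3 because p is odd. Consequently a nontrivial subgroup of odd order has at least 5
    elements, and the index of a centraliser in its normaliser, at most 4, is not 3. *)
Lemma G_not3 : ~~ (3 %| #|G|).
Proof.
have pr3 : prime 3 by [].
rewrite cardG !(Euclid_dvdM _ _ pr3) orbb !negb_or -andbA.
apply/and3P; split.
- by rewrite /dvdn q_mod3.
- by rewrite /dvdn -modnDml -modnXm q_mod3.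
by rewrite -eqn_mod_dvd ?q_gt0 // q_mod3.
Qed.

Lemma odd_sub_ge5 (A : {group gT}) : A \subset G -> odd #|A| -> A :!=: 1 -> 5 <= #|A|.
Proof.
move=> sAG oddA; rewrite trivg_card1; move: (cardSg sAG) oddA (cardG_gt0 A).
case: #|A| => [|[|[|[|[|n]]]]] //= A3 _ _ _.
by case/negP: G_not3.
Qed.

Lemma norm_cent_index x : x \in G -> x != 1 -> odd #[x] ->
  #|'N_G('C_G[x]) : 'C_G[x]| \in [:: 1; 2; 4]%N.
Proof.
move=> Gx nt_x x_odd; have [_ _ le4 _] := odd_cent Gx nt_x x_odd.
have : #|'N_G('C_G[x]) : 'C_G[x]| %| #|G|.
  by rewrite (dvdn_trans (dvdn_indexg _ _)) // cardSg ?subsetIl.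
move: le4; have := indexg_gt0 'N_G('C_G[x]) 'C_G[x].
case: #|_ : _| => [|[|[|[|[|n]]]]] //= _ _ dvd3.
by case/negP: G_not3.
Qed.

Lemma cent_H_index x g : g \in G -> 'C_G[x] = H :^ g ->
  #|'N_G('C_G[x]) : 'C_G[x]| = 2.
Proof.
move=> Gg ->; have -> : 'N_G(H :^ g) = 'N_G(H) :^ g by rewrite conjIg (conjGid Gg) normJ.
rewrite indexJg -divgS ?subsetI ?sHG ?normG //.
by rewrite card_norm_H cardH mulnK ?q1_gt0.
Qed.

(* The involution acts without non-trivial fixed points, hence by inversion. *)
Lemma norm_cent_invol x z : x \in G -> x != 1 -> odd #[x] ->
  z \in 'N_G('C_G[x]) -> #[z] = 2 -> {in 'C_G[x], forall y, y ^ z = y^-1}.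
Proof.
move=> Gx nt_x x_odd /setIP[Gz nCz] oz y Cy.
have [cycC oddC _ _] := odd_cent Gx nt_x x_odd.
have Cyz : y ^ z \in 'C_G[x] by rewrite memJ_norm.
apply: (mulgI y); rewrite mulgV; apply: contraTeq isT => nt_w.
have Cw : y * y ^ z \in 'C_G[x] by rewrite groupM.
have z2 : z * z = 1 by rewrite -(expg_order z) oz.
have wz : (y * y ^ z) ^ z = y * y ^ z.
  rewrite conjMg -conjgM z2 conjg1.
  exact: (centsP (cyclic_abelian cycC)).
have : z \in 'C_G[y * y ^ z].
  by rewrite inE Gz; apply/cent1P/commute_sym/commgP/conjg_fixP.
rewrite (odd_cent_dvd Gx nt_x x_odd Cw nt_w) => Cz.
by have := dvdn_odd (order_dvdG Cz) oddC; rewrite oz.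
Qed.

(** Q embeds in N / C and has order at most 4. Two involutions of Q both invert x, so their quotient
    centralises x and lies in C ∩ Q = 1; a group of order 4 with only one involution is cyclic. *)
Lemma norm_cent_2group x (Q : {group gT}) : x \in G -> x != 1 -> odd #[x] ->
    Q \subset 'N_G('C_G[x]) -> 2.-group Q ->
  cyclic Q /\ #|Q| %| #|'N_G('C_G[x]) : 'C_G[x]|.
Proof.
move=> Gx nt_x x_odd sQN Q2; have [cycC oddC le4 _] := odd_cent Gx nt_x x_odd.
have tiCQ : 'C_G[x] :&: Q = 1.
  apply: coprime_TIg; rewrite coprime_sym (pnat_coprime Q2) // -odd_2'nat //.
have nCQ : Q \subset 'N('C_G[x]) := subset_trans sQN (subsetIr _ _).
have dvdQ : #|Q| %| #|'N_G('C_G[x]) : 'C_G[x]|.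
  rewrite (card_isog (quotient_isog nCQ tiCQ)) -card_quotient ?subsetIr //.
  by rewrite cardSg ?quotientS.
split=> //.
have uniq_inv z1 z2 : z1 \in Q -> z2 \in Q -> #[z1] = 2 -> #[z2] = 2 -> z1 = z2.
  move=> Qz1 Qz2 oz1 oz2; have inv1 := norm_cent_invol Gx nt_x x_odd (subsetP sQN _ Qz1) oz1.
  have inv2 := norm_cent_invol Gx nt_x x_odd (subsetP sQN _ Qz2) oz2.
  apply/eqP; rewrite eq_mulgV1 -in_set1 -set1gE -tiCQ inE.
  rewrite [z1 * _ \in Q]groupM ?groupV // andbT.
  have Cx : x \in 'C_G[x] by rewrite inE Gx cent1id.
  have Gz1 : z1 \in G by have /setIP[] := subsetP sQN _ Qz1.
  have Gz2 : z2 \in G by have /setIP[] := subsetP sQN _ Qz2.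
  rewrite inE groupM ?groupV //; apply/cent1P/commute_sym/commgP/conjg_fixP.
  rewrite conjgM inv1 // conjVg; apply: invg_inj; rewrite invgK.
  by rewrite -[RHS](conjgK z2) conjVg inv2 // invgK.
have [n cardQ] := p_natP Q2; have le_n2 : n <= 2.
  by rewrite -(leq_exp2l n 2 (ltnSn 1)) -cardQ (leq_trans (dvdn_leq _ dvdQ)) ?indexg_gt0.
case: n cardQ le_n2 => [|[|[|//]]] cardQ _.
- by rewrite (card1_trivg cardQ) cyclic1.
- by rewrite prime_cyclic // cardQ.
apply: contraT => ncyc; have nt4 y : y \in Q -> y != 1 -> #[y] = 2.
  move=> Qy nt_y; have := order_dvdG Qy; rewrite cardQ.
  have pr2 : prime 2 by [].
  case/(dvdn_pfactor _ _ pr2) => -[|[|[|//]]] _ oy.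
  - by move: nt_y; rewrite -order_eq1 oy.
  - by [].
  case/negP: ncyc; apply/cyclicP; exists y; apply/eqP.
  by rewrite eq_sym eqEcard cycle_subG Qy cardQ [#|<[y]>|]oy.
have [y Qy nt_y] : exists2 y, y \in Q & y != 1.
  by apply/trivgPn; rewrite trivg_card1 cardQ.
have : Q \subset [set 1; y].
  apply/subsetP=> z Qz; rewrite !inE; have [//|nt_z] := eqVneq z 1.
  by rewrite (uniq_inv z y) ?nt4 ?eqxx ?orbT.
by move/subset_leq_card; rewrite cards2 cardQ; case: (_ != _).
Qed.

(** An element of U outside B puts [S :^ t] into U, and the Bruhat decomposition then puts all
    conjugates of S there, hence all involutions. Every h in H is the product of t and t h, whose
    squares are trivial. *)
Lemma gen_from_S (U : {group gT}) : U \subset G -> S \subset U -> ~~ (U \subset B) ->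
  U :=: G.
Proof.
move=> sUG sSU /subsetPn[k Uk nBk]; have Gk := subsetP sUG k Uk.
have [b [s [Bb Ss Dk]]] := G_notinB Gk nBk.
have sStU : S :^ t \subset U.
  have : (S :^ k) :^ s^-1 \subset U.
    by rewrite -(conjGid (groupVr (subsetP sSU s Ss))) conjSg -(conjGid Uk) conjSg.
  by rewrite Dk !conjsgM (normsP (normal_norm nsSB) b Bb) conjsgK.
have sSgU g : g \in G -> S :^ g \subset U.
  move=> Gg; have [Bg|nBg] := boolP (g \in B).
    by rewrite (normsP (normal_norm nsSB)).
  have [b1 [s1 [Bb1 Ss1 ->]]] := G_notinB Gg nBg.
  rewrite -mulgA conjsgM (normsP (normal_norm nsSB) b1 Bb1) conjsgM.
  by rewrite -(conjGid (subsetP sSU s1 Ss1)) conjSg.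
have invU z : z \in G -> z * z = 1 -> z \in U.
  move=> Gz zz; have [g Gg Sz] : exists2 g, g \in G & z \in S :^ g.
    apply: elt2_S => //; rewrite /p_elt; apply: (@pnat_dvd _ 2) => //.
    by rewrite order_dvdn expgS expg1 zz.
  exact: subsetP (sSgU g Gg) z Sz.
have Ut : t \in U by apply: invU.
have sHU : H \subset U.
  apply/subsetP=> h Hh; rewrite -(groupMl _ Ut); apply: invU.
    by rewrite groupM // (subsetP sHG).
  have -> : t * h * (t * h) = h ^ t * h by rewrite /conjg tV !mulgA.
  by rewrite tH // mulVg.
apply/eqP; rewrite eqEsubset sUG (subset_trans GE) // subUset join_subG sSU sHU /=.
by rewrite !mul_subG ?sub1set // join_subG sSU.
Qed.

Lemma Z_char_norm : B \subset 'N(Z).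
Proof.
apply/subsetP=> b Bb; rewrite inE; apply/subsetP=> _ /imsetP[z Zz ->].
have Sz := subsetP sZS z Zz.
have Szb : z ^ b \in S by rewrite memJ_norm // (subsetP (normal_norm nsSB)).
by rewrite -ZE // -conjXg conjg_eq1 ZE.
Qed.

Lemma cent_B x : x \in B -> x \notin S -> exists2 s, s \in S & 'C_G[x] = H :^ s.
Proof.
move=> Bx nSx; have [h [s [Hh Ss ->]]] := B_elt Bx nSx; exists s => //.
have [nt_h Hh'] := setD1P Hh.
by apply: cent_HJ; rewrite ?(subsetP sSG) // ?memJ_conjg // conjg_eq1.
Qed.

(** * Counting in a proper subgroup *)

Section Subgroup.

Variable U : {group gT}.
Hypothesis sUG : U \subset G.

Definition odd_part := [set x in U^# | odd #[x]].
Definition cent_class x := class_support ('C_U[x]^#) U.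

Lemma cent_sub x : 'C_U[x] = U :&: 'C_G[x].
Proof. by rewrite setIA (setIidPl sUG). Qed.

Lemma odd_partP x : reflect [/\ x \in U, x \in G, x != 1 & odd #[x]] (x \in odd_part).
Proof.
rewrite !inE; apply: (iffP andP) => [[/andP[-> Ux] ->]|[-> _ -> ->]] //.
by rewrite (subsetP sUG).
Qed.

Lemma cent_odd_part x y : x \in odd_part -> y \in 'C_U[x]^# -> y \in odd_part.
Proof.
case/odd_partP=> Ux Gx nt_x x_odd /setD1P[nt_y Cy].
have [_ oddC _ _] := odd_cent Gx nt_x x_odd.
apply/odd_partP; split=> //; first by case/setIP: Cy.
  by rewrite (subsetP sUG) //; case/setIP: Cy.
by apply: dvdn_odd oddC; rewrite order_dvdG //; move: Cy; rewrite cent_sub => /setIP[].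
Qed.

Lemma cent_eq x y : x \in odd_part -> y \in 'C_U[x]^# -> 'C_G[y] = 'C_G[x].
Proof.
case/odd_partP=> Ux Gx nt_x x_odd /setD1P[nt_y].
by rewrite cent_sub => /setIP[_ Cy]; apply: odd_cent_dvd.
Qed.

Lemma cent_conj x g : g \in G -> 'C_G[x ^ g] = 'C_G[x] :^ g.
Proof. by move=> Gg; rewrite conjIg (conjGid Gg) cent1J. Qed.

Lemma norm_cent_sub x : x \in odd_part -> 'N_U('C_U[x]) = U :&: 'N_G('C_G[x]).
Proof.
move=> Ox; have [Ux Gx nt_x x_odd] := odd_partP _ Ox.
apply/setP=> g; apply/setIP/setIP=> -[Ug nCg]; split=> //.
  have Gg := subsetP sUG g Ug; rewrite inE Gg; apply/normP.
  rewrite -cent_conj // (cent_eq Ox) // in_setD1 conjg_eq1 nt_x /=.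
  by rewrite memJ_norm // inE Ux cent1id.
by rewrite cent_sub inE conjIg conjGid // setIS //; case/setIP: nCg => _ /normP->.
Qed.

Lemma normedTI_cent x : x \in odd_part ->
  normedTI ('C_U[x]^#) U 'N_U('C_U[x]).
Proof.
move=> Ox; have [Ux Gx nt_x x_odd] := odd_partP _ Ox.
apply/normedTI_P; split.
- by apply/set0Pn; exists x; rewrite in_setD1 nt_x inE Ux cent1id.
- by rewrite normD1 subsetI subsetIl subsetIr.
move=> g Ug; rewrite -setI_eq0 => /set0Pn[y /setIP[Cy Cyg]].
suffices: g \in U :&: 'N_G('C_G[x]) by rewrite -norm_cent_sub.
move: Cyg; rewrite mem_conjg => Cyg; have Gg := subsetP sUG g Ug.
rewrite inE Ug inE Gg; apply/normP.
by rewrite -{1}(cent_eq Ox Cyg) cent_conj ?groupV // conjsgKV (cent_eq Ox Cy).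
Qed.

Lemma cent_class_sub x : x \in odd_part -> cent_class x \subset odd_part.
Proof.
move=> Ox; apply/subsetP=> _ /imset2P[y g Cy Ug ->].
have /odd_partP[Uy Gy nt_y y_odd] := cent_odd_part Ox Cy.
apply/odd_partP; rewrite groupJ // groupJ ?(subsetP sUG) // conjg_eq1 orderJ.
by split.
Qed.

Lemma cent_class_disjoint x y : x \in odd_part -> y \in odd_part ->
  y \notin cent_class x -> [disjoint cent_class x & cent_class y].
Proof.
move=> Ox Oy; apply: contraR; rewrite -setI_eq0 => /set0Pn[z /setIP[]].
case/imset2P=> c g Cc Ug -> /imset2P[d k Cd Uk eq_z].
have Gg := subsetP sUG g Ug; have Gk := subsetP sUG k Uk.
have [Uy Gy nt_y _] := odd_partP _ Oy.
have Gkg : k * g^-1 \in G by rewrite groupM ?groupV.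
have : y ^ (k * g^-1) \in 'C_U[x]^#.
  have Uyk : y ^ (k * g^-1) \in U by rewrite groupJ ?groupM ?groupV.
  rewrite in_setD1 conjg_eq1 nt_y inE Uyk /=.
  suffices: y ^ (k * g^-1) \in 'C_G[x] by case/setIP.
  rewrite -(cent_eq Ox Cc) -(conjgK g c) eq_z -conjgM (cent_conj _ Gkg).
  by rewrite memJ_conjg (cent_eq Oy Cd) inE Gy cent1id.
move=> Cyk; have -> : y = (y ^ (k * g^-1)) ^ (g * k^-1).
  by rewrite -conjgM -mulgA mulKg mulgV conjg1.
by rewrite memJ_class_support // groupM ?groupV.
Qed.

Lemma card_cent_class x (a := #|'C_U[x]|) (e := #|'N_U('C_U[x]) : 'C_U[x]|) :
    x \in odd_part ->
  [/\ 5 <= a, odd a, e \in [:: 1; 2; 4]%N, #|'N_U('C_U[x])| = (a * e)%N &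
      (#|cent_class x| * (a * e) = (a - 1) * #|U|)%N]
  /\ e %| #|'N_G('C_G[x]) : 'C_G[x]|.
Proof.
move=> Ox; have [Ux Gx nt_x x_odd] := odd_partP _ Ox.
have [_ oddC _ _] := odd_cent Gx nt_x x_odd.
have sCC : 'C_U[x] \subset 'C_G[x] by apply: setSI.
have oddCU : odd a := dvdn_odd (cardSg sCC) oddC.
have sCG : 'C_U[x] \subset G by apply: subset_trans sUG; apply: subsetIl.
have ntC : 'C_U[x] != 1.
  by apply/trivgPn; exists x; rewrite // inE Ux cent1id.
have a5 : 5 <= a by apply: odd_sub_ge5.
have sCN : 'C_U[x] \subset 'N_U('C_U[x]) by rewrite subsetI subsetIl normG.
have cardN : #|'N_U('C_U[x])| = (a * e)%N by rewrite -(Lagrange sCN).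
(* ['N_U('C_U[x])] meets ['C_G[x]] in ['C_U[x]], so [e] is the order of a subgroup of the quotient
   of ['N_G('C_G[x])] by ['C_G[x]]. *)
have e_dvd : e %| #|'N_G('C_G[x]) : 'C_G[x]|.
  have sNN : 'N_U('C_U[x]) \subset 'N_G('C_G[x]).
    by have := subsetIr U 'N_G('C_G[x]); rewrite -norm_cent_sub.
  have De : e = #|'N_U('C_U[x]) / 'C_G[x]|.
    rewrite card_quotient; last by rewrite (subset_trans sNN) ?subsetIr.
    have capE : 'N_U('C_U[x]) :&: 'C_G[x] = 'C_U[x].
      apply/eqP; rewrite eqEsubset; apply/andP; split; last by rewrite subsetI sCN.
      by apply: subset_trans (setSI _ (subsetIl _ _)) _; rewrite -cent_sub.
    by rewrite -indexgI /= capE.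
  rewrite De -[X in _ %| X]card_quotient ?subsetIr // cardSg // quotientS //.
have e124 : e \in [:: 1; 2; 4]%N.
  have := norm_cent_index Gx nt_x x_odd; rewrite !inE => /or3P[] /eqP De;
  by move: e_dvd; rewrite De; case: (e) => [|[|[|[|[|]]]]].
split=> //; split=> //; have := card_support_normedTI (normedTI_cent Ox).
have -> : #|'C_U[x]^#| = a - 1 by rewrite /a (cardsD1 1 'C_U[x]) group1 add1n subn1.
rewrite /cent_class => ->; rewrite -cardN -mulnA; congr (_ * _)%N.
by rewrite mulnC Lagrange ?subsetIl.
Qed.

(* The odd part of U is exhausted by adding the classes one at a time to a union of classes. *)
Definition saturated (W : {set gT}) := W \subset odd_part /\
  {in odd_part, forall z, z \notin W -> [disjoint W & cent_class z]}.

Lemma saturated_class x : x \in odd_part -> saturated (cent_class x).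
Proof.
by move=> Ox; split=> [|z Oz]; [apply: cent_class_sub | apply: cent_class_disjoint].
Qed.

Lemma saturated_new W : saturated W -> #|W| < #|odd_part| ->
  exists z, [/\ z \in odd_part, z \notin W, saturated (W :|: cent_class z) &
    #|W :|: cent_class z| = (#|W| + #|cent_class z|)%N].
Proof.
move=> [sWO satW] ltW; have [z Oz nWz] : exists2 z, z \in odd_part & z \notin W.
  by apply/subsetPn; apply: contraL ltW => /subset_leq_card; rewrite -leqNgt.
exists z; split=> //; last first.
  by apply/eqP; have := satW z Oz nWz; rewrite -leq_card_setU => /eqP->.
split; first by rewrite subUset sWO cent_class_sub.
move=> y Oy; rewrite inE negb_or => /andP[nWy nzy].
rewrite -setI_eq0 setIUl setU_eq0 !setI_eq0 satW //=.
exact: cent_class_disjoint.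
Qed.

Lemma new_class x : x \in odd_part -> #|cent_class x| < #|odd_part| ->
  exists y, [/\ y \in odd_part, y \notin cent_class x &
    #|cent_class x| + #|cent_class y| <= #|odd_part|].
Proof.
move=> Ox /(saturated_new (saturated_class Ox))[y [Oy nxy [sub _] cardxy]].
by exists y; rewrite -cardxy subset_leq_card.
Qed.

Lemma new_class2 x y : x \in odd_part -> y \in odd_part -> y \notin cent_class x ->
    #|cent_class x| + #|cent_class y| < #|odd_part| ->
  exists z, [/\ z \in odd_part, z \notin cent_class x, z \notin cent_class y &
    #|cent_class x| + #|cent_class y| + #|cent_class z| <= #|odd_part|].
Proof.
move=> Ox Oy nxy ltxy; have sat_x := saturated_class Ox.
have /eqP cardxy : #|cent_class x :|: cent_class y| == (#|cent_class x| + #|cent_class y|)%N.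
  by have [_ /(_ y Oy nxy)] := sat_x; rewrite -leq_card_setU.
have sat_xy : saturated (cent_class x :|: cent_class y).
  split=> [|z Oz]; first by rewrite subUset !cent_class_sub.
  rewrite inE negb_or => /andP[nxz nyz].
  by rewrite -setI_eq0 setIUl setU_eq0 !setI_eq0 !cent_class_disjoint.
rewrite -cardxy in ltxy *; have [z [Oz + [sub _] cardxyz]] := saturated_new sat_xy ltxy.
rewrite inE negb_or => /andP[nxz nyz].
by exists z; rewrite -cardxyz subset_leq_card.
Qed.

Definition contained := (exists2 g, g \in G & U \subset B :^ g) \/
  (exists x, [/\ x \in G, x != 1, odd #[x] & U \subset 'N_G('C_G[x])]).

Lemma norm_full x : x \in odd_part -> #|U| = #|'N_U('C_U[x])| -> contained.
Proof.
move=> Ox cardU; have [Ux Gx nt_x x_odd] := odd_partP _ Ox; right; exists x; split=> //.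
have := subsetIr U 'N_G('C_G[x]); rewrite -norm_cent_sub //.
by have /eqP -> : 'N_U('C_U[x]) == U by rewrite eqEcard subsetIl -cardU leqnn.
Qed.

(** The indices e divide |U| and are therefore 1, so a class fills at least 4/5 of U and there is
    room for only one. *)
Lemma contained_odd : odd #|U| -> contained.
Proof.
move=> oddU; have [U1|ntU] := eqVneq U 1%G.
  by left; exists 1; rewrite // U1 sub1G.
have oddE y : y \in U -> y != 1 -> y \in odd_part.
  move=> Uy nt_y; apply/odd_partP; split; rewrite ?(subsetP sUG) //.
  exact: dvdn_odd (order_dvdG Uy) oddU.
have [x Ux nt_x] := trivgPn _ ntU; have Ox := oddE x Ux nt_x.
have e1 y : y \in odd_part -> #|'N_U('C_U[y]) : 'C_U[y]| = 1%N.
  move=> Oy; have [[_ _ e124 _ _] _] := card_cent_class Oy.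
  have : odd #|'N_U('C_U[y]) : 'C_U[y]|.
    by apply: dvdn_odd (dvdn_indexg _ _) _; apply: dvdn_odd oddU; rewrite cardSg ?subsetIl.
  by move: e124; rewrite !inE => /or3P[]/eqP->.
have uE : #|U| = (1 + #|odd_part|)%N.
  rewrite (cardsD1 1 U) group1; congr (_ + #|pred_of_set _|)%N.
  apply/setP=> y; rewrite in_setD1; apply/andP/idP => [[nt_y Uy]|/odd_partP[-> _ -> _]//].
  exact: oddE.
have [[a5 _ _ cardN fE] _] := card_cent_class Ox; rewrite e1 // in cardN fE.
apply: (norm_full Ox); rewrite cardN; apply: odd_order_arith a5 uE fE _ _.
  by rewrite subset_leq_card ?cent_class_sub.
case/(new_class Ox) => y [Oy _ le_xy]; exists #|cent_class y|; split=> //.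
have [[b5 _ _ _ f'E] _] := card_cent_class Oy; rewrite e1 // in f'E.
by have [/(_ erefl)] := class_arith b5 f'E.
Qed.

Hypothesis ntP : U :&: S != 1.
Local Notation P := (U :&: S).
Local Notation V := (U :&: B).

Lemma normedTI_P : normedTI P^# U V.
Proof.
apply/normedTI_P; split.
- by rewrite setD_eq0 subG1.
- rewrite normD1 subsetI subsetIl; apply/subsetP=> g /setIP[Ug Bg].
  rewrite inE conjIg conjGid // setIS //.
  by rewrite (normsP (normal_norm nsSB)).
move=> g Ug; rewrite -setI_eq0 => /set0Pn[y /setIP[Py]].
rewrite mem_conjg => Pyg; have Gg := subsetP sUG g Ug.
have /setD1P[nt_y /setIP[_ Sy]] := Py; have /setD1P[_ /setIP[_ Syg]] := Pyg.
rewrite inE Ug /=; suffices: g^-1 \in B :^ 1 by rewrite conjsg1 groupV.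
by apply: (@memJS y g^-1 1); rewrite ?conjsg1 ?groupV.
Qed.

(** A Sylow 2-subgroup of U above P lies in a conjugate of S. That conjugate shares a non-identity
    element of P with S, so it is S. *)
Lemma sylP : 2.-Sylow(U) P.
Proof.
have P2 : 2.-group P by apply: pgroupS (pHall_pgroup sylS); apply: subsetIr.
have [Q sylQ sPQ] := Sylow_superset (subsetIl U S) P2.
suffices sQP : Q \subset P.
  by have -> : P = Q by apply/eqP; rewrite eqEsubset sPQ.
have sQU := pHall_sub sylQ.
have [g Gg sQS] := Sylow_subJ sylS (subset_trans sQU sUG) (pHall_pgroup sylQ).
rewrite subsetI sQU /=; have [y Py nt_y] := trivgPn _ ntP.
have Bg : g^-1 \in B.
  have /setIP[_ Sy] := Py; have Sgy := subsetP sQS y (subsetP sPQ y Py).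
  suffices: g^-1 \in B :^ 1 by rewrite conjsg1.
  apply: (@memJS y g^-1 1); rewrite ?conjsg1 ?groupV //.
  by rewrite -mem_conjg.
by rewrite groupV in Bg; rewrite (normsP (normal_norm nsSB)) in sQS.
Qed.

Lemma even_partE : U^# :\: odd_part = class_support P^# U.
Proof.
apply/setP=> x; rewrite in_setD; apply/andP/imset2P => [[nOx /setD1P[nt_x Ux]]|].
  have Gx := subsetP sUG x Ux.
  have x_even : ~~ odd #[x] by apply: contra nOx => ?; apply/odd_partP.
  have [g Gg Sx] := even_S Gx x_even.
  have x2 : 2.-elt x.
    by apply: mem_p_elt Sx; rewrite pgroupJ (pHall_pgroup sylS).
  have sxU : <[x]> \subset U by rewrite cycle_subG.
  have [u Uu sxP] := Sylow_subJ sylP sxU x2.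
  exists (x ^ u^-1) u; rewrite ?conjgKV //.
  by rewrite in_setD1 conjg_eq1 nt_x -mem_conjg -cycle_subG.
case=> y u /setD1P[nt_y /setIP[Uy Sy]] Uu ->; split; last first.
  by rewrite in_setD1 conjg_eq1 nt_y groupJ.
apply/negP=> /odd_partP[_ _ _]; rewrite orderJ => y_odd.
have y2 : 2.-elt y by apply: mem_p_elt Sy; apply: pHall_pgroup sylS.
have y2' : 2^'.-elt y by rewrite /p_elt -odd_2'nat.
by case/eqP: nt_y; apply/eqP; rewrite -order_eq1 (pnat_1 y2 y2').
Qed.

Lemma card_parts : #|U| = (1 + #|class_support P^# U| + #|odd_part|)%N.
Proof.
rewrite (cardsD1 1 U) group1 -addnA; congr (_ + _)%N.
rewrite -even_partE -(cardsID odd_part U^#) addnC; congr (_ + #|pred_of_set _|)%N.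
by apply/setIidPr/subsetP=> x; rewrite inE => /andP[].
Qed.

Lemma card_even_part : (#|class_support P^# U| * #|V| = (#|P| - 1) * #|U|)%N.
Proof.
have := card_support_normedTI normedTI_P.
have -> : #|P^#| = #|P| - 1 by rewrite (cardsD1 1 P) group1 add1n subn1.
by move=> ->; rewrite -mulnA; congr (_ * _)%N; rewrite mulnC Lagrange ?subsetIl.
Qed.

Lemma normal_P : P <| V.
Proof.
rewrite /normal setIS ?sSB //= normsI //.
  by apply: subset_trans (subsetIl _ _) (normG _).
by apply: subset_trans (subsetIr _ _) (normal_norm nsSB).
Qed.

Lemma semireg_B (D : {group gT}) : D \subset B -> S :&: D = 1 -> semiregular S D.
Proof.
move=> sDB tiSD d /setD1P[nt_d Dd].
have nSd : d \notin S.
  by apply: contra nt_d => Sd; rewrite -in_set1 -set1gE -tiSD inE Sd.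
have [h [s [Hh Ss ->]]] := B_elt (subsetP sDB d Dd) nSd.
by rewrite cent1J -{1}(conjGid Ss) -conjIg regSH // conjs1g.
Qed.

Lemma V_compl : exists D : {group gT},
  [/\ P ><| D = V, D \subset V, cyclic D, #|D| %| (q - 1)%N & semiregular S D].
Proof.
have hallP : Hall V P.
  apply: (@pHall_Hall _ 2); apply: (pHall_subl _ _ sylP); last exact: subsetIl.
  by rewrite setIS ?sSB.
have /splitsP[D /complP[tiPD defV]] := SchurZassenhaus_split hallP normal_P.
have sDV : D \subset V by rewrite -defV mulG_subr.
have sDU : D \subset U := subset_trans sDV (subsetIl _ _).
have sDB : D \subset B := subset_trans sDV (subsetIr _ _).
have tiSD : S :&: D = 1.
  apply/trivgP; rewrite -tiPD subsetI subsetIr andbT subsetI subsetIl andbT.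
  by rewrite subIset // sDU orbT.
have nSD : D \subset 'N(S) := subset_trans sDB (normal_norm nsSB).
have isoD : D \isog D / S := quotient_isog nSD tiSD.
have sDH : D / S \subset H / S by rewrite -(quotientMidl S H) BE quotientS.
exists D; split=> //.
- by rewrite sdprodE // (subset_trans sDV) ?normal_norm ?normal_P.
- by rewrite (isog_cyclic isoD) (cyclicS sDH) ?quotient_cyclic.
- rewrite (card_isog isoD) (dvdn_trans (cardSg sDH)) // -cardH.
  exact: dvdn_quotient.
exact: semireg_B.
Qed.

(** ['C_G[x]] is a conjugate of H inside B, so ['C_U[x]] lies in V and meets P trivially. Its order
    is then at most |V : P| = |D|. *)
Lemma cent_compl (D : {group gT}) x : P ><| D = V -> cyclic D -> #|D| %| (q - 1)%N ->
  x \in D^# -> x \in odd_part /\ 'C_U[x] = D.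
Proof.
move=> sdV cycD dvdD /setD1P[nt_x Dx].
have [_ defV nPD tiPD] := sdprodP sdV.
have sDV : D \subset V by rewrite -defV mulG_subr.
have [sDU sDB] := subsetIP sDV.
have Ux := subsetP sDU x Dx; have Bx := subsetP sDB x Dx.
have oddD : odd #|D| by apply: dvdn_odd dvdD _; rewrite -cardH H_odd.
have x_odd : odd #[x] := dvdn_odd (order_dvdG Dx) oddD.
have Ox : x \in odd_part by apply/odd_partP; split; rewrite ?(subsetP sUG).
split=> //; have tiSD : S :&: D = 1.
  apply/trivgP; rewrite -tiPD subsetI subsetIr andbT subsetI subsetIl andbT.
  by rewrite subIset // sDU orbT.
have nSx : x \notin S.
  by apply: contra nt_x => Sx; rewrite -in_set1 -set1gE -tiSD inE Sx.
have [h [s [Hh Ss Dxh]]] := B_elt Bx nSx.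
have Gs := subsetP sSG s Ss.
have CxH : 'C_G[x] = H :^ s.
  by apply: cent_HJ => //; rewrite Dxh memJ_conjg; case/setD1P: Hh.
have sCV : 'C_U[x] \subset V.
  rewrite subsetI subsetIl /= cent_sub CxH subIset // orbC.
  by rewrite -(conjGid (subsetP sSB s Ss)) conjSg sHB.
have tiPC : P :&: 'C_U[x] = 1.
  apply/trivgP; rewrite -(semireg_B sDB tiSD (_ : x \in D^#)) ?in_setD1 ?nt_x //.
  by apply: setISS; apply: subsetIr.
apply/eqP; rewrite eq_sym eqEcard subsetI sDU sub_cent1.
rewrite (subsetP (cyclic_abelian cycD)) //=.
rewrite -(leq_pmul2l (cardG_gt0 (U :&: S))) -TI_cardMg //.
rewrite -(TI_cardMg tiPD) defV subset_leq_card // mul_subG //.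
by rewrite normal_sub ?normal_P.
Qed.

Lemma contained_B : #|U| = #|V| -> contained.
Proof.
move=> cardU; left; exists 1 => //; rewrite conjsg1.
by apply/setIidPl/eqP; rewrite eqEcard subsetIl -cardU leqnn.
Qed.

Lemma contained_cap_2group : #|V| = #|P| -> contained.
Proof.
move=> cardV; have [k cardP] := p_natP (pHall_pgroup sylP).
have P_gt0 := cardG_gt0 (U :&: S); have k_gt0 : 0 < k.
  by case: k cardP => // cardP; case/eqP: ntP; apply: card1_trivg.
have := small_two_arith P_gt0 card_parts; rewrite -{1}cardV => /(_ card_even_part) uE.
case: (posnP #|odd_part|) => [o0 | o_gt0].
  by apply: contained_B; rewrite cardV -uE o0 addn0 muln1.
have [x Ox] : exists x, x \in odd_part by apply/set0Pn; rewrite -card_gt0.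
have [[a5 _ e124 cardN fE] _] := card_cent_class Ox.
have f_le : #|cent_class x| <= #|odd_part| by rewrite subset_leq_card ?cent_class_sub.
have lt_f : #|cent_class x| < #|odd_part| -> 5 * #|cent_class x| + #|U| <= 5 * #|odd_part|.
  case/(new_class Ox) => y [Oy _ le_xy]; have [[b5 _ e'124 _ f'E] _] := card_cent_class Oy.
  by apply: (leq_trans (n := 5 * (#|cent_class x| + #|cent_class y|)));
     rewrite ?leq_mul2l // mulnDr leq_add2l (class_lower b5 e'124 f'E).
apply: (norm_full Ox); rewrite cardN.
apply: (self_centralised_arith uE (cardG_gt0 U)) f_le lt_f => //.
  case: k k_gt0 cardP => [|[|[|k]]] // _ ->; [by constructor 1 | by constructor 2|].
  by constructor 3; rewrite -[8]/(2 ^ 3)%N leq_exp2l.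
(* If e = 4 then 4 divides |U|, so its Sylow 2-subgroup P cannot have order 2. *)
move=> P2 e4; have : 2 ^ 2 %| #|P|.
  rewrite (card_Hall sylP) p_part dvdn_Pexp2l // -pfactor_dvdn ?cardG_gt0 //.
  by rewrite (dvdn_trans _ (cardSg (subsetIl U 'N('C_U[x])))) // cardN e4 dvdn_mull.
by rewrite P2.
Qed.

(* As p is prime, 2 has order p modulo every prime divisor of |D|. *)
Lemma card_regular_power_q (A D : {group gT}) : A \subset S -> A :!=: 1 -> D \subset 'N(A) ->
    semiregular S D -> D :!=: 1 -> #|D| %| (q - 1)%N ->
  exists2 m, m \in [:: 1; 2]%N & #|A| = (q ^ m)%N.
Proof.
move=> sAS ntA nAD regD ntD dvdD.
have A2 : 2.-group A := pgroupS sAS (pHall_pgroup sylS).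
have [k cardA] := p_natP A2.
have regAD : semiregular A D.
  by move=> d Dd; apply/trivgP; rewrite -(regD d Dd) setSI.
have := regular_norm_dvd_pred nAD regAD; rewrite cardA -subn1 => dvdD2.
have ltD : 1 < #|D| by rewrite cardG_gt1.
have r_pr := pdiv_prime ltD; have r_D := pdiv_dvd #|D|.
have := dvdn_pred_exp2_prime r_pr p_pr (dvdn_trans r_D dvdD) (dvdn_trans r_D dvdD2).
case/dvdnP=> m Dk; rewrite mulnC in Dk; exists m; last by rewrite Dk expnM.
have : #|A| <= #|S| by apply: subset_leq_card.
rewrite cardA cardS Dk expnM leq_exp2l ?(leq_trans _ q_ge8) //.
case: m Dk => [|[|[|]]] // Dk _; case/eqP: ntA; apply: card1_trivg.
by rewrite cardA Dk muln0.
Qed.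

(** q + 1 exceeds q - 1 and is prime to q^2 + 1, while [#|'C_G[x]|] equals the former or divides the
    latter. *)
Lemma cent_card_neq_succ x (A : {group gT}) : x \in odd_part -> A \subset 'C_G[x] ->
  #|A| != (q + 1)%N.
Proof.
case/odd_partP=> _ Gx nt_x x_odd sAC; apply/eqP=> cardA.
have dvdA : (q + 1)%N %| #|'C_G[x]| by rewrite -cardA cardSg.
have [_ _ _ []] := odd_cent Gx nt_x x_odd.
  case=> g Gg CH; move: dvdA; rewrite CH cardJg cardH => /dvdn_leq.
  rewrite q1_gt0 => /(_ isT); rewrite leqNgt addn1 subn1.
  by rewrite (leq_ltn_trans (leq_pred _)).
move=> dvdC; have := coprime_sqr_succ_succ q_even; rewrite /coprime.
have /gcdn_idPr -> := dvdn_trans dvdA dvdC.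
by rewrite addn1 eqSS -leqn0 leqNgt q_gt0.
Qed.

(** Let D be nontrivial and U not inside B. Then D is a centraliser in U with e = 1 or 2. If e = 1
    the count gives U = U ∩ B; if e = 2 and |P| = q^2 then S lies in U and U = G. In the remaining
    case, e = 2 and |P| = q, a second class must exist, and each value of its index [e'] is
    refuted. *)
Lemma contained_main : U :!=: G -> contained.
Proof.
move=> neqUG; have [D [sdV sDV cycD dvdD regD]] := V_compl.
have [_ defV nPD tiPD] := sdprodP sdV.
have cardV : #|V| = (#|P| * #|D|)%N := esym (sdprod_card sdV).
have [D1|ntD] := eqVneq D 1%G.
  by apply: contained_cap_2group; rewrite cardV D1 cards1 muln1.
have [sUB|nUB] := boolP (U \subset B); first by left; exists 1; rewrite ?conjsg1.
have [sDU sDB] := subsetIP sDV.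
have [x Dx nt_x] := trivgPn _ ntD.
have Dx' : x \in D^# by rewrite in_setD1 nt_x.
have nSx : x \notin S.
  apply: contra nt_x => Sx; rewrite -in_set1 -set1gE -tiPD inE Dx andbT inE Sx andbT.
  exact: (subsetP sDU).
have [Ox CxD] := cent_compl sdV cycD dvdD Dx'.
have [s Ss CGx] := cent_B (subsetP sDB x Dx) nSx.
have [[c5 _ e124 cardN fE] dvd_e] := card_cent_class Ox.
rewrite (cent_H_index (subsetP sSG s Ss) CGx) in dvd_e.
move: #|_ : _| e124 cardN fE dvd_e; rewrite CxD in c5 * => e e124 cardN fE dvd_e.
have [m m12 cardP] := card_regular_power_q (subsetIr U S) ntP nPD regD ntD dvdD.
have P8 : 8 <= #|P|.
  rewrite cardP (leq_trans q_ge8) // -{1}(expn1 q) leq_exp2l ?(leq_trans _ q_ge8) //.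
  by move: m12; rewrite !inE => /orP[]/eqP->.
have f_le : #|cent_class x| <= #|odd_part| by rewrite subset_leq_card ?cent_class_sub.
have u_gt0 := cardG_gt0 U.
have lt_ou : #|odd_part| < #|U| by rewrite card_parts -addnA add1n ltnS leq_addl.
have cep := card_even_part; rewrite cardV in cep.
have [b1 b2 _ _ _] := class_arith c5 fE.
have [e1 | e2] : e = 1%N \/ e = 2.
- by move: e124 dvd_e; rewrite !inE => /or3P[]/eqP-> //; auto.
- have lt_f : #|cent_class x| < #|odd_part| ->
      5 * #|cent_class x| + #|U| <= 5 * #|odd_part|.
    case/(new_class Ox) => y [Oy _ le_xy]; have [[b5 _ e'124 _ f'E] _] := card_cent_class Oy.
    by apply: (leq_trans (n := 5 * (#|cent_class x| + #|cent_class y|)));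
       rewrite ?leq_mul2l // mulnDr leq_add2l (class_lower b5 e'124 f'E).
  apply: contained_B; rewrite cardV.
  rewrite e1 muln1 in fE; apply: (Frobenius_arith_full _ card_parts cep fE) => //.
  by apply: leq_trans (leq_mul P8 c5).
exfalso; rewrite {}e2 in fE b2 *.
have le2 := b2 erefl.
have [m1|m2] : m = 1%N \/ m = 2 by move: m12; rewrite !inE => /orP[]/eqP->; auto.
  rewrite m1 expn1 in cardP; rewrite cardP in cep cardV.
  have c_gt0 : 0 < #|D| := cardG_gt0 D.
  pose n := #|U : V|.
  have uE : #|U| = (q * #|D| * n)%N by rewrite -cardV Lagrange ?subsetIl.
  have n_gt0 : 0 < n := indexg_gt0 _ _.
  have n_odd : odd n.
    have /and3P[_ _ ] := sylP; rewrite -odd_2'nat; apply: dvdn_odd.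
    by apply: indexgS; apply: setIS sSB.
  (* An element k of U outside B moves P to a subgroup meeting V trivially, so V and [P :^ k] have
     |V| q distinct products in U. *)
  have le_qn : q <= n.
    have [k Uk nBk] := subsetPn nUB; have Gk := subsetP sUG k Uk.
    have tiVPk : V :&: P :^ k = 1.
      apply/trivgP; rewrite -(tiBSg Gk nBk); apply: setISS (subsetIr _ _) _.
      by rewrite conjSg subsetIr.
    have : #|V * P :^ k| <= #|U|.
      rewrite subset_leq_card // mul_subG ?subsetIl //.
      by rewrite -{2}(conjGid Uk) conjSg subsetIl.
    rewrite TI_cardMg // cardJg cardV cardP uE leq_pmul2l //.
    by rewrite muln_gt0 q_gt0.
  have ltf : #|cent_class x| < #|odd_part|.
    rewrite ltn_neqAle f_le andbT; apply/eqP=> fo.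
    apply: (@one_class_arith q n #|D| #|cent_class x| #|U| #|class_support P^# U|) => //.
    - by apply: leq_trans q_ge8.
    - by apply: leq_trans c5.
    by rewrite fo card_parts.
  have [y [Oy nxy le_xy]] := new_class Ox ltf.
  have [[b5 _ e'124 cardNy f'E] _] := card_cent_class Oy.
  have [b'1 _ _ _ _] := class_arith b5 f'E.
  move: #|_ : _| e'124 cardNy f'E b'1 => e'; rewrite !inE => /or3P[]/eqP-> cardNy f'E b'1.
  - exact: (two_class_max le2 (b'1 erefl) le_xy lt_ou).
  (* Two classes with index 2 and a third one would fill at least 2/5 + 2/5 + 1/5 of U. So these two
     classes exhaust the odd part, and the centraliser of y in U has order q + 1. *)
  - have oE : #|odd_part| = (#|cent_class x| + #|cent_class y|)%N.
      apply/eqP; rewrite eq_sym eqn_leq le_xy leqNgt; apply/negP=> lt_xy.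
      have [z [Oz _ _ le_xyz]] := new_class2 Ox Oy nxy lt_xy.
      have [[d5 _ e''124 _ f''E] _] := card_cent_class Oz.
      have [_ b'2 _ _ _] := class_arith b5 f'E.
      exact: (three_class_max le2 (b'2 erefl) (class_lower d5 e''124 f''E) le_xyz lt_ou).
    have b_gt0 : 0 < #|'C_U[y]| by apply: cardG_gt0.
    have q2 : 2 <= q by apply: leq_trans q_ge8.
    have uS := card_parts; rewrite oE in uS.
    have bE := second_class_arith q2 c_gt0 b_gt0 n_gt0 uE uS cep fE f'E.
    have := Zassenhaus_arith q_ge8 q_even n_odd le_qn c_gt0 dvdD bE.
    by apply/eqP; apply: (@cent_card_neq_succ y 'C_U[y]%G) => //; apply: setSI.
  (* If [e'] is 4, a Sylow 2-subgroup of the normaliser is cyclic of order at least 4, yet conjugate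
     into P, which lies in Z and has exponent 2. *)
  have [Q sylQ] := Sylow_exists 2 'N_U('C_U[y]).
  have [Uy Gy nt_y y_odd] := odd_partP _ Oy.
  have sQN := pHall_sub sylQ; have Q2 := pHall_pgroup sylQ.
  have sNN : 'N_U('C_U[y]) \subset 'N_G('C_G[y]).
    by have := subsetIr U 'N_G('C_G[y]); rewrite -norm_cent_sub.
  have [cycQ _] := norm_cent_2group Gy nt_y y_odd (subset_trans sQN sNN) Q2.
  have sQU : Q \subset U := subset_trans sQN (subsetIl _ _).
  have [k Uk sQP] := Sylow_subJ sylP sQU Q2.
  (* P meets Z nontrivially because squares in S lie in Z. The intersection is D-invariant, so its
     order is at least q = |P|. *)
  have sPZ : P \subset Z.
    have ntPZ : P :&: Z != 1.
      have [w Pw nt_w] := trivgPn _ ntP; have Sw : w \in S by case/setIP: Pw.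
      have [Zw|nZw] := boolP (w \in Z); first by apply/trivgPn; exists w; rewrite // in_setI Pw.
      apply/trivgPn; exists (w ^+ 2); last by rewrite ZE.
      by rewrite in_setI groupX //= sqS.
    have nPZD : D \subset 'N(P :&: Z).
      by rewrite normsI // (subset_trans sDB) ?Z_char_norm.
    have sPZS : P :&: Z \subset S by rewrite subIset // subsetIr.
    have [m' m'12 cardPZ] := card_regular_power_q sPZS ntPZ nPZD regD ntD dvdD.
    apply/setIidPl/eqP; rewrite eqEcard subsetIl cardP cardPZ -{1}(expn1 q).
    rewrite leq_exp2l ?(leq_trans _ q_ge8) //.
    by move: m'12; rewrite !inE => /orP[]/eqP->.
  have [v defQ] := cyclicP cycQ.
  have : #[v] %| 2.
    have Zv : v ^ k^-1 \in Z.
      by rewrite (subsetP sPZ) // -mem_conjg (subsetP sQP) // defQ cycle_id.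
    rewrite order_dvdn -(conjg_eq1 _ k^-1) conjXg.
    by rewrite ZE // (subsetP sZS).
  rewrite /order -defQ (card_Hall sylQ) p_part => /dvdn_leq => le4.
  move: (le4 isT); apply/negP; rewrite -ltnNge -[2]/(2 ^ 1)%N ltn_exp2l //.
  by rewrite -pfactor_dvdn ?cardG_gt0 // cardNy dvdn_mull.
case/eqP: neqUG; apply: gen_from_S => //.
by apply/setIidPr/eqP; rewrite eqEcard subsetIr cardS cardP m2 leqnn.
Qed.

End Subgroup.

Lemma containedJ (U : {group gT}) g : g \in G -> contained (U :^ g) -> contained U.
Proof.
move=> Gg [[k Gk sUB]|[x [Gx nt_x x_odd sUN]]].
  left; exists (k * g^-1); first by rewrite groupM ?groupV.
  by rewrite -(conjSg _ _ g) -conjsgM mulgKV.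
right; exists (x ^ g^-1); rewrite groupJ ?groupV // conjg_eq1 orderJ; split=> //.
rewrite -(conjSg _ _ g); apply: subset_trans sUN _.
by rewrite cent_conj ?groupV // conjIg conjGid // -normJ conjsgKV.
Qed.

(** A subgroup of even order is first conjugated so that one of its involutions lies in S, as
    [contained_main] requires. *)
Lemma proper_contained (U : {group gT}) : U \subset G -> U :!=: G -> contained U.
Proof.
move=> sUG neqUG; have [oddU|evenU] := boolP (odd #|U|); first exact: contained_odd.
have [z Uz oz] : {z | z \in U & #[z] = 2} by apply: Cauchy; rewrite // dvdn2.
have [g Gg Sz] : exists2 g, g \in G & z \in S :^ g.
  by apply: elt2_S; rewrite ?(subsetP sUG) // /p_elt oz.
apply: (@containedJ U g^-1); rewrite ?groupV //.
apply: contained_main.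
- by rewrite -(conjGid (groupVr Gg)) conjSg.
- apply/trivgPn; exists (z ^ g^-1); last by rewrite conjg_eq1 -order_eq1 oz.
  by rewrite inE memJ_conjg Uz -mem_conjg.
apply: contra neqUG => /eqP UgG; rewrite -(conjsgK g^-1 U) invgK UgG conjGid //.
Qed.

(** * The classes of centralisers of odd elements in G *)

Local Notation OG := (odd_part G).
Local Notation Cl := (cent_class G).

Lemma odd_partGP x : reflect [/\ x \in G, x != 1 & odd #[x]] (x \in OG).
Proof. by apply: (iffP (odd_partP (subxx _) x)) => [[]|[]]. Qed.

Lemma cent_class_conj x y : x \in OG -> y \in OG -> y \in Cl x ->
  exists2 g, g \in G & 'C_G[y] = 'C_G[x] :^ g.
Proof.
move=> Ox Oy /imset2P[c g Cc Gg ->]; exists g => //.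
by rewrite cent_conj // (cent_eq (subxx _) Ox Cc).
Qed.

Lemma conj_cent_class x y g : x \in OG -> y \in OG -> g \in G ->
  'C_G[y] = 'C_G[x] :^ g -> y \in Cl x.
Proof.
move=> Ox /odd_partGP[Gy nt_y _] Gg CyE; rewrite -(conjgKV g y).
rewrite memJ_class_support // in_setD1 conjg_eq1 nt_y /= -mem_conjg -CyE.
by rewrite inE Gy cent1id.
Qed.

Lemma not_H_dvd h x : h \in H^# -> x \in OG -> x \notin Cl h ->
  #|'C_G[x]| %| (q ^ 2 + 1)%N.
Proof.
move=> Hh Ox nhx; have [Gx nt_x x_odd] := odd_partGP _ Ox.
have [_ _ _ [[g Gg CxE]|//]] := odd_cent Gx nt_x x_odd; case/negP: nhx.
have [nt_h Hh'] := setD1P Hh; have Gh := subsetP sHG h Hh'.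
have Oh : h \in OG.
  by apply/odd_partGP; split=> //; apply: dvdn_odd (order_dvdG Hh') H_odd.
by apply: (conj_cent_class Oh Ox Gg); rewrite CxE cent_H.
Qed.

(** Let r be a common prime and R a Sylow r-subgroup of G containing an element u of order r of the
    first centraliser. A central element w of R commutes with u, so w and x have the same
    centraliser, which contains R. By Sylow's theorem an element of order r of the second
    centraliser is conjugate into R, so the two centralisers are conjugate. *)
Lemma coprime_classes x y : x \in OG -> y \in OG -> y \notin Cl x ->
  coprime #|'C_G[x]| #|'C_G[y]|.
Proof.
move=> Ox Oy nxy; rewrite coprime_has_primes ?cardG_gt0 //.
apply/hasPn=> r; rewrite !mem_primes !cardG_gt0 /= => /andP[r_pr r_y].
apply: contra nxy => /andP[_ r_x].
have [[Gx nt_x x_odd] [Gy nt_y y_odd]] := (odd_partGP _ Ox, odd_partGP _ Oy).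
have [u Cu ou] := Cauchy r_pr r_x; have [v Cv ov] := Cauchy r_pr r_y.
have nt_u : u != 1 by rewrite -order_eq1 ou neq_ltn prime_gt1 ?orbT.
have nt_v : v != 1 by rewrite -order_eq1 ov neq_ltn prime_gt1 ?orbT.
have [Gu Gv] : u \in G /\ v \in G by case/setIP: Cu; case/setIP: Cv.
have [R sylR uR] : exists2 R : {group gT}, r.-Sylow(G) R & <[u]> \subset R.
  have sylGu : <[u]> \subset G by rewrite cycle_subG.
  have ru : r.-group <[u]> by rewrite /pgroup -/(order u) ou pnat_id.
  by have [R] := Sylow_superset sylGu ru; exists R.
rewrite cycle_subG in uR; have rR := pHall_pgroup sylR; have sRG := pHall_sub sylR.
have ntR : R :!=: 1 by apply/trivgPn; exists u.
have [w Zw nt_w] : exists2 w, w \in 'Z(R) & w != 1.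
  by apply/trivgPn; apply: contra ntR => /eqP/(trivg_center_pgroup rR)->.
have [Rw cRw] := setIP Zw; have Gw := subsetP sRG w Rw.
have CxE : 'C_G[w] = 'C_G[x].
  apply: odd_cent_dvd => //; rewrite -(odd_cent_dvd Gx nt_x x_odd Cu nt_u).
  by rewrite inE Gw; apply/cent1P/(centP cRw).
have sRC : R \subset 'C_G[x].
  rewrite -CxE subsetI sRG sub_cent1 //.
have sylGv : <[v]> \subset G by rewrite cycle_subG.
have rv : r.-group <[v]> by rewrite /pgroup -/(order v) ov pnat_id.
have [g Gg] := Sylow_subJ sylR sylGv rv; rewrite cycle_subG => Rv.
have Cvg : v ^ g^-1 \in 'C_G[x] by rewrite (subsetP sRC) // -mem_conjg.
apply: (@conj_cent_class x y g) => //.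
rewrite -(odd_cent_dvd Gx nt_x x_odd Cvg) ?conjg_eq1 //.
by rewrite -cent_conj // conjgKV (odd_cent_dvd Gy nt_y y_odd Cv nt_v).
Qed.

Lemma torus_split : exists y z,
  [/\ y \in OG, z \in OG, #|'C_G[y]| = (q + 2 ^ (p.+1)./2 + 1)%N
    & #|'C_G[z]| = (q - 2 ^ (p.+1)./2 + 1)%N]
  /\ [/\ #|'N_G('C_G[y]) : 'C_G[y]| = 4, #|'N_G('C_G[z]) : 'C_G[z]| = 4 &
    forall x, x \in OG -> [\/ exists2 g, g \in G & 'C_G[x] = H :^ g,
      exists2 g, g \in G & 'C_G[x] = 'C_G[y] :^ g |
      exists2 g, g \in G & 'C_G[x] = 'C_G[z] :^ g]].
Proof.
have [h Hh] : exists h, h \in H^# by apply/set0Pn; rewrite setD_eq0 subG1 H_neq1.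
have [nt_h Hh'] := setD1P Hh; have Gh := subsetP sHG h Hh'.
have Oh : h \in OG.
  by apply/odd_partGP; split=> //; apply: dvdn_odd (order_dvdG Hh') H_odd.
have GS : G :&: S = S by apply/setIidPr; apply: sSG.
have GB : G :&: B = B by apply/setIidPr.
have ntGS : G :&: S != 1 by rewrite GS S_neq1.
have gS := card_parts (subxx G) ntGS.
have n2E := card_even_part (subxx G) ntGS.
rewrite GS GB cardS cardB in n2E gS.
have [[_ _ _ _ fhE] _] := card_cent_class (subxx G) Oh.
rewrite (cent_H_index (group1 G)) ?conjsg1 ?cent_H // cardH in fhE.
have q2 : 2 <= q by apply: leq_trans q_ge8.
have oE := total_arith q2 cardG gS n2E fhE.
have [lt_h lt_half gt_25] := rest_bounds q_ge8 cardG oE.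
have overflow s : 3 * #|G| <= 5 * s -> #|Cl h| + s <= #|OG| -> False.
  by move=> le3 les; apply: (rest_overflow lt_half le3 les).
have lower y : y \in OG -> #|G| <= 5 * #|Cl y|.
  move=> Oy; have [[b5 _ e124 _ fE] _] := card_cent_class (subxx G) Oy.
  exact: class_lower b5 e124 fE.
have [y [Oy nhy sat_hy card_hy]] := saturated_new (subxx G) (saturated_class (subxx G) Oh) lt_h.
have dvdy := not_H_dvd Hh Oy nhy.
have le_hy : #|Cl h| + #|Cl y| <= #|OG|.
  by rewrite -card_hy; apply: subset_leq_card; case: sat_hy.
have [[b5 _ e124 _ fyE] _] := card_cent_class (subxx G) Oy.
have [b1 b2 _ _ u4] := class_arith b5 fyE.
(* A class with index 1 would exceed the available half of G. One with index 2 takes at least 2/5,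
   so no further class fits, and then q + 1 would divide q^2 + 1. *)
have ey4 : #|'N_G('C_G[y]) : 'C_G[y]| = 4.
  move: e124; rewrite !inE => /or3P[]/eqP ey //.
    case: (overflow _ _ le_hy); move: (b1 ey); clear; lia.
  have {}b2 := b2 ey; have hyE : (#|Cl h| + #|Cl y| = #|OG|)%N.
    apply/eqP; rewrite eqn_leq le_hy leqNgt -card_hy; apply/negP=> lt_hy.
    have [z [Oz _ [sub _] card_hyz]] := saturated_new (subxx G) sat_hy lt_hy.
    have := subset_leq_card sub; rewrite card_hyz card_hy -addnA; apply: overflow.
    by move: b2 (lower z Oz); clear; lia.
  have fyR : (2 * #|Cl y| = q ^ 3 * (q - 1) ^ 2)%N.
    by move: oE; rewrite -hyE mulnDr => /addnI.
  rewrite ey in fyE; have := index2_rest_arith q2 (cardG_gt0 _) cardG fyR fyE.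
  move=> qE; have := coprime_sqr_succ_succ q_even; rewrite /coprime.
  have /gcdn_idPr -> : (q + 1)%N %| (q ^ 2 + 1)%N by rewrite qE dvdn_mull.
  by rewrite addn1 eqSS -leqn0 leqNgt q_gt0.
(* A class with index 4 takes at most 1/4 of G and cannot fill a rest of more than 2/5. *)
have lt_hy : #|Cl h :|: Cl y| < #|OG|.
  by rewrite card_hy; apply: rest_underflow (u4 ey4) gt_25.
have [z [Oz]] := saturated_new (subxx G) sat_hy lt_hy.
rewrite inE negb_or => /andP[nhz nyz] sat_hyz card_hyz.
rewrite card_hy in card_hyz.
have dvdz := not_H_dvd Hh Oz nhz.
have le_hyz : #|Cl h| + (#|Cl y| + #|Cl z|) <= #|OG|.
  by rewrite addnA -card_hyz; apply: subset_leq_card; case: sat_hyz.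
have [[d5 _ e'124 _ fzE] _] := card_cent_class (subxx G) Oz.
have [d1 d2 _ _ _] := class_arith d5 fzE.
have ez4 : #|'N_G('C_G[z]) : 'C_G[z]| = 4.
  move: e'124; rewrite !inE => /or3P[]/eqP ez //; case: (overflow _ _ le_hyz).
    by move: (d1 ez); clear; lia.
  by move: (d2 ez) (lower y Oy); clear; lia.
(* Three classes besides that of h would take at least 3/5 of G. *)
have hyzE : Cl h :|: Cl y :|: Cl z = OG.
  apply/eqP; rewrite eqEcard; have [-> _ /=] := sat_hyz; rewrite leqNgt.
  apply/negP=> lt_hyz; have [w [Ow _ [sub _] card_w]] := saturated_new (subxx G) sat_hyz lt_hyz.
  have := subset_leq_card sub; rewrite card_w card_hyz -!addnA; apply: overflow.
  by move: (lower y Oy) (lower z Oz) (lower w Ow); clear; lia.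
have fR : (2 * (#|Cl y| + #|Cl z|) = q ^ 3 * (q - 1) ^ 2)%N.
  by move: oE; rewrite -hyzE card_hyz -addnA mulnDr => /addnI.
rewrite ey4 in fyE; rewrite ez4 in fzE.
have ky0 : 0 < #|'C_G[y]| := cardG_gt0 _; have kz0 : 0 < #|'C_G[z]| := cardG_gt0 _.
have kE := index4_rest_arith q2 ky0 kz0 cardG fR fyE fzE.
have cop := coprime_classes Oy Oz nyz.
have [kM kD] := torus_order_arith q_even ky0 kz0 cop dvdy dvdz kE.
have rE : ((2 ^ (p.+1)./2) ^ 2 = 2 * q)%N.
  by rewrite -expnM -expnS muln2 halfK /= p_odd subn0.
have le_rq : 2 ^ (p.+1)./2 <= q.
  by rewrite leq_exp2l // leq_uphalf_double -addnn leq_addr.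
have coverE x : x \in OG -> [\/ exists2 g, g \in G & 'C_G[x] = H :^ g,
      exists2 g, g \in G & 'C_G[x] = 'C_G[y] :^ g |
      exists2 g, g \in G & 'C_G[x] = 'C_G[z] :^ g].
  move=> Ox; have := Ox; rewrite -{1}hyzE !inE -orbA => /or3P[] Clx.
  - by constructor 1; rewrite -(cent_H Hh); apply: cent_class_conj.
  - by constructor 2; apply: cent_class_conj.
  by constructor 3; apply: cent_class_conj.
case: (leqP #|'C_G[z]| #|'C_G[y]|) => [le_zy | /ltnW le_yz].
  by have [ky kz] := torus_order_solve le_rq rE le_zy kM kD; exists y, z.
rewrite mulnC in kM; rewrite addnC in kD.
have [kz ky] := torus_order_solve le_rq rE le_yz kM kD; exists z, y; split=> //.
split=> // x /coverE[]; by [constructor 1 | constructor 3 | constructor 2].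
Qed.

Lemma cent_cases y : y \in OG ->
  [\/ #|'C_G[y]| = (q - 1)%N /\ #|'N_G('C_G[y]) : 'C_G[y]| = 2,
      #|'C_G[y]| = (q + 2 ^ (p.+1)./2 + 1)%N /\ #|'N_G('C_G[y]) : 'C_G[y]| = 4 |
      #|'C_G[y]| = (q - 2 ^ (p.+1)./2 + 1)%N /\ #|'N_G('C_G[y]) : 'C_G[y]| = 4].
Proof.
have [y1 [y2 [[Oy1 Oy2 k1 k2] [e1 e2 cover]]]] := torus_split => Oy.
have conj_index z g : g \in G -> 'C_G[y] = 'C_G[z] :^ g ->
    #|'C_G[y]| = #|'C_G[z]|
    /\ #|'N_G('C_G[y]) : 'C_G[y]| = #|'N_G('C_G[z]) : 'C_G[z]|.
  move=> Gg ->; rewrite cardJg; split=> //.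
  by rewrite normJ -{1}(conjGid Gg) -conjIg indexJg.
case: (cover y Oy) => [[g Gg CyE]|[g Gg CyE]|[g Gg CyE]].
- by constructor 1; rewrite (cent_H_index Gg CyE) CyE cardJg cardH.
- by constructor 2; have [-> ->] := conj_index _ _ Gg CyE.
by constructor 3; have [-> ->] := conj_index _ _ Gg CyE.
Qed.

Lemma cent_index_even y : y \in OG ->
  #|'N_G('C_G[y]) : 'C_G[y]| = 2 \/ #|'N_G('C_G[y]) : 'C_G[y]| = 4.
Proof. by case/cent_cases=> -[_ ->]; auto. Qed.

Lemma S_conj_eq x g k : g \in G -> k \in G -> x \in S :^ g -> x \in S :^ k -> x != 1 ->
  S :^ g = S :^ k.
Proof.
move=> Gg Gk Sgx Skx nt_x; have /and3P[_ /trivIsetP tiSG _] := tiS.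
have /eqP eqS : S^# :^ g == S^# :^ k.
  apply: contraT => neqS; have := tiSG _ _ (imset_f _ Gg) (imset_f _ Gk) neqS.
  by rewrite -setI_eq0 => /eqP/setP/(_ x); rewrite !conjD1g !inE nt_x Sgx Skx.
by rewrite -(setD1K (group1 (S :^ g))) -(setD1K (group1 (S :^ k))) -!conjD1g eqS.
Qed.

Lemma S_2elt x g : x \in S :^ g -> 2.-elt x.
Proof. by move=> Sx; apply: mem_p_elt Sx; rewrite pgroupJ (pHall_pgroup sylS). Qed.

Lemma elt2_odd (x : gT) : 2.-elt x -> odd #[x] -> x = 1.
Proof.
move=> x2 x_odd; have x2' : 2^'.-elt x by rewrite /p_elt -odd_2'nat.
by apply/eqP; rewrite -order_eq1 (pnat_1 x2 x2').
Qed.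

(** * Normalisers of the maximal tori *)

Section TorusNormalizer.

Variable y : gT.
Hypothesis Oy : y \in OG.
Local Notation C := 'C_G[y].
Local Notation N := 'N_G('C_G[y]).

Let sCN : C \subset N. Proof. by rewrite subsetI subsetIl normG. Qed.

Lemma torus_odd : odd #|C|.
Proof. by have [Gy nt_y y_odd] := odd_partGP _ Oy; case: (odd_cent Gy nt_y y_odd). Qed.

Lemma torus_cyclic : cyclic C.
Proof. by have [Gy nt_y y_odd] := odd_partGP _ Oy; case: (odd_cent Gy nt_y y_odd). Qed.

Lemma torus_cent w : w \in C -> w != 1 -> 'C_G[w] = C.
Proof. by have [Gy nt_y y_odd] := odd_partGP _ Oy; apply: odd_cent_dvd. Qed.

Lemma torus_index2 : 2.-nat #|N : C|.
Proof. by case: (cent_index_even Oy) => ->. Qed.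

Let nsCN : C <| N. Proof. by rewrite /normal sCN subsetIr. Qed.

Lemma torus_hall : 2^'.-Hall(N) C.
Proof.
apply/and3P; split=> //; first by rewrite /pgroup -odd_2'nat torus_odd.
by rewrite pnatNK torus_index2.
Qed.

Lemma torus_odd_elt w : w \in N -> odd #[w] -> w \in C.
Proof.
by move=> Nw w_odd; rewrite (mem_normal_Hall torus_hall) // /p_elt -odd_2'nat.
Qed.

Lemma torus_2elt w : w \in N -> w \notin C -> 2.-elt w.
Proof.
move=> Nw nCw; have Gw : w \in G by case/setIP: Nw.
have [g Gg Sw] : exists2 g, g \in G & w \in S :^ g.
  by apply: even_S => //; apply: contra nCw; apply: torus_odd_elt.
by apply: mem_p_elt Sw; rewrite pgroupJ (pHall_pgroup sylS).
Qed.

Lemma card_torus_norm : #|N| = (#|C| * #|N : C|)%N.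
Proof. by rewrite Lagrange. Qed.

Section Sylow.

Variable Q : {group gT}.
Hypothesis sylQ : 2.-Sylow(N) Q.

Lemma torus_sylow_cyclic : cyclic Q.
Proof.
have [Gy nt_y y_odd] := odd_partGP _ Oy.
by have [] := norm_cent_2group Gy nt_y y_odd (pHall_sub sylQ) (pHall_pgroup sylQ).
Qed.

Lemma card_torus_sylow : #|Q| = #|N : C|.
Proof.
rewrite (card_Hall sylQ) card_torus_norm partnM ?cardG_gt0 ?indexg_gt0 //.
rewrite part_p'nat -?odd_2'nat ?torus_odd // mul1n.
by rewrite part_pnat_id ?torus_index2.
Qed.

Lemma torus_sylow_sdprod : C ><| Q = N.
Proof.
have tiCQ : C :&: Q = 1.
  apply: coprime_TIg; rewrite coprime_sym (pnat_coprime (pHall_pgroup sylQ)) //.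
  by rewrite -odd_2'nat torus_odd.
have sQN := pHall_sub sylQ.
rewrite sdprodE ?(subset_trans sQN) ?subsetIr //.
apply/eqP; rewrite eqEcard mul_subG //= TI_cardMg // card_torus_sylow.
by rewrite card_torus_norm leqnn.
Qed.

Lemma torus_sylow_neq1 : Q :!=: 1.
Proof.
rewrite trivg_card1 card_torus_sylow.
by case: (cent_index_even Oy) => ->.
Qed.

Lemma torus_Frobenius : [Frobenius N = C ><| Q].
Proof.
have [Gy nt_y y_odd] := odd_partGP _ Oy.
apply/Frobenius_semiregularP; rewrite ?torus_sylow_sdprod ?torus_sylow_neq1 //.
  by apply/trivgPn; exists y; rewrite // inE Gy cent1id.
move=> z /setD1P[nt_z Qz]; apply/trivgP/subsetP=> c /setIP[Cc cxc].
apply: contraT; rewrite inE => nt_c; have [_ _ _ tiCQ] := sdprodP torus_sylow_sdprod.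
case/negP: nt_z; rewrite -in_set1 -set1gE -tiCQ inE Qz andbT -(torus_cent Cc nt_c).
by rewrite inE (subsetP (subset_trans (pHall_sub sylQ) (subsetIl _ _))) // cent1C.
Qed.

End Sylow.

(** C is the set of all elements of odd order in N, so whatever normalises N normalises C. *)
Lemma torus_norm_self : 'N_G(N) = N.
Proof.
apply/eqP; rewrite eqEsubset; apply/andP; split; last first.
  by rewrite subsetI subsetIl normG.
apply/subsetP=> g /setIP[Gg nNg]; rewrite inE Gg inE.
apply/subsetP=> _ /imsetP[c Cc ->].
apply: torus_odd_elt; first by rewrite memJ_norm // (subsetP sCN).
by rewrite orderJ (dvdn_odd (order_dvdG Cc)) ?torus_odd.
Qed.

(** Otherwise the commutator of x and y lies in C, which x normalises, and in [S :^ g], which y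
    normalises. So it is 1, and the 2-element x would lie in C, of odd order. *)
Lemma torus_not_B x g : g \in G -> x \in S :^ g -> x != 1 -> x \in N ->
  ~~ (C \subset B :^ g).
Proof.
move=> Gg Sx nt_x Nx; apply/negP=> sCB; have [Gy nt_y y_odd] := odd_partGP _ Oy.
have Cy : y \in C by rewrite inE Gy cent1id.
have x2 : 2.-elt x by apply: mem_p_elt Sx; rewrite pgroupJ (pHall_pgroup sylS).
have tiCS : C :&: S :^ g = 1.
  apply: coprime_TIg; rewrite coprime_sym cardJg (pnat_coprime (pHall_pgroup sylS)) //.
  by rewrite -odd_2'nat torus_odd.
have nSB : B :^ g \subset 'N(S :^ g) by rewrite normJ conjSg (normal_norm nsSB).
have : [~ x, y] \in C :&: S :^ g.
  rewrite inE; apply/andP; split.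
    by rewrite commgEr groupM // memJ_norm ?groupV //; case/setIP: Nx.
  rewrite commgEl groupM ?groupV // memJ_norm //.
  by rewrite (subsetP nSB) // (subsetP sCB).
rewrite tiCS => /set1P/eqP/commgP cxy.
have Cx : x \in C by rewrite inE; case/setIP: Nx => -> _; apply/cent1P.
have x2' : 2^'.-elt x.
  by rewrite /p_elt -odd_2'nat (dvdn_odd (order_dvdG Cx)) ?torus_odd.
by case/eqP: nt_x; apply/eqP; rewrite -order_eq1 (pnat_1 x2 x2').
Qed.

(** A non-identity element of C in [B :^ g] has odd order, hence a centraliser inside [B :^ g]; but
    that centraliser is C, against [torus_not_B]. So the intersection is a 2-group, in fact the
    Sylow 2-subgroup of N in [S :^ g]. *)
Lemma torus_cap_B x g : g \in G -> x \in S :^ g -> x != 1 -> x \in N ->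
  [/\ N :&: B :^ g \subset S :^ g, cyclic (N :&: B :^ g) & #|N :&: B :^ g| = #|N : C|].
Proof.
move=> Gg Sx nt_x Nx.
have x2 : 2.-elt x by apply: mem_p_elt Sx; rewrite pgroupJ (pHall_pgroup sylS).
have sxN : <[x]> \subset N by rewrite cycle_subG.
have [Q sylQ] := Sylow_superset sxN x2; rewrite cycle_subG => Qx.
have sQN := pHall_sub sylQ; have sQG := subset_trans sQN (subsetIl _ _).
have [k Gk sQS] := Sylow_subJ sylS sQG (pHall_pgroup sylQ).
have SkE : S :^ k = S :^ g by apply: S_conj_eq nt_x; rewrite // (subsetP sQS).
have sNBS : N :&: B :^ g \subset S :^ g.
  apply/subsetP=> w /setIP[Nw Bw]; have [-> | nt_w] := eqVneq w 1; first exact: group1.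
  rewrite mem_conjg in Bw; rewrite mem_conjg; have [Cw | nCw] := boolP (w \in C).
    apply: contraT => nSw; case/negP: (torus_not_B Gg Sx nt_x Nx).
    have [s Ss Cw'] := cent_B Bw nSw.
    rewrite -(torus_cent Cw nt_w) -(conjgKV g w) cent_conj // Cw' conjSg.
    by rewrite -(conjGid (subsetP sSB s Ss)) conjSg sHB.
  apply: B_even => //; rewrite orderJ; apply: contra nt_w => w_odd.
  by apply/eqP/elt2_odd => //; apply: torus_2elt.
have defQ : N :&: B :^ g = Q.
  apply: (sub_pHall sylQ); rewrite ?subsetIl //.
    by apply: pgroupS sNBS _; rewrite pgroupJ (pHall_pgroup sylS).
  by rewrite subsetI sQN (subset_trans sQS) // SkE conjSg sSB.
rewrite defQ; split.
- by rewrite -SkE.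
- exact: torus_sylow_cyclic sylQ.
exact: card_torus_sylow sylQ.
Qed.

End TorusNormalizer.

(** * The maximal subgroups of G *)

Local Notation N y := 'N_G('C_G[y]).

Lemma card_N_lt y : y \in OG -> #|N y| < q ^ 2 * (q - 1).
Proof.
move=> Oy; have le_rq : 2 ^ (p.+1)./2 <= q.
  by rewrite leq_exp2l // leq_uphalf_double -addnn leq_addr.
apply: torus_small; first exact: q_ge8.
rewrite card_torus_norm; move: le_rq; have [[-> ->]|[-> ->]|[-> ->]] := cent_cases Oy.
- by rewrite mulnC; move: q; clear; lia.
- by move: q (2 ^ (p.+1)./2)%N; clear; lia.
by move: q (2 ^ (p.+1)./2)%N; clear; lia.
Qed.

Lemma N_proper y : y \in OG -> N y \proper G.
Proof.
move=> Oy; rewrite properEcard subsetIl /= (leq_trans (card_N_lt Oy)) //.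
by rewrite cardG leq_mul2r leq_pmulr ?orbT // addn1.
Qed.

Lemma B_proper g : g \in G -> B :^ g \proper G.
Proof.
move=> Gg; rewrite properEcard -{1}(conjGid Gg) conjSg sBG cardJg cardB cardG.
by rewrite ltn_pmul2r ?q1_gt0 // ltn_Pmulr ?sqrn_gt0 ?q_gt0 // addn1 ltnS sqrn_gt0 q_gt0.
Qed.

Lemma containedP (U : {group gT}) : U \subset G -> U :!=: G ->
  (exists2 g, g \in G & U \subset B :^ g) \/ (exists2 y, y \in OG & U \subset N y).
Proof.
move=> sUG /(proper_contained sUG)[|[y [Gy nt_y y_odd sUN]]]; first by left.
by right; exists y => //; apply/odd_partGP.
Qed.

Lemma N_sub_eq y z : y \in OG -> z \in OG -> y \in N z -> 'C_G[y] = 'C_G[z].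
Proof.
move=> Oy Oz Ny; have [Gy nt_y y_odd] := odd_partGP _ Oy.
by apply: torus_cent => //; apply: torus_odd_elt.
Qed.

Lemma mem_N y : y \in OG -> y \in N y.
Proof.
case/odd_partGP=> Gy _ _; rewrite inE Gy; apply: (subsetP (normG 'C_G[y])).
by rewrite inE Gy cent1id.
Qed.

Lemma N_invol y : y \in OG -> exists2 z, z \in N y & #[z] = 2.
Proof.
move=> Oy; have even_N : 2 %| #|N y|.
  by rewrite card_torus_norm dvdn_mull //; case: (cent_index_even Oy) => ->.
by have [z Nz oz] := Cauchy (isT : prime 2) even_N; exists z.
Qed.

Lemma N_not_sub_B y g : y \in OG -> g \in G -> ~~ (N y \subset B :^ g).
Proof.
move=> Oy Gg; apply/negP=> sNB; have [z Nz oz] := N_invol Oy.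
have nt_z : z != 1 by rewrite -order_eq1 oz.
have Sz : z \in S :^ g.
  by rewrite mem_conjg B_even // ?orderJ ?oz // -mem_conjg (subsetP sNB).
case/negP: (torus_not_B Oy Gg Sz nt_z Nz); apply: subset_trans sNB.
by rewrite subsetI subsetIl normG.
Qed.

Lemma maximal_B g : g \in G -> maximal (B :^ g) G.
Proof.
move=> Gg; apply/maxgroupP; split=> [|U /properP[sUG [w Gw nUw]] sBU].
  exact: B_proper.
have neqUG : U :!=: G by apply: contraNneq nUw => ->.
have [[k Gk sUB]|[y Oy sUN]] := containedP sUG neqUG.
  apply/eqP; rewrite eq_sym eqEcard sBU (leq_trans (subset_leq_card sUB)) //.
  by rewrite !cardJg.
have := leq_trans (subset_leq_card (subset_trans sBU sUN)) (ltnW (card_N_lt Oy)).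
by have := subset_leq_card (subset_trans sBU sUN); rewrite leqNgt cardJg cardB card_N_lt.
Qed.

(** An overgroup inside some [N z] contains y, and an odd element of [N z] other than 1 has
    centraliser ['C_G[z]], so [N z] is [N y]. *)
Lemma maximal_N y : y \in OG -> maximal (N y) G.
Proof.
move=> Oy; apply/maxgroupP; split=> [|U /properP[sUG [w Gw nUw]] sNU].
  exact: N_proper.
have neqUG : U :!=: G by apply: contraNneq nUw => ->.
have [[k Gk sUB]|[z Oz sUN]] := containedP sUG neqUG.
  by case/negP: (N_not_sub_B Oy Gk); apply: subset_trans sUB.
apply/eqP; rewrite eqEsubset sNU andbT; apply: (subset_trans sUN).
by rewrite (N_sub_eq Oy Oz) // (subsetP (subset_trans sNU sUN)) ?mem_N.
Qed.

Lemma maximal_cases (M : {group gT}) : maximal M G ->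
  (exists2 g, g \in G & M :=: B :^ g) \/ (exists2 y, y \in OG & M :=: N y).
Proof.
move=> maxM; have sMG := proper_sub (maxgroupp maxM).
have neqMG : M :!=: G by have := maxgroupp maxM; rewrite properEneq => /andP[].
have [[g Gg sMB]|[y Oy sMN]] := containedP sMG neqMG.
  left; exists g => //; apply/esym; have [_ maxP] := maxgroupP maxM.
  by apply: (maxP (B :^ g)%G); first exact: B_proper.
right; exists y => //; apply/esym; have [_ maxP] := maxgroupP maxM.
by apply: (maxP (N y)%G); first exact: N_proper.
Qed.

Lemma maximal_solvable (M : {group gT}) : maximal M G -> solvable M.
Proof.
case/maximal_cases=> [[g Gg ->]|[y Oy ->]].
  rewrite -(isog_sol (conj_isog _ _)) (series_sol nsSB) (pgroup_sol (pHall_pgroup sylS)) /=.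
  by rewrite -BE quotientMidl quotient_sol // abelian_sol ?cyclic_abelian.
have nsCN : 'C_G[y] <| N y by rewrite /normal subsetI subsetIl normG subsetIr.
rewrite (series_sol nsCN) abelian_sol ?cyclic_abelian ?torus_cyclic //=.
apply: (@pgroup_sol _ 2); rewrite /pgroup card_quotient ?subsetIr //.
exact: torus_index2.
Qed.

(** In a soluble G a Hall 2'-subgroup would have order (q^2 + 1) (q - 1), yet as a proper subgroup
    it would lie in a conjugate of B or in some [N y], all of smaller order. *)
Lemma G_nonsolvable : ~~ solvable G.
Proof.
apply/negP=> solG; have [K hallK] := Hall_exists 2^' solG.
have cardK : (#|K| = (q ^ 2 + 1) * (q - 1))%N.
  rewrite (card_Hall hallK); have S_gt0 : 0 < #|S| by apply: cardG_gt0.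
  apply/eqP; rewrite -(eqn_pmul2l S_gt0) {1}(card_Hall sylS) partnC ?cardG_gt0 //.
  by rewrite cardG cardS mulnA.
have ltBK : q ^ 2 * (q - 1) < #|K| by rewrite cardK ltn_pmul2r ?q1_gt0 // addn1.
have neqKG : K :!=: G.
  apply/eqP=> KG; have := cardG; rewrite -KG cardK -mulnA => /eqP.
  by rewrite -[X in X == _]mul1n eqn_pmul2r ?muln_gt0 ?q1_gt0 ?addn1 // eq_sym (eqn_exp2r _ 1) // gtn_eqF // (leq_trans _ q_ge8).
have [[g Gg sKB]|[y Oy sKN]] := containedP (pHall_sub hallK) neqKG.
  by have := subset_leq_card sKB; rewrite cardJg cardB leqNgt ltBK.
by have := subset_leq_card sKN; rewrite leqNgt (ltn_trans (card_N_lt Oy)).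
Qed.

(** * Counting the maximal subgroups above an element *)

Definition elts_of_order r : {set gT} := [set x in G | #[x] == r].

Lemma S_order s : s \in S -> s != 1 -> #[s] = (if s \in Z then 2 else 4).
Proof.
move=> Ss nt_s; have s4 : s ^+ 4 = 1.
  by apply/eqP; rewrite (expgM s 2 2) ZE ?sqS // (subsetP sZS) ?sqS.
have: #[s] %| 2 ^ 2 by rewrite order_dvdn s4.
have pr2 : prime 2 by [].
case/(dvdn_pfactor _ _ pr2) => -[|[|[|//]]] _ os.
- by move: nt_s; rewrite -order_eq1 os.
- by rewrite -ZE // -order_dvdn os.
by rewrite -ZE // -order_dvdn os.
Qed.

Lemma order2_classE : elts_of_order 2 = class_support Z^# G.
Proof.
apply/setP=> x; rewrite inE; apply/andP/imset2P=> [[Gx /eqP ox]|[z g]].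
  have [g Gg Sx] : exists2 g, g \in G & x \in S :^ g by apply: even_S; rewrite ?ox.
  exists (x ^ g^-1) g; rewrite ?conjgKV //; rewrite mem_conjg in Sx.
  by rewrite in_setD1 conjg_eq1 -order_eq1 ox /= -ZE // -order_dvdn orderJ ox.
case/setD1P=> nt_z Zz Gg ->; have Sz := subsetP sZS z Zz.
by rewrite (groupJ (subsetP sSG z Sz) Gg) orderJ (S_order Sz nt_z) Zz.
Qed.

Lemma order4_classE : elts_of_order 4 = class_support (S :\: Z) G.
Proof.
apply/setP=> x; rewrite inE; apply/andP/imset2P=> [[Gx /eqP ox]|[s g]].
  have [g Gg Sx] : exists2 g, g \in G & x \in S :^ g by apply: even_S; rewrite ?ox.
  exists (x ^ g^-1) g; rewrite ?conjgKV //; rewrite mem_conjg in Sx.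
  by rewrite in_setD Sx andbT -ZE // -order_dvdn orderJ ox.
case/setDP=> Ss nZs Gg ->; have nt_s : s != 1 by apply: contraNneq nZs => ->.
by rewrite (groupJ (subsetP sSG s Ss) Gg) orderJ (S_order Ss nt_s) (negPf nZs).
Qed.

Lemma indexGB : #|G : B| = (q ^ 2 + 1)%N.
Proof.
by rewrite -divgS // cardG cardB mulnAC mulKn // muln_gt0 sqrn_gt0 q_gt0 q1_gt0.
Qed.

Lemma card_order2 : #|elts_of_order 2| = ((q ^ 2 + 1) * (q - 1))%N.
Proof.
have cZ : #|Z^#| = (q - 1)%N by rewrite -cardZ (cardsD1 1 Z) group1 add1n subn1.
have tiZ : normedTI Z^# G B.
  apply: normedTI_S tiS; first by rewrite -card_gt0 cZ q1_gt0.
    by rewrite normD1 Z_char_norm.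
  exact: setSD.
by rewrite order2_classE (card_support_normedTI tiZ) indexGB cZ mulnC.
Qed.

Lemma card_order4 : #|elts_of_order 4| = ((q ^ 2 + 1) * (q ^ 2 - q))%N.
Proof.
have cSZ : #|S :\: Z| = (q ^ 2 - q)%N by rewrite cardsDS ?cardS ?cardZ.
have tiSZ : normedTI (S :\: Z) G B.
  apply: normedTI_S tiS.
  - rewrite -card_gt0 cSZ subn_gt0 -{1}(expn1 q) ltn_exp2l //.
    by rewrite (leq_trans _ q_ge8).
  - apply/subsetP=> b Bb; rewrite inE conjDg (normsP (normal_norm nsSB) b Bb).
    by rewrite (normsP Z_char_norm b Bb).
  by rewrite setDS // sub1set group1.
by rewrite order4_classE (card_support_normedTI tiSZ) indexGB cSZ mulnC.
Qed.

Lemma same_order_conj r x y : r \in [:: 2; 4] ->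
    x \in elts_of_order r -> y \in elts_of_order r ->
  exists2 g, g \in G & y = x ^ g \/ y = x^-1 ^ g.
Proof.
rewrite in_cons mem_seq1 => /orP[]/eqP->.
  rewrite order2_classE => /imset2P[x0 g Zx Gg ->] /imset2P[y0 k Zy Gk ->].
  have [h Hh ->] := conjZ Zx Zy; exists (g^-1 * h * k); last first.
    by left; rewrite -!conjgM !mulgA mulgV mul1g.
  by rewrite !groupM ?groupV // (subsetP sHG).
rewrite order4_classE => /imset2P[x0 g Sx Gg ->] /imset2P[y0 k Sy Gk ->].
have [b Bb y0E] := conj4 Sx Sy; exists (g^-1 * b * k).
  by rewrite !groupM ?groupV // (subsetP sBG).
by case: y0E => ->; [left | right]; rewrite -?conjVg -!conjgM !mulgA mulgV mul1g.
Qed.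

Lemma cyclic4_orders (Q : {group gT}) : cyclic Q -> #|Q| = 4 ->
  #|[set x in Q | #[x] == 4]| = 2 /\ #|[set x in Q | #[x] == 2]| = 1%N.
Proof.
move=> cycQ cardQ; have [z defQ] := cyclicP cycQ.
have oz : #[z] = 4 by rewrite /order -defQ.
have E4 : [set x in Q | #[x] == 4] = [set x | generator <[z]> x].
  apply/setP=> x; rewrite !inE -defQ /generator.
  apply/andP/eqP => [[Qx /eqP ox]|defx].
    by apply/eqP; rewrite eq_sym eqEcard cycle_subG Qx cardQ [#|<[x]>|]ox.
  by rewrite defx cycle_id /order -defx cardQ.
have cardE4 : #|[set x in Q | #[x] == 4]| = 2 by rewrite E4 -totient_gen oz.
split=> //; have E2 : [set x in Q | #[x] == 2] = Q^# :\: [set x in Q | #[x] == 4].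
  apply/setP=> x; rewrite !inE; case Qx: (x \in Q); rewrite /= ?andbF // andbT.
  rewrite -order_eq1; have := order_dvdG Qx; rewrite cardQ.
  by move: #[x] => [|[|[|[|[|n]]]]] // /dvdn_leq.
have sE4 : [set x in Q | #[x] == 4] \subset Q^#.
  apply/subsetP=> x; rewrite !inE => /andP[-> /eqP ox].
  by rewrite -order_eq1 ox.
rewrite E2 cardsDS // cardE4; have := cardsD1 1 Q; rewrite group1 cardQ.
by move: #|Q^#|; clear; lia.
Qed.

(** [N y] is a Frobenius group whose complement Q has as many conjugates as ['C_G[y]] has elements,
    meeting pairwise trivially. Q is cyclic of order 2 or 4, with one involution and correspondingly
    none or two elements of order 4. *)
Lemma card_N_order y r : y \in OG -> r \in [:: 2; 4] ->
  #|N y :&: elts_of_order r| =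
    (#|'C_G[y]| * (if r == 2 then 1 else if #|N y : 'C_G[y]| == 2 then 0 else 2))%N.
Proof.
move=> Oy r24; have [Q sylQ] := Sylow_exists 2 (N y).
have frobN := torus_Frobenius Oy sylQ.
have cardQ := card_torus_sylow Oy sylQ; have cycQ := torus_sylow_cyclic Oy sylQ.
pose E := [set x in Q | #[x] == r].
have sQN := pHall_sub sylQ.
have r_gt1 : 1 < r by move: r24; rewrite in_cons mem_seq1 => /orP[]/eqP->.
have sEQ : E \subset Q^#.
  apply/subsetP=> x; rewrite in_setD1 inE => /andP[-> /eqP ox].
  by rewrite -order_eq1 ox gtn_eqF.
have NE : N y :&: elts_of_order r = class_support E (N y).
  apply/setP=> x; apply/setIP/imset2P => [[Nx]|[z g Ez Ng ->]].
    rewrite inE => /andP[Gx /eqP ox]; have r2 : 2.-nat r.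
      by move: r24; rewrite in_cons mem_seq1 => /orP[]/eqP->.
    have x2 : 2.-elt x by rewrite /p_elt ox.
    have sxN : <[x]> \subset N y by rewrite cycle_subG.
    have [g Ng] := Sylow_subJ sylQ sxN x2; rewrite cycle_subG mem_conjg => Qx.
    by exists (x ^ g^-1) g; rewrite ?conjgKV // inE Qx orderJ ox /=.
  move: Ez; rewrite inE => /andP[Qz /eqP oz]; have Nz := subsetP sQN z Qz.
  have Nzg : z ^ g \in N y by rewrite groupJ.
  by rewrite Nzg inE orderJ oz eqxx andbT; case/setIP: Nzg.
have cardE : #|E| = (if r == 2 then 1 else if #|N y : 'C_G[y]| == 2 then 0 else 2)%N.
  have [e2|e4] := cent_index_even Oy; last first.
    rewrite e4 in cardQ *; have [E4 E2] := cyclic4_orders cycQ cardQ.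
    by move: r24; rewrite /E in_cons mem_seq1 => /orP[]/eqP->.
  rewrite e2 eqxx; have cardQ' : #|Q^#| = 1%N.
    by have := cardsD1 1 Q; rewrite group1 cardQ e2 => -[].
  move: r24; rewrite in_cons mem_seq1 => /orP[]/eqP Dr; rewrite Dr /=.
    rewrite -cardQ'; congr #|pred_of_set _|; apply/setP=> x; rewrite in_setD1 inE Dr.
    rewrite -order_eq1 andbC; case Qx: (x \in Q); rewrite ?andbF // !andbT.
    have := order_dvdG Qx; rewrite cardQ e2.
    by move: #[x] => [|[|[|n]]] // /dvdn_leq.
  apply/eqP; rewrite cards_eq0; apply/eqP/setP=> x; rewrite !inE Dr.
  apply/negP=> /andP[Qx /eqP ox]; have := order_dvdG Qx.
  by rewrite ox cardQ e2.
rewrite NE -cardE; have [-> | ntE] := eqVneq E set0.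
  rewrite cards0 muln0; apply/eqP; rewrite cards_eq0 -subset0.
  by apply/subsetP=> x /imset2P[z g]; rewrite inE.
have tiQ : normedTI Q^# (N y) Q by case/and3P: frobN.
have tiE : normedTI E (N y) Q.
  apply: normedTI_S tiQ => //; apply/subsetP=> z Qz; rewrite inE.
  apply/subsetP=> _ /imsetP[x + ->]; rewrite !inE => /andP[Qx /eqP ox].
  by rewrite groupJ // orderJ ox eqxx.
rewrite (card_support_normedTI tiE) mulnC; congr (_ * _)%N.
by rewrite -divgS // card_torus_norm -cardQ mulnK ?cardG_gt0.
Qed.

Lemma elts_of_orderJ r g : g \in G -> elts_of_order r :^ g = elts_of_order r.
Proof.
move=> Gg; apply/setP=> x; rewrite mem_conjg !inE orderJ.
by rewrite -mem_conjg conjGid.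
Qed.

(** The number of conjugates A of [N y] above z is the same for all z of order r: conjugation by g
    carries those above x to those above x ^ g, and x and x^-1 lie in the same subgroups. *)
Lemma count_containing y r x : y \in OG -> r \in [:: 2; 4] -> x \in elts_of_order r ->
  (#|G : N y| * #|N y :&: elts_of_order r|
     = #|elts_of_order r| * #|[set A in N y :^: G | x \in A]|)%N.
Proof.
move=> Oy r24 Ex; pose E := elts_of_order r.
have count_const z : z \in E ->
    #|[set A in N y :^: G | z \in A]| = #|[set A in N y :^: G | x \in A]|.
  move=> Ez; have [g Gg Dz] := same_order_conj r24 Ex Ez.
  rewrite -[RHS](card_imset _ (@conjsg_inj _ g)); congr #|pred_of_set _|.
  apply/setP=> A; rewrite inE; apply/andP/imsetP => [[/imsetP[k Gk ->] zA]|[A0 + ->]].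
    exists ((N y :^ k) :^ g^-1); last by rewrite conjsgKV.
    rewrite inE -conjsgM imset_f ?groupM ?groupV //= conjsgM mem_conjgV.
    by case: Dz zA => -> //; rewrite conjVg groupV.
  rewrite inE => /andP[/imsetP[k Gk ->] xA].
  rewrite -conjsgM imset_f ?groupM //; split=> //.
  by rewrite conjsgM; case: Dz => ->; rewrite memJ_conjg ?groupV.
rewrite -sum_nat_const -(eq_bigr _ count_const).
have -> : \sum_(z in E) #|[set A in N y :^: G | z \in A]| = \sum_(A in N y :^: G) #|A :&: E|.
  transitivity (\sum_(z in E) \sum_(A in N y :^: G) (z \in A : nat))%N.
    apply: eq_bigr => z _; rewrite -sum1_card big_mkcond [RHS]big_mkcond.
    by apply: eq_bigr => A _; rewrite inE; case: (A \in _); case: (z \in A).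
  rewrite exchange_big; apply: eq_bigr => A _.
  rewrite -sum1_card big_mkcond [RHS]big_mkcond.
  by apply: eq_bigr => z _; rewrite in_setI; case: (z \in E); case: (z \in A).
have -> : \sum_(A in N y :^: G) #|A :&: E| = (\sum_(A in N y :^: G) #|N y :&: E|)%N.
  apply: eq_bigr => _ /imsetP[k Gk ->].
  by have EJ : E :^ k = E := elts_of_orderJ r Gk; rewrite -{1}EJ -conjIg cardJg.
by rewrite sum_nat_const card_conjugates torus_norm_self.
Qed.

Lemma N_same_card y z : y \in OG -> z \in OG -> #|N y| = #|N z| ->
  exists2 g, g \in G & N z = N y :^ g.
Proof.
move=> Oy Oz; rewrite !card_torus_norm => eq_card.
suffices [g Gg ->] : exists2 g, g \in G & 'C_G[z] = 'C_G[y] :^ g.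
  by exists g; rewrite // normJ -{1}(conjGid Gg) -conjIg.
have r_gt0 : 0 < 2 ^ (p.+1)./2 by rewrite expn_gt0.
have le_rq : 2 ^ (p.+1)./2 <= q.
  by rewrite leq_exp2l // leq_uphalf_double -addnn leq_addr.
have [neq1 neq2 neq3] := torus_orders_neq q_ge8 q_even r_gt0 le_rq.
have [y1 [y2 [[Oy1 Oy2 k1 k2] [e1 e2 cover]]]] := torus_split.
have trans (K : {group gT}) : (exists2 g, g \in G & 'C_G[y] = K :^ g) ->
    (exists2 g, g \in G & 'C_G[z] = K :^ g) -> exists2 g, g \in G & 'C_G[z] = 'C_G[y] :^ g.
  case=> g Gg -> [k Gk ->]; exists (g^-1 * k); first by rewrite groupM ?groupV.
  by rewrite conjsgM conjsgK.
have cardC w v g : g \in G -> 'C_G[w] = 'C_G[v] :^ g ->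
    (#|'C_G[w]| * #|N w : 'C_G[w]|)%N = (#|'C_G[v]| * #|N v : 'C_G[v]|)%N.
  move=> Gg ->; rewrite cardJg; congr (_ * _)%N.
  by rewrite normJ -{1}(conjGid Gg) -conjIg indexJg.
have cardCH w g : g \in G -> 'C_G[w] = H :^ g ->
    (#|'C_G[w]| * #|N w : 'C_G[w]|)%N = ((q - 1) * 2)%N.
  by move=> Gg CwE; rewrite (cent_H_index Gg CwE) CwE cardJg cardH.
move: eq_card.
case: (cover y Oy) (cover z Oz) => -[g Gg CyE] [] [k Gk CzE];
  rewrite ?(cardCH _ _ Gg CyE) ?(cardCH _ _ Gk CzE) ?(cardC _ _ _ Gg CyE)
    ?(cardC _ _ _ Gk CzE) ?k1 ?k2 ?e1 ?e2 => /eqP.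
all: rewrite ?(negPf neq1) ?(negPf neq2) ?(negPf neq3) //.
all: rewrite 1?eq_sym ?(negPf neq1) ?(negPf neq2) ?(negPf neq3) //.
all: move=> _; by [apply: (trans H); [exists g | exists k] | apply: (trans 'C_G[y1]%G); [exists g | exists k] | apply: (trans 'C_G[y2]%G); [exists g | exists k]].
Qed.

Lemma OG_conj y g : g \in G -> (y ^ g \in OG) = (y \in OG).
Proof. by move=> Gg; rewrite !inE conjg_eq1 orderJ groupJr. Qed.

Lemma N_conj y g : g \in G -> N (y ^ g) = N y :^ g.
Proof. by move=> Gg; rewrite cent_conj // normJ -{1}(conjGid Gg) -conjIg. Qed.

Lemma maximal_card_N y (M : {group gT}) : y \in OG -> maximal M G -> #|M| = #|N y| ->
  exists2 g, g \in G & M :=: N y :^ g.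
Proof.
move=> Oy /maximal_cases[[g Gg ->]|[z Oz ->]]; last by move/esym; apply: N_same_card.
by rewrite cardJg cardB => cardN; have := card_N_lt Oy; rewrite cardN ltnn.
Qed.

Lemma count_maximals y x : y \in OG ->
  #|[set A in N y :^: G | x \in A]|
   = #|[set M in maximals_containing G x | #|M| == #|N y|]|.
Proof.
move=> Oy; rewrite -[RHS](card_imset _ (@group_inj gT)); congr #|pred_of_set _|.
apply/setP=> A; rewrite inE; apply/andP/imsetP => [[/imsetP[g Gg ->] xA]|[M + ->]].
  exists (N y :^ g)%G => //; rewrite !inE cardJg eqxx andbT xA andbT.
  have := maximal_N (_ : y ^ g \in OG); rewrite OG_conj // => /(_ Oy).
  by congr maximal; apply: N_conj.
rewrite !inE => /andP[/andP[maxM xM] /eqP cardM].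
have [g Gg defM] := maximal_card_N Oy maxM cardM; split=> //.
by rewrite /= defM imset_f.
Qed.

Lemma count_N y r x : y \in OG -> r \in [:: 2; 4] -> x \in elts_of_order r ->
  #|[set M in maximals_containing G x | #|M| == #|N y|]| =
    if r == 2 then (q ^ 2 %/ #|N y : 'C_G[y]|)%N
    else if #|N y : 'C_G[y]| == 2 then 0 else (q %/ 2)%N.
Proof.
move=> Oy r24 Ex; rewrite -count_maximals //; set n := #|_|.
have := count_containing Oy r24 Ex; rewrite -/n card_N_order //.
have GN : #|G| = (#|'C_G[y]| * #|N y : 'C_G[y]| * #|G : N y|)%N.
  by rewrite -card_torus_norm // Lagrange // subsetIl.
rewrite cardG in GN.
have C_gt0 : 0 < #|'C_G[y]| := cardG_gt0 _.
move: r24 Ex; rewrite in_cons mem_seq1 => /orP[]/eqP-> _ /=.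
  by rewrite card_order2; apply: count2_arith => //; apply: leq_trans q_ge8.
have [e2|e4] := cent_index_even Oy; [rewrite e2 | rewrite e4] => /=; last first.
  by rewrite card_order4; rewrite e4 in GN; apply: count4_arith => //; apply: leq_trans q_ge8.
rewrite !muln0 card_order4 => /esym/eqP; rewrite muln_eq0 muln_eq0 addn1 /= => /orP[|/eqP//].
by rewrite -{1}mulnn -{3}[q]muln1 -mulnBr muln_eq0 !eqn0Ngt q_gt0 q1_gt0.
Qed.

(** * Recognition of the types of maximal subgroups by their orders *)

(** The extension of S / Z by Z does not split: the squares in a complement D lie in Z ∩ D = 1, so D
    lies in Z and is trivial. *)
Lemma S_C2p_C2p : is_C2p_C2p p S.
Proof.
have nsZS : Z <| S.
  by rewrite /normal sZS (subset_trans sSB) ?Z_char_norm.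
apply/existsP; exists Z; rewrite nsZS cardZ eqxx /=.
have cardSZ : #|S / Z| = q.
  by rewrite card_quotient ?normal_norm // -divgS // cardS cardZ -mulnn mulnK ?q_gt0.
rewrite cardSZ eqxx /=; apply/and3P; split.
- apply: exponent2_abelem; apply/exponentP=> z Zz; apply/eqP.
  by rewrite ZE ?(subsetP sZS).
- apply: exponent2_abelem; apply/exponentP=> _ /morphimP[s nZs Ss ->].
  by rewrite -morphX //= coset_id // sqS.
apply/negP=> /splitsP[D /complP[tiZD defS]].
have sDS : D \subset S by rewrite -defS mulG_subr.
have D1 : D \subset [1].
  apply/subsetP=> d Dd; rewrite -tiZD inE Dd andbT -ZE ?(subsetP sDS) //.
  have : d ^+ 2 \in Z :&: D.
    by apply/setIP; split; [apply/sqS/(subsetP sDS) | apply: groupX].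
  by rewrite tiZD => /set1P->.
have := TI_cardMg tiZD; rewrite defS cardS cardZ (trivgP D1) cards1 muln1 => /eqP.
rewrite -[X in _ == X]expn1 eqn_exp2l //; exact: leq_trans q_ge8.
Qed.

(** The four types have distinct orders, so the order of a maximal subgroup decides its type, and
    all later counts go by orders. *)
Lemma borel_typeE (M : {group gT}) : maximal M G ->
  borel_type p G M = (#|M| == q ^ 2 * (q - 1))%N.
Proof.
move=> maxM; apply/existsP/eqP => [[P /existsP[K /and5P[_ PE KE]]]|cardM].
  move=> /eqP/sdprod_card cardN /card_isog ->; rewrite -cardN; case/andP: KE => _ /eqP->.
  case/existsP: PE => E /and5P[nsEP _ /eqP cE _ /andP[/eqP cPE _]].
  rewrite card_quotient ?normal_norm // in cPE.
  by rewrite -(Lagrange (normal_sub nsEP)) cE cPE mulnn.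
have [[g Gg defM]|[y Oy defM]] := maximal_cases maxM; last first.
  by have := card_N_lt Oy; rewrite -defM cardM ltnn.
exists S; apply/existsP; exists H; rewrite sylS S_C2p_C2p /is_C cycH cardH eqxx.
rewrite sdB NGS eqxx /= defM isog_sym; exact: conj_isog.
Qed.

Lemma frobenius_typeE n (M : {group gT}) : n \in [:: q_plus p; q_minus p] -> maximal M G ->
  frobenius_type n G M = (#|M| == n * 4)%N.
Proof.
move=> n_pm maxM; apply/existsP/eqP => [[K /existsP[Q /and5P[_ KE QE /eqP sdN isoM]]]|cardM].
  rewrite (card_isog isoM) -(sdprod_card sdN).
  by case/andP: KE QE => _ /eqP-> /andP[_ /eqP->].
have nB : #|M| != (q ^ 2 * (q - 1))%N.
  apply/eqP=> cardB'; have := cardM; rewrite cardB' => /eqP; apply/negP.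
  have le_rq : 2 ^ (p.+1)./2 <= q.
    by rewrite leq_exp2l // leq_uphalf_double -addnn leq_addr.
  rewrite gtn_eqF // torus_small ?q_ge8 //; move: n_pm le_rq; rewrite in_cons mem_seq1.
  by case/orP=> /eqP->; rewrite /q_plus /q_minus /sqrt2q;
     move: (2 ^ p)%N (2 ^ (p.+1)./2)%N; clear; lia.
have [[g Gg defM]|[y Oy defM]] := maximal_cases maxM.
  by rewrite defM cardJg cardB eqxx in nB.
have r_gt0 : 0 < 2 ^ (p.+1)./2 by rewrite expn_gt0.
have le_rq : 2 ^ (p.+1)./2 <= q.
  by rewrite leq_exp2l // leq_uphalf_double -addnn leq_addr.
have [neq1 neq2 neq3] := torus_orders_neq q_ge8 q_even r_gt0 le_rq.
have [cardC e4] : #|'C_G[y]| = n /\ #|N y : 'C_G[y]| = 4.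
  move: cardM; rewrite defM card_torus_norm //.
  by case: (cent_cases Oy) => -[-> ->] /eqP; move: n_pm; rewrite in_cons mem_seq1;
    case/orP=> /eqP->; rewrite ?(negPf neq1) ?(negPf neq2) ?(negPf neq3) //
      eq_sym ?(negPf neq3).
have [Q sylQ] := Sylow_exists 2 (N y).
exists 'C_G[y]%G; apply/existsP; exists Q; apply/and5P; split.
- exact: subsetIl.
- by rewrite /is_C torus_cyclic //= cardC.
- by rewrite /is_C (torus_sylow_cyclic Oy sylQ) (card_torus_sylow Oy sylQ) e4.
- by rewrite (torus_sylow_sdprod Oy sylQ).
by rewrite defM isog_refl.
Qed.

Lemma dihedral_typeE (M : {group gT}) : maximal M G ->
  dihedral_type p M = (#|M| == (q - 1) * 2)%N.
Proof.
move=> maxM; have q1_gt1 : 1 < q - 1 by rewrite ltn_subRL (leq_trans _ q_ge8).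
apply/idP/eqP => [/card_isog->|cardM].
  by rewrite mul2n card_dihedral // muln2.
have ltM : #|M| < #|B|.
  by rewrite cardM cardB mulnC ltn_pmul2r ?q1_gt0 // -mulnn (leq_trans _ (leq_mul q_ge8 q_ge8)).
have [[g Gg defM]|[y Oy defM]] := maximal_cases maxM.
  by move: ltM; rewrite defM cardJg ltnn.
have r_gt0 : 0 < 2 ^ (p.+1)./2 by rewrite expn_gt0.
have le_rq : 2 ^ (p.+1)./2 <= q.
  by rewrite leq_exp2l // leq_uphalf_double -addnn leq_addr.
have [neq1 neq2 neq3] := torus_orders_neq q_ge8 q_even r_gt0 le_rq.
have cardC : #|'C_G[y]| = (q - 1)%N.
  move: cardM; rewrite defM card_torus_norm //.
  by case: (cent_cases Oy) => -[-> ->] // /eqP; rewrite eq_sym ?(negPf neq1) ?(negPf neq2).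
have [c defC] := cyclicP (torus_cyclic Oy).
have oc : #[c] = (q - 1)%N by rewrite /order -defC.
have Cc : c \in 'C_G[y] by rewrite defC cycle_id.
have [z Nz oz] := N_invol Oy.
have [Gy nt_y y_odd] := odd_partGP _ Oy.
have zz : z * z = 1 by rewrite -(expg_order z) oz.
have cz : c ^ z = c^-1 by apply: (norm_cent_invol Gy nt_y y_odd Nz oz).
have sCN : 'C_G[y] \subset N y by rewrite subsetI subsetIl normG.
have nt_c : c != 1 by rewrite -order_eq1 oc gtn_eqF.
have zV : z^-1 = z by apply: (mulgI z); rewrite mulgV zz.
(* As the involution z inverts a generator c of the centraliser, z and z c are involutions, and they
   generate [N y]. *)
have o_zc : #[z * c] = 2.
  apply: nt_prime_order => //; last first.
    apply: contraTneq (Nz) => zc1; have := torus_odd Oy; rewrite defC -orderE.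
    by rewrite -[c](mulKg z) zc1 mulg1 zV oz.
  rewrite expgS expg1; have -> : z * c * (z * c) = c ^ z * c by rewrite /conjg zV !mulgA.
  by rewrite cz mulVg.
have Ncz : z * c \in N y by rewrite groupM // (subsetP sCN).
have gen_eq : <<[set z; z * c]>> = N y.
  apply/eqP; rewrite eqEcard gen_subG; apply/andP; split.
    by apply/subsetP=> w /set2P[]->.
  have Kz : z \in <<[set z; z * c]>> by rewrite mem_gen // set21.
  have Kc : c \in <<[set z; z * c]>>.
    by rewrite -(groupMl _ Kz) mem_gen // set22.
  have sCK : 'C_G[y] \subset <<[set z; z * c]>> by rewrite defC cycle_subG.
  rewrite -defM cardM -cardC -(Lagrange sCK) leq_mul2l indexg_gt1 orbC.
  apply/orP; left; apply: contraL (torus_odd Oy) => /subsetP/(_ z Kz) Cz.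
  by have := order_dvdG Cz; rewrite oz dvdn2.
have := involutions_gen_dihedral oz o_zc _.
rewrite gen_eq -defM cardM mulnC; apply.
by rewrite -{1}[z]mulg1 (inj_eq (mulgI z)) eq_sym.
Qed.

(** * Solubilizers *)

Lemma oddpart_or_2 x : x \in G -> x != 1 ->
  x \in OG \/ ((#[x] = 2 \/ #[x] = 4) /\ exists2 g, g \in G & x \in S :^ g).
Proof.
move=> Gx nt_x; have [x_odd|x_even] := boolP (odd #[x]).
  by left; apply/odd_partGP.
right; have [g Gg Sx] := even_S Gx x_even; split; last by exists g.
rewrite mem_conjg in Sx; rewrite -(orderJ x g^-1) S_order ?conjg_eq1 //.
by case: ifP; auto.
Qed.

Lemma element_orders x : x \in G -> x != 1 ->
  #[x] = 2 \/ #[x] = 4 \/ (#[x] %| q - 1)%N \/ (#[x] %| q_plus p)%N \/ (#[x] %| q_minus p)%N.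
Proof.
move=> Gx nt_x; have [Ox|[[]]] := oddpart_or_2 Gx nt_x; [|by auto|by auto].
have dvdC : #[x] %| #|'C_G[x]| by rewrite order_dvdG // inE Gx cent1id.
by case: (cent_cases Ox) => -[CE _]; rewrite CE in dvdC; auto.
Qed.

Lemma maximal_orders (M : {group gT}) : maximal M G ->
  [\/ #|M| = (q ^ 2 * (q - 1))%N, #|M| = ((q - 1) * 2)%N, #|M| = (q_plus p * 4)%N
    | #|M| = (q_minus p * 4)%N].
Proof.
case/maximal_cases=> [[g Gg ->]|[y Oy ->]].
  by constructor 1; rewrite cardJg cardB.
rewrite card_torus_norm //; case: (cent_cases Oy) => -[-> ->].
- by constructor 2.
- by constructor 3.
by constructor 4.
Qed.

Lemma maximal_types (M : {group gT}) : maximal M G ->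
  borel_type p G M \/ dihedral_type p M \/
    frobenius_type (q_plus p) G M \/ frobenius_type (q_minus p) G M.
Proof.
move=> maxM; rewrite borel_typeE ?dihedral_typeE ?frobenius_typeE ?inE ?eqxx ?orbT //.
by case: (maximal_orders maxM) => ->; rewrite eqxx; auto.
Qed.

Lemma solubilizerE x : x \in G ->
  solubilizer G x = \bigcup_(M in maximals_containing G x) M.
Proof.
move=> Gx; apply/setP=> y; rewrite inE; apply/andP/bigcupP => [[Gy sol_xy]|[M]].
  pose U := <<[set x; y]>>%G.
  have sUG : U \subset G by rewrite gen_subG; apply/subsetP=> w /set2P[]->.
  have neqUG : U :!=: G by apply: contraTneq sol_xy => ->; apply: G_nonsolvable.
  have Ux : x \in U by rewrite mem_gen ?set21.
  have Uy : y \in U by rewrite mem_gen ?set22.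
  have [[g Gg sU]|[z Oz sU]] := containedP sUG neqUG.
    exists (B :^ g)%G; last exact: (subsetP sU).
    by rewrite inE (maximal_B Gg) (subsetP sU).
  exists 'N_G('C_G[z])%G; last exact: (subsetP sU).
  by rewrite inE (maximal_N Oz) (subsetP sU).
rewrite inE => /andP[maxM Mx] My; split.
  by apply: subsetP My; apply: proper_sub (maxgroupp maxM).
apply: solvableS (maximal_solvable maxM).
by rewrite gen_subG; apply/subsetP=> w /set2P[]->.
Qed.

Definition num_maximals x (n : nat) := #|[set M in maximals_containing G x | #|M| == n]|.

Lemma maximal_countsE x : maximal_counts p G x =
  (num_maximals x (q ^ 2 * (q - 1)), num_maximals x ((q - 1) * 2),
   num_maximals x (q_plus p * 4), num_maximals x (q_minus p * 4))%N.
Proof.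
have card_eq (P : pred {group gT}) n : (forall M : {group gT}, maximal M G -> P M = (#|M| == n)) ->
    #|[set M in maximals_containing G x | P M]| = num_maximals x n.
  move=> PE; congr #|pred_of_set _|; apply/setP=> M; rewrite !inE.
  by case maxM: (maximal M G); rewrite //= PE.
congr (_, _, _, _); apply: card_eq => M maxM.
- exact: borel_typeE.
- exact: dihedral_typeE.
- by apply: frobenius_typeE; rewrite ?inE ?eqxx.
by apply: frobenius_typeE; rewrite ?inE ?eqxx ?orbT.
Qed.

Lemma orders_neq : uniq [:: q ^ 2 * (q - 1); (q - 1) * 2; q_plus p * 4; q_minus p * 4]%N.
Proof.
have r_gt0 : 0 < 2 ^ (p.+1)./2 by rewrite expn_gt0.
have le_rq : 2 ^ (p.+1)./2 <= q.
  by rewrite leq_exp2l // leq_uphalf_double -addnn leq_addr.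
have [neq1 neq2 neq3] := torus_orders_neq q_ge8 q_even r_gt0 le_rq.
have nB k : k <= 4 * (2 * q + 1) -> (q ^ 2 * (q - 1) == k)%N = false.
  by move=> le_k; apply: gtn_eqF; apply: torus_small q_ge8 le_k.
rewrite /= !inE (negPf neq1) (negPf neq2) (negPf neq3) !nB //.
all: move: le_rq; rewrite /q_plus /q_minus /sqrt2q.
all: by move: (2 ^ p)%N (2 ^ (p.+1)./2)%N; clear; lia.
Qed.

(** Outside K the members of P are pairwise disjoint. K will be the conjugate of B above a 2-element
    x, or ['C_G[x]] for x conjugate into H. *)
Lemma card_star (P : {set {group gT}}) (K : {group gT}) :
    K \subset \bigcup_(M in P) M ->
    {in P &, forall M L : {group gT}, M != L -> M :&: L \subset K} ->
  #|\bigcup_(M in P) M| = (#|K| + \sum_(M in P) (#|M| - #|M :&: K|))%N.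
Proof.
move=> sK tiP; rewrite -(cardsID K) (setIidPr sK); congr (_ + _)%N.
(* The family is extended by the empty set to all subgroups, as disjointness is required for every
   pair of distinct indices. *)
pose f (M : {group gT}) := if M \in P then M :\: K else set0.
have tif M L : M != L -> [disjoint f M & f L].
  rewrite /f; case: ifP => [PM|]; last by rewrite -setI_eq0 set0I eqxx.
  case: ifP => [PL|]; last by rewrite -setI_eq0 setI0 eqxx.
  move=> /(tiP M L PM PL) sub; rewrite -setI_eq0 -subset0; apply/subsetP=> w.
  case/setIP=> /setDP[Mw nKw] /setDP[Lw _]; case/negP: nKw.
  by apply: (subsetP sub); apply/setIP.
have -> : (\bigcup_(M in P) M) :\: K = \bigcup_M f M.
  apply/setP=> w; apply/setDP/bigcupP => [[/bigcupP[M PM Mw] nKw]|[M _]].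
    by exists M; rewrite // /f PM; apply/setDP.
  rewrite /f; case: ifP => [PM /setDP[Mw nKw]|_]; last by rewrite inE.
  by split=> //; apply/bigcupP; exists M.
rewrite -sum1_card (partition_disjoint_bigcup addn (fun=> 1%N) tif) [RHS]big_mkcond.
apply: eq_bigr => M _; rewrite sum1_card /f; case: ifP => _; last by rewrite cards0.
by rewrite cardsD.
Qed.

Lemma sum_by_order x (f : nat -> nat) :
  \sum_(M in maximals_containing G x) f #|M| =
    (num_maximals x (q ^ 2 * (q - 1)) * f (q ^ 2 * (q - 1))
     + num_maximals x ((q - 1) * 2) * f ((q - 1) * 2)
     + num_maximals x (q_plus p * 4) * f (q_plus p * 4)
     + num_maximals x (q_minus p * 4) * f (q_minus p * 4))%N.
Proof.
pose ns := [:: q ^ 2 * (q - 1); (q - 1) * 2; q_plus p * 4; q_minus p * 4]%N.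
transitivity (\sum_(n <- ns) num_maximals x n * f n)%N; last first.
  by rewrite /ns unlock /= addn0 !addnA.
have nsE n : (num_maximals x n * f n = \sum_(M in maximals_containing G x)
    if #|M| == n then f n else 0)%N.
  rewrite -sum_nat_const big_mkcond [RHS]big_mkcond; apply: eq_bigr => M _.
  by rewrite in_set; case: (M \in _).
rewrite (eq_bigr _ (fun n _ => nsE n)) exchange_big; apply: eq_bigr => M.
rewrite inE => /andP[maxM _].
have nsM : #|M| \in ns.
  by rewrite !inE; case: (maximal_orders maxM) => ->; rewrite eqxx ?orbT.
rewrite (bigD1_seq #|M|) ?orders_neq //= eqxx big1 ?addn0 // => n.
by rewrite eq_sym => /negPf->.
Qed.

Lemma BJ_S x g : g \in G -> x \in B :^ g -> ~~ odd #[x] -> x \in S :^ g.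
Proof.
move=> Gg; rewrite !mem_conjg => Bx x_even; apply: B_even => //.
by rewrite orderJ.
Qed.

Lemma borel_unique x g k : g \in G -> k \in G -> x \in S :^ g -> x != 1 -> x \in B :^ k ->
  B :^ k = B :^ g.
Proof.
move=> Gg Gk Sx nt_x Bx; have x_even : ~~ odd #[x].
  by apply: contra nt_x => /(elt2_odd (S_2elt Sx))->.
have eqS := S_conj_eq Gk Gg (BJ_S Gk Bx x_even) Sx nt_x.
by rewrite -NGS !conjIg !(conjGid Gg, conjGid Gk) -!normJ eqS.
Qed.

(** A non-identity element of odd order in both normalisers would lie in both centralisers and
    identify them. So the intersection is a 2-group, contained in the conjugate of S that contains
    x. *)
Lemma torus_capS x g y z : g \in G -> x \in S :^ g -> x != 1 -> y \in OG -> z \in OG ->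
  x \in N y -> x \in N z -> 'C_G[y] != 'C_G[z] -> N y :&: N z \subset S :^ g.
Proof.
move=> Gg Sx nt_x Oy Oz Nyx Nzx neqC; pose D := ('N_G('C_G[y]) :&: 'N_G('C_G[z]))%G.
have D2 : 2.-group D.
  apply/pgroupP=> r r_pr /(Cauchy r_pr)[w /setIP[Nyw Nzw] ow]; apply: contraR neqC => r2.
  have w_odd : odd #[w] by rewrite ow; case: (even_prime r_pr) r2 => // ->.
  have nt_w : w != 1 by rewrite -order_eq1 ow gtn_eqF ?prime_gt1.
  by rewrite -(torus_cent Oy (torus_odd_elt Oy Nyw w_odd) nt_w)
    -(torus_cent Oz (torus_odd_elt Oz Nzw w_odd) nt_w).
have sDG : D \subset G by rewrite subIset // subsetIl.
have [k Gk sDS] := Sylow_subJ sylS sDG D2.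
rewrite (S_conj_eq Gg Gk Sx _ nt_x) //.
by apply: (subsetP sDS); apply/setIP.
Qed.

Lemma order_dvd4 x (D : {group gT}) : #|D| %| 4 -> x \in D -> x != 1 ->
  #|D| = 2 \/ #|D| = 4.
Proof.
move=> dvd4 Dx nt_x; have D1 : #|D| != 1%N.
  by apply: contra nt_x => /eqP/card1_trivg D1; rewrite D1 in Dx; apply/eqP/set1P.
by move: #|D| dvd4 D1 => [|[|[|[|[|n]]]]] //; auto=> /dvdn_leq; move/(_ isT).
Qed.

Lemma maximal_cap x g (M L : {group gT}) : g \in G -> x \in S :^ g -> x != 1 ->
    M \in maximals_containing G x -> L \in maximals_containing G x -> M != L ->
  [/\ M :&: L \subset S :^ g, cyclic (M :&: L) & #|M :&: L| %| 4].
Proof.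
move=> Gg Sx nt_x; pose ok (A : {set gT}) := [/\ A \subset S :^ g, cyclic A & #|A| %| 4].
have okBN y : y \in OG -> x \in N y -> ok (N y :&: B :^ g).
  move=> Oy Ny; have [sub cyc card] := torus_cap_B Oy Gg Sx nt_x Ny; split=> //.
  by rewrite card; case: (cent_index_even Oy) => ->.
rewrite !inE => /andP[maxM Mx] /andP[maxL Lx] neqML.
have {neqML} neqML : M != L :> {set gT} by apply: contra neqML => /eqP/group_inj->.
have [[k Gk defM]|[y Oy defM]] := maximal_cases maxM;
have [[l Gl defL]|[z Oz defL]] := maximal_cases maxL; rewrite -/(ok _).
all: rewrite defM defL in neqML *; rewrite defM in Mx; rewrite defL in Lx.
- case/eqP: neqML.
  by rewrite (borel_unique Gg Gk Sx nt_x Mx) (borel_unique Gg Gl Sx nt_x Lx).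
- by rewrite (borel_unique Gg Gk Sx nt_x Mx) setIC; apply: okBN.
- by rewrite (borel_unique Gg Gl Sx nt_x Lx); apply: okBN.
have neqC : 'C_G[y] != 'C_G[z] by apply: contra neqML => /eqP->.
have sub := torus_capS Gg Sx nt_x Oy Oz Mx Lx neqC.
have sub' : N y :&: N z \subset N y :&: B :^ g.
  by rewrite subsetI subsetIl (subset_trans sub) // conjSg sSB.
have [_ cyc dvd4] := okBN y Oy Mx; split=> //; first exact: cyclicS cyc.
exact: dvdn_trans (cardSg sub') dvd4.
Qed.

Lemma num_borel_2 x g : g \in G -> x \in S :^ g -> x != 1 ->
  num_maximals x (q ^ 2 * (q - 1))%N = 1%N.
Proof.
move=> Gg Sx nt_x; rewrite -[RHS](cards1 (B :^ g)%G); congr #|pred_of_set _|.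
apply/setP=> M; rewrite in_set in_set1 inE; apply/idP/eqP => [|->].
  case/andP=> /andP[maxM Mx] /eqP cardM; apply: group_inj.
  have [[k Gk defM]|[y Oy defM]] := maximal_cases maxM; last first.
    by have := card_N_lt Oy; rewrite -defM cardM ltnn.
  by rewrite defM; apply: (borel_unique Gg Gk Sx nt_x); rewrite -defM.
by rewrite (maximal_B Gg) cardJg cardB eqxx andbT (subsetP _ x Sx) // conjSg sSB.
Qed.

Lemma num_N_2 r x n e : x \in G -> #[x] = r -> r \in [:: 2; 4] ->
    (n, e) \in [:: ((q - 1) * 2, 2); (q_plus p * 4, 4); (q_minus p * 4, 4)]%N ->
  num_maximals x n = if r == 2 then (q ^ 2 %/ e)%N else if e == 2 then 0 else (q %/ 2)%N.
Proof.
move=> Gx ox r24 ne; have Ex : x \in elts_of_order r by rewrite inE Gx ox /=.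
suffices [y [Oy eN <-]] : exists y, [/\ y \in OG, n = #|N y| & #|N y : 'C_G[y]| = e].
  by rewrite eN; apply: count_N.
have [y1 [y2 [[Oy1 Oy2 k1 k2] [e1 e2 _]]]] := torus_split.
have [h Hh] : exists h, h \in H^# by apply/set0Pn; rewrite setD_eq0 subG1 H_neq1.
have [nt_h H_h] := setD1P Hh.
have CH : 'C_G[h] = H :^ 1 by rewrite conjsg1 cent_H.
have Oh : h \in OG.
  by apply/odd_partGP; split; rewrite // ?(subsetP sHG) // (dvdn_odd (order_dvdG H_h)) ?H_odd.
move: ne; rewrite !inE !xpair_eqE => /or3P[]/andP[/eqP-> /eqP->].
- by exists h; rewrite card_torus_norm // (cent_H_index (group1 G) CH) CH cardJg cardH.
- by exists y1; rewrite card_torus_norm // e1 k1.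
by exists y2; rewrite card_torus_norm // e2 k2.
Qed.

Lemma card_sol_2 x g : g \in G -> x \in S :^ g -> x != 1 ->
  #|solubilizer G x| = (q ^ 2 * (q - 1) + num_maximals x ((q - 1) * 2) * ((q - 1) * 2 - 2)
    + num_maximals x (q_plus p * 4) * (q_plus p * 4 - 4)
    + num_maximals x (q_minus p * 4) * (q_minus p * 4 - 4))%N.
Proof.
move=> Gg Sx nt_x; have Gx : x \in G.
  by apply: subsetP Sx; rewrite -(conjGid Gg) conjSg sSG.
have Bx : x \in B :^ g by rewrite (subsetP _ x Sx) // conjSg sSB.
have PB : (B :^ g)%G \in maximals_containing G x by rewrite inE (maximal_B Gg).
rewrite solubilizerE // (@card_star _ (B :^ g)%G); first last.
- move=> M L PM PL neqML; have [sub _ _] := maximal_cap Gg Sx nt_x PM PL neqML.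
  by rewrite (subset_trans sub) // conjSg sSB.
- exact: (bigcup_sup (B :^ g)%G).
rewrite cardJg cardB; pose b := (q ^ 2 * (q - 1))%N.
(* [f n] is what a maximal subgroup of order n adds to [B :^ g]: nothing for [B :^ g] itself,
   otherwise n less the order of the intersection, which is 2 in the dihedral case and 4 in the two
   others. *)
pose f n := (n - (if n == b then b else if n == (q - 1) * 2 then 2 else 4))%N.
rewrite (eq_bigr (fun M : {group gT} => f #|M|)) => [|M PM].
  rewrite sum_by_order (num_borel_2 Gg Sx nt_x); have := orders_neq.
  rewrite /= !inE !negb_or -!andbA => /and4P[n1 n2 n3 /and4P[n4 n5 n6 _]].
  rewrite /f /b !eqxx subnn muln0 add0n -!addnA; congr (_ + (_ + (_ + _)))%N.
  - by rewrite eq_sym (negPf n1).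
  - by rewrite eq_sym (negPf n2) eq_sym (negPf n4).
  by rewrite eq_sym (negPf n3) eq_sym (negPf n5).
rewrite /f; congr (_ - _)%N; move: (PM); rewrite inE => /andP[maxM Mx].
have [[k Gk defM]|[y Oy defM]] := maximal_cases maxM.
  rewrite defM in Mx *; rewrite (borel_unique Gg Gk Sx nt_x Mx).
  by rewrite /= setIid cardJg cardB eqxx.
have Nx : x \in N y by rewrite -defM.
have [_ _ card] := torus_cap_B Oy Gg Sx nt_x Nx.
have ltM := card_N_lt Oy; rewrite /= defM card (ltn_eqF ltM) card_torus_norm //.
have := orders_neq; rewrite /= !inE !negb_or -!andbA => /and4P[n1 n2 n3 /and4P[n4 n5 n6 _]].
case: (cent_cases Oy) => -[-> ->]; first by rewrite eqxx.
  by rewrite eq_sym (negPf n4).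
by rewrite eq_sym (negPf n5).
Qed.

(** In the action on the conjugates of B the element x fixes exactly two points, which gives two
    conjugates of B. A normaliser [N y] containing the odd element x has ['C_G[y] = 'C_G[x]]. *)
Lemma maximals_H x g : g \in G -> x \in H :^ g -> x != 1 ->
  [/\ 'C_G[x] = H :^ g, x \in OG &
   maximals_containing G x = [set (B :^ g)%G; (B :^ (t * g))%G; 'N_G('C_G[x])%G]].
Proof.
move=> Gg Hx nt_x; have CE := cent_HJ Gg Hx nt_x.
have Gx : x \in G by apply: subsetP Hx; rewrite -(conjGid Gg) conjSg sHG.
have Ox : x \in OG.
  apply/odd_partGP; split=> //; apply: dvdn_odd (order_dvdG Hx) _.
  by rewrite cardJg H_odd.
have Gtg : t * g \in G by rewrite groupM.
have sHBt : H \subset B :^ t by rewrite -{1}tiBt subsetIr.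
have sHB : H \subset B by rewrite -{1}tiBt subsetIl.
split=> //; apply/setP=> M; rewrite !in_setU !in_set1 inE.
apply/andP/idP => [[maxM Mx]|]; last first.
  case/orP=> [/orP[]|] /eqP->.
  - by rewrite (maximal_B Gg) (subsetP _ x Hx) // conjSg.
  - by rewrite (maximal_B Gtg) (subsetP _ x Hx) //= conjsgM conjSg.
  by rewrite (maximal_N Ox) (mem_N Ox).
have [[k Gk defM]|[y Oy defM]] := maximal_cases maxM; last first.
  apply/orP; right; apply/eqP/group_inj; rewrite defM /=.
  by rewrite (N_sub_eq Ox Oy) // -defM.
suffices [BE1|BE1] : B :^ k = B :^ g \/ B :^ k = B :^ (t * g).
- by rewrite -orbA; apply/orP; left; apply/eqP/group_inj; rewrite defM.
- by rewrite orbAC; apply/orP; right; apply/eqP/group_inj; rewrite defM.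
pose h := x ^ g^-1; have Hh : h \in H by rewrite -mem_conjg.
have nt_h : h != 1 by rewrite conjg_eq1.
have Bl : h \in B :^ (k * g^-1) by rewrite conjsgM memJ_conjg -defM.
have BkE : B :^ k = (B :^ (k * g^-1)) :^ g by rewrite -conjsgM mulgKV.
suffices [BE1|BE1] : B :^ (k * g^-1) = B \/ B :^ (k * g^-1) = B :^ t.
- by left; rewrite BkE BE1.
- by right; rewrite BkE BE1 conjsgM.
have Gl : k * g^-1 \in G by rewrite groupM ?groupV.
have := subsetP GE _ Gl; case/setUP=> [Bl'|]; first by left; rewrite conjGid.
case/mulsgP=> _ s /rcosetP[b Bb ->] Ss lE; right.
have BlE : B :^ (k * g^-1) = (B :^ t) :^ s by rewrite lE !conjsgM (conjGid Bb).
have Bs : s \in B by apply: (subsetP sSB).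
have Hhs : h ^ s^-1 \in H.
  rewrite -tiBt; apply/setIP; split; last by rewrite -mem_conjg -BlE.
  by rewrite groupJ ?groupV // (subsetP sHB).
have hE : h = (h ^ s^-1) ^ s by rewrite conjgKV.
have s1 : s = 1.
  apply: (@H_conjS (h ^ s^-1)) => //; last by rewrite -hE.
  by rewrite in_setD1 conjg_eq1 nt_h.
by rewrite BlE s1 conjsg1.
Qed.

Lemma cap_N_B x g : x \in OG -> g \in G -> #|N x : 'C_G[x]| = 2 -> 'C_G[x] \subset B :^ g ->
  N x :&: B :^ g = 'C_G[x].
Proof.
move=> Ox Gg idx sCB; have sCN : 'C_G[x] \subset N x by rewrite subsetI subsetIl normG.
have sCD : 'C_G[x] \subset N x :&: B :^ g by rewrite subsetI sCN.
have := Lagrange_index (subsetIl (N x) (B :^ g)) sCD; rewrite idx => idxE.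
have nD1 : #|N x : N x :&: B :^ g| != 1%N.
  by rewrite indexg_eq1 subsetI subxx /= (N_not_sub_B Ox Gg).
apply/eqP; rewrite eqEsubset sCD andbT -indexg_eq1.
move: nD1 idxE; move: #|_ : N x :&: _| #|_ : 'C_G[x]| => a b; clear.
by case: a => [|[|a]] //; case: b => [|[|b]] // _; rewrite ?muln0 // !mulnS !mulSn; lia.
Qed.

(** * Elements conjugate into H *)

Section SplitElement.

Variables x g : gT.
Hypotheses (Gg : g \in G) (Hx : x \in H :^ g) (nt_x : x != 1).

Let M1 := (B :^ g)%G.
Let M2 := (B :^ (t * g))%G.
Let M3 := 'N_G('C_G[x])%G.

Let PE : maximals_containing G x = [set M1; M2; M3].
Proof. by case: (maximals_H Gg Hx nt_x). Qed.
Let CE : 'C_G[x] = H :^ g. Proof. by case: (maximals_H Gg Hx nt_x). Qed.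
Let Ox : x \in OG. Proof. by case: (maximals_H Gg Hx nt_x). Qed.
Let Gtg : t * g \in G. Proof. by rewrite groupM. Qed.
Let idx : #|N x : 'C_G[x]| = 2. Proof. exact: cent_H_index Gg CE. Qed.
Let cardM3 : #|M3| = ((q - 1) * 2)%N.
Proof. by rewrite card_torus_norm // idx CE cardJg cardH. Qed.

Let cap12 : M1 :&: M2 = 'C_G[x].
Proof. by rewrite /= conjsgM -conjIg tiBt CE. Qed.

Let cap31 : M3 :&: M1 = 'C_G[x].
Proof. by apply: cap_N_B => //; rewrite -cap12 subsetIl. Qed.

Let cap32 : M3 :&: M2 = 'C_G[x].
Proof. by apply: cap_N_B => //; rewrite -cap12 subsetIr. Qed.

Let ltM3 : #|M3| < q ^ 2 * (q - 1). Proof. exact: card_N_lt. Qed.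

Let neq12 : M1 != M2.
Proof.
apply/eqP=> M12; have := cap12; rewrite -M12 setIid => /(congr1 (fun A : {set gT} => #|A|)).
move=> /= cardM1; have := ltM3; rewrite -cardB -(cardJg B g) cardM1 ltnNge.
by rewrite subset_leq_card // subsetI subsetIl normG.
Qed.

Let sum3 (f : {group gT} -> nat) :
  \sum_(M in maximals_containing G x) f M = (f M1 + f M2 + f M3)%N.
Proof.
have neq3 (M : {group gT}) : #|M| = #|B| -> M3 != M.
  by move=> cardM; apply: contraTneq ltM3 => ->; rewrite cardM cardB ltnn.
rewrite PE setUC big_setU1 ?big_setU1 ?big_set1 /=; first by rewrite addnC.
  by rewrite in_set1.
by rewrite in_set2 !(negPf (neq3 _ _)) //= cardJg.
Qed.

Lemma num_maximals_H n :
  num_maximals x n = ((q ^ 2 * (q - 1) == n) + (q ^ 2 * (q - 1) == n) + ((q - 1) * 2 == n))%N.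
Proof.
rewrite -cardM3 -cardB -{1}(cardJg B g) -(cardJg B (t * g)) -(sum3 (fun M => #|M| == n)).
rewrite /num_maximals -sum1_card big_mkcond [RHS]big_mkcond; apply: eq_bigr => M _.
by rewrite in_set; case: (M \in _); case: (_ == n).
Qed.

Lemma intersections_H : pairwise_intersections G x (fun A => is_C (q - 1)%N A).
Proof.
have C1 : is_C (q - 1)%N 'C_G[x] by rewrite /is_C torus_cyclic // CE cardJg cardH eqxx.
move=> M L; rewrite PE !in_setU !in_set1.
case/orP=> [/orP[]|] /eqP->; case/orP=> [/orP[]|] /eqP-> neqML; rewrite ?eqxx // in neqML *.
- by rewrite cap12.
- by rewrite setIC cap31.
- by rewrite setIC cap12.
- by rewrite setIC cap32.
- by rewrite cap31.
by rewrite cap32.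
Qed.

Lemma card_sol_H : #|solubilizer G x| = (2 * q ^ 2 * (q - 1))%N.
Proof.
have Gx : x \in G by case/odd_partGP: Ox.
have sCM (M : {group gT}) : M \in maximals_containing G x -> 'C_G[x] \subset M.
  rewrite PE !in_setU !in_set1 => /orP[/orP[]|] /eqP->.
  - by rewrite -cap12 subsetIl.
  - by rewrite -cap12 subsetIr.
  by rewrite subsetI subsetIl normG.
have PM1 : M1 \in maximals_containing G x by rewrite PE !inE eqxx.
rewrite solubilizerE // (@card_star _ 'C_G[x]%G); first last.
- move=> M L PM PL neqML; have := intersections_H.
  move: PM PL neqML; rewrite PE !in_setU !in_set1.
  case/orP=> [/orP[]|] /eqP->; case/orP=> [/orP[]|] /eqP-> neqML _; rewrite ?eqxx // in neqML *.
  + by rewrite cap12.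
  + by rewrite setIC cap31.
  + by rewrite setIC cap12.
  + by rewrite setIC cap32.
  + by rewrite cap31.
  by rewrite cap32.
- exact: (bigcup_max M1 PM1 (sCM _ PM1)).
rewrite (eq_bigr (fun M : {group gT} => #|M| - #|'C_G[x]|)%N) => [|M PM].
  rewrite sum3 cardM3 !cardJg cardB /= CE cardJg cardH.
  have : 0 < q ^ 2 by rewrite sqrn_gt0 q_gt0.
  rewrite -mulnA; move: (q ^ 2)%N (q - 1)%N; clear=> m n m_gt0.
  by have := leq_pmull n m_gt0; move: (m * n)%N; clear=> k; lia.
by rewrite (setIidPr (sCM M PM)).
Qed.

End SplitElement.

(** * Odd elements not conjugate into H *)

Lemma maximals_torus x : x \in OG -> #|'C_G[x]| %| (q ^ 2 + 1)%N ->
  maximals_containing G x = [set 'N_G('C_G[x])%G].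
Proof.
move=> Ox dvdC; have [Gx nt_x _] := odd_partGP _ Ox.
have Cx : x \in 'C_G[x] by rewrite inE Gx cent1id.
apply/setP=> M; rewrite in_set1 inE; apply/andP/eqP => [[maxM Mx]|->]; last first.
  by rewrite (maximal_N Ox) (mem_N Ox).
have [[k Gk defM]|[y Oy defM]] := maximal_cases maxM; apply: group_inj; rewrite defM /=; last first.
  by rewrite (N_sub_eq Ox Oy) // -defM.
case/eqP: nt_x; apply/eqP; rewrite -order_eq1 -dvdn1.
have cop : coprime (q ^ 2 * (q - 1)) (q ^ 2 + 1).
  by rewrite coprimeMl cop_S_plus cop_H_plus.
rewrite -(eqP cop) dvdn_gcd; apply/andP; split; last exact: dvdn_trans (order_dvdG Cx) dvdC.
by rewrite -cardB -(cardJg B k) order_dvdG //= -defM.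
Qed.

Lemma torus_case x n : x \in OG -> #|'C_G[x]| = n -> n %| (q ^ 2 + 1)%N ->
  (forall m, num_maximals x m = (n * 4 == m)%N) /\ #|solubilizer G x| = (4 * n)%N.
Proof.
move=> Ox CE dvdn; have Gx : x \in G by case/odd_partGP: Ox.
have PE := maximals_torus Ox; rewrite CE in PE; have {}PE := PE dvdn.
(* The other possibility has a centraliser of order q - 1; as this order divides q^2 + 1 it would be
   1. *)
have idx4 : #|N x : 'C_G[x]| = 4.
  case: (cent_cases Ox) => -[C1 //] _; have := cop_H_plus.
  rewrite -C1 CE /coprime (gcdn_idPl dvdn) -CE => /eqP C_1.
  have [_ nt_x _] := odd_partGP _ Ox; case/eqP: nt_x; apply/set1gP.
  by rewrite -(card1_trivg C_1) inE Gx cent1id.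
have cardN : #|N x| = (n * 4)%N by rewrite card_torus_norm // CE idx4.
split=> [m|]; last by rewrite solubilizerE // PE big_set1 cardN mulnC.
rewrite /num_maximals PE -sum1_card big_mkcond (bigD1 'N_G('C_G[x])%G) //= big1.
  by rewrite in_set in_set1 eqxx cardN addn0; case: eqP.
by move=> M neqM; rewrite in_set in_set1 (negPf neqM).
Qed.

Lemma sqrt2q_le : sqrt2q p <= q.
Proof. by rewrite leq_exp2l // leq_uphalf_double -addnn leq_addr. Qed.

Lemma dvdn_q_plus : (q_plus p %| q ^ 2 + 1)%N.
Proof. by rewrite -(torus_orders_mul sqrt2q_le (sqrt2qE p_odd)) dvdn_mulr. Qed.

Lemma dvdn_q_minus : (q_minus p %| q ^ 2 + 1)%N.
Proof. by rewrite -(torus_orders_mul sqrt2q_le (sqrt2qE p_odd)) dvdn_mull. Qed.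

Lemma coprime_q_pm : coprime (q_plus p) (q_minus p).
Proof. exact: torus_orders_coprime q_even sqrt2q_le (sqrt2qE p_odd). Qed.

(** * The five cases according to the order of x *)

Lemma solubilizer_2 x : x \in G -> #[x] = 2 ->
  [/\ maximal_counts p G x = (1, q ^ 2 %/ 2, q ^ 2 %/ 4, q ^ 2 %/ 4)%N,
      pairwise_intersections G x (fun A => is_C 2 A \/ is_C 4 A)
    & #|solubilizer G x| = (q ^ 2 * (4 * q - 3))%N].
Proof.
move=> Gx ox; have nt_x : x != 1 by rewrite -order_eq1 ox.
have [g Gg Sx] : exists2 g, g \in G & x \in S :^ g by apply: even_S; rewrite ?ox.
have numE n e := num_N_2 (n := n) (e := e) Gx ox (isT : 2 \in [:: 2; 4]).
rewrite maximal_countsE (card_sol_2 Gg Sx nt_x) (num_borel_2 Gg Sx nt_x).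
rewrite (numE _ 2) ?(numE _ 4) ?inE ?eqxx ?orbT //=; split=> //.
  move=> M L PM PL neqML; have [_ cyc dvd4] := maximal_cap Gg Sx nt_x PM PL neqML.
  have MLx : x \in M :&: L by move: PM PL; rewrite !inE => /andP[_ ->] /andP[_ ->].
  by rewrite /is_C cyc /=; case: (order_dvd4 dvd4 MLx nt_x) => ->; auto.
exact: card_sol2_arith q_ge8 q_even sqrt2q_le.
Qed.

Lemma solubilizer_4 x : x \in G -> #[x] = 4 ->
  [/\ maximal_counts p G x = (1, 0, q %/ 2, q %/ 2)%N,
      pairwise_intersections G x (fun A => is_C 4 A)
    & #|solubilizer G x| = (q ^ 2 * (q + 3))%N].
Proof.
move=> Gx ox; have nt_x : x != 1 by rewrite -order_eq1 ox.
have [g Gg Sx] : exists2 g, g \in G & x \in S :^ g by apply: even_S; rewrite ?ox.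
have numE n e := num_N_2 (n := n) (e := e) Gx ox (isT : 4 \in [:: 2; 4]).
rewrite maximal_countsE (card_sol_2 Gg Sx nt_x) (num_borel_2 Gg Sx nt_x).
rewrite (numE _ 2) ?(numE _ 4) ?inE ?eqxx ?orbT //=; split=> //.
  move=> M L PM PL neqML; have [_ cyc dvd4] := maximal_cap Gg Sx nt_x PM PL neqML.
  have MLx : x \in M :&: L by move: PM PL; rewrite !inE => /andP[_ ->] /andP[_ ->].
  by rewrite /is_C cyc eqn_dvd dvd4 -ox order_dvdG.
rewrite mul0n addn0; exact: card_sol4_arith q_ge8 q_even sqrt2q_le.
Qed.

Lemma solubilizer_split x : x \in G -> x != 1 -> (#[x] %| q - 1)%N ->
  [/\ maximal_counts p G x = (2, 1, 0, 0)%N,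
      pairwise_intersections G x (fun A => is_C (q - 1)%N A)
    & #|solubilizer G x| = (2 * q ^ 2 * (q - 1))%N].
Proof.
move=> Gx nt_x dvd_x; have [g Gg Hx] : exists2 g, g \in G & x \in H :^ g.
  have x_odd : odd #[x] by rewrite (dvdn_odd dvd_x) // -cardH H_odd.
  have [//|dvd1] := odd_type Gx x_odd; case/eqP: nt_x; apply/eqP.
  by rewrite -order_eq1 -dvdn1 -(eqP cop_H_plus) dvdn_gcd dvd_x.
split; [ | exact: (intersections_H Gg Hx nt_x) | exact: (card_sol_H Gg Hx nt_x)].
rewrite maximal_countsE !(num_maximals_H Gg Hx nt_x).
have := orders_neq; rewrite /= !inE !negb_or -!andbA => /and4P[n1 n2 n3 /and4P[n4 n5 n6 _]].
rewrite !eqxx (negPf n1) (negPf n2) (negPf n3) (negPf n4) (negPf n5).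
by rewrite eq_sym (negPf n1).
Qed.

(** [m] is the other one of [q_plus p] and [q_minus p], so that both cases are treated at once. As n
    and m are coprime, x cannot have a centraliser of order m. *)
Lemma solubilizer_torus x n m : x \in G -> x != 1 ->
    (n, m) = (q_plus p, q_minus p) \/ (n, m) = (q_minus p, q_plus p) -> (#[x] %| n)%N ->
  (forall k, num_maximals x k = (n * 4 == k)%N) /\ #|solubilizer G x| = (4 * n)%N.
Proof.
move=> Gx nt_x nm dvd_n.
have [n_dvd cop CE] : [/\ (n %| q ^ 2 + 1)%N, coprime n m & forall y, y \in OG ->
    [\/ #|'C_G[y]| = (q - 1)%N, #|'C_G[y]| = n | #|'C_G[y]| = m]].
  have cop' : coprime (q_minus p) (q_plus p) by rewrite coprime_sym coprime_q_pm.
  case: nm => -[-> ->]; split; rewrite ?dvdn_q_plus ?dvdn_q_minus ?coprime_q_pm //.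
    - by move=> y /cent_cases[] [-> _]; [constructor 1 | constructor 2 | constructor 3].
  by move=> y /cent_cases[] [-> _]; [constructor 1 | constructor 3 | constructor 2].
have Ox : x \in OG.
  apply/odd_partGP; split=> //; apply: dvdn_odd (dvdn_trans dvd_n n_dvd) _.
  by rewrite addn1 oddS oddX (negPf q_even).
have nt_cop k : coprime n k -> #|'C_G[x]| <> k.
  move=> copk CxE; case/eqP: nt_x; apply/eqP; rewrite -order_eq1 -dvdn1 -(eqP copk) dvdn_gcd dvd_n.
  by rewrite -CxE order_dvdG // inE Gx cent1id.
apply: torus_case => //; case: (CE x Ox) => // CxE; case: (nt_cop _ _ CxE) => //.
by rewrite coprime_sym; apply: coprime_dvdr n_dvd cop_H_plus.
Qed.

Lemma solubilizer_q_plus x : x \in G -> x != 1 -> (#[x] %| q_plus p)%N ->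
  maximal_counts p G x = (0, 0, 1, 0)%N /\ #|solubilizer G x| = (4 * q_plus p)%N.
Proof.
move=> Gx nt_x dvd_x; have [numE solE] := solubilizer_torus Gx nt_x (or_introl erefl) dvd_x.
rewrite maximal_countsE !numE; split=> //.
have := orders_neq; rewrite /= !inE !negb_or -!andbA => /and4P[n1 n2 n3 /and4P[n4 n5 n6 _]].
by rewrite eqxx (negPf n6) eq_sym (negPf n2) eq_sym (negPf n4).
Qed.

Lemma solubilizer_q_minus x : x \in G -> x != 1 -> (#[x] %| q_minus p)%N ->
  maximal_counts p G x = (0, 0, 0, 1)%N /\ #|solubilizer G x| = (4 * q_minus p)%N.
Proof.
move=> Gx nt_x dvd_x; have [numE solE] := solubilizer_torus Gx nt_x (or_intror erefl) dvd_x.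
rewrite maximal_countsE !numE; split=> //.
have := orders_neq; rewrite /= !inE !negb_or -!andbA => /and4P[n1 n2 n3 /and4P[n4 n5 n6 _]].
by rewrite eqxx eq_sym (negPf n3) eq_sym (negPf n5) eq_sym (negPf n6).
Qed.

Lemma suzuki_solubilizer x : x \in G -> x != 1 ->
  (#[x] = 2 \/ #[x] = 4 \/
    (#[x] %| q - 1)%N \/ (#[x] %| q_plus p)%N \/ (#[x] %| q_minus p)%N)
  /\ (forall M : {group gT}, maximal M G ->
        borel_type p G M \/ dihedral_type p M \/
        frobenius_type (q_plus p) G M \/ frobenius_type (q_minus p) G M)
  /\ solubilizer G x = \bigcup_(M in maximals_containing G x) (M : {set _})
  /\ (#[x] = 2 ->
        maximal_counts p G x = (1, q ^ 2 %/ 2, q ^ 2 %/ 4, q ^ 2 %/ 4)%N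
        /\ pairwise_intersections G x (fun A => is_C 2 A \/ is_C 4 A)
        /\ #|solubilizer G x| = (q ^ 2 * (4 * q - 3))%N)
  /\ (#[x] = 4 ->
        maximal_counts p G x = (1, 0, q %/ 2, q %/ 2)%N
        /\ pairwise_intersections G x (fun A => is_C 4 A)
        /\ #|solubilizer G x| = (q ^ 2 * (q + 3))%N)
  /\ ((#[x] %| q - 1)%N ->
        maximal_counts p G x = (2, 1, 0, 0)%N
        /\ pairwise_intersections G x (fun A => is_C (q - 1)%N A)
        /\ #|solubilizer G x| = (2 * q ^ 2 * (q - 1))%N)
  /\ ((#[x] %| q_plus p)%N ->
        maximal_counts p G x = (0, 0, 1, 0)%N
        /\ #|solubilizer G x| = (4 * q_plus p)%N)
  /\ ((#[x] %| q_minus p)%N ->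
        maximal_counts p G x = (0, 0, 0, 1)%N
        /\ #|solubilizer G x| = (4 * q_minus p)%N).
Proof.
move=> Gx nt_x; split; first exact: element_orders.
split; first exact: maximal_types.
split; first exact: solubilizerE.
split; first by case/(solubilizer_2 Gx).
split; first by case/(solubilizer_4 Gx).
split; first by case/(solubilizer_split Gx nt_x).
split; [exact: solubilizer_q_plus | exact: solubilizer_q_minus].
Qed.

End Suzuki.

(** * Suzuki matrices *)

Import GRing.Theory.

Section Matrices.

Import GroupScope.

Variables (p : nat) (F : finFieldType).
Hypotheses (p_odd : odd p) (cardF : #|F| = (2 ^ p)%N).

Local Open Scope ring_scope.
Local Notation th := (theta p (F := F)).
Local Notation Sm := (suzuki_S p (F := F)).
Local Notation Mm := (suzuki_M p (F := F)).
Local Notation Tm := (suzuki_T F).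
Implicit Types a b c d l : F.

Lemma pchar2 : 2%N \in [pchar F].
Proof. exact: (card_finPcharP cardF). Qed.

Lemma two_eq0 : 2 = 0 :> F.
Proof. exact: pcharf0 pchar2. Qed.

Lemma even_eq0 n : ~~ odd n -> n%:R = 0 :> F.
Proof. by move=> n_even; rewrite -(even_halfK n_even) -muln2 natrM two_eq0 mulr0. Qed.

Lemma oppr_even_eq0 n : ~~ odd n -> - n%:R = 0 :> F.
Proof. by move=> n_even; rewrite even_eq0 ?oppr0. Qed.

(** Identities of characteristic 2 are proved by moving everything to one side and handing to [ring]
    the vanishing of the even integers that occur as coefficients. *)
Ltac char2_ring :=
  apply/eqP; rewrite -subr_eq0; apply/eqP;
  ring: (@even_eq0 2 isT) (@even_eq0 4 isT) (@even_eq0 6 isT)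
    (@oppr_even_eq0 2 isT) (@oppr_even_eq0 4 isT) (@oppr_even_eq0 6 isT).

Lemma thetaD a b : th (a + b) = th a + th b.
Proof.
rewrite /theta /sqrt2q; elim: _./2 => [|n IHn]; first by rewrite !expr1.
rewrite expnSr !exprM IHn; have h := two_eq0; ring: h.
Qed.

Lemma thetaM a b : th (a * b) = th a * th b.
Proof. exact: exprMn. Qed.

Lemma thetaX a n : th (a ^+ n) = th a ^+ n.
Proof. by rewrite /theta -!exprM mulnC. Qed.

Lemma thetaK a : th (th a) = a ^+ 2.
Proof.
rewrite /theta -exprM mulnn (sqrt2qE p_odd) mulnC exprM -cardF.
by rewrite expf_card.
Qed.

Lemma thetaV a : th a^-1 = (th a)^-1.
Proof. by rewrite /theta exprVn. Qed.

Lemma theta1 : th 1 = 1.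
Proof. exact: expr1n. Qed.

Lemma theta0 : th 0 = 0.
Proof. by rewrite /theta expr0n expn_eq0. Qed.

Lemma theta_eq0 a : (th a == 0) = (a == 0).
Proof. by rewrite /theta expf_eq0 /sqrt2q expn_gt0. Qed.

Definition thetaE := (thetaD, thetaM, thetaX, thetaV, thetaK, theta1).

Lemma addrr2 a : a + a = 0.
Proof. by rewrite -mulr2n -mulr_natl two_eq0 mul0r. Qed.

Lemma oppr2 a : - a = a.
Proof. by apply/eqP; rewrite eq_sym -addr_eq0 addrr2. Qed.

(* w + theta w = 1 gives theta w + w^2 = 1, so w is 0 or 1. *)
Lemma add_theta_neq1 w : w + th w != 1.
Proof.
apply/eqP=> wth; have: th (w + th w) = 1 by rewrite wth theta1.
rewrite thetaD thetaK => thw; have: w * (w - 1) = 0.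
  have h := two_eq0.
  have -> : w * (w - 1) = (th w + w ^+ 2) - (w + th w) by ring: h.
  by rewrite wth thw subrr.
move/eqP; rewrite mulf_eq0 subr_eq0 => /orP[]/eqP w01; move: wth; rewrite w01.
  by rewrite theta0 addr0 => /eqP; rewrite eq_sym oner_eq0.
by rewrite theta1 addrr2 => /eqP; rewrite eq_sym oner_eq0.
Qed.

(** The lower left entry of [suzuki_S a b]; its graph is the affine part of the Suzuki-Tits
    ovoid. *)
Definition ovoid_form a b := a ^+ 2 * th a + a * b + th b.

Lemma ovoid_form_eq0 a b : (ovoid_form a b == 0) = (a == 0) && (b == 0).
Proof.
apply/idP/andP=> [|[/eqP-> /eqP->]]; last first.
  by rewrite /ovoid_form theta0 mulr0 mul0r !addr0 eqxx.
have [-> | nz_a] := eqVneq a 0.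
  by rewrite /ovoid_form theta0 mulr0 mul0r !add0r theta_eq0 => ->.
have nz_tha: th a != 0 by rewrite theta_eq0.
(* In terms of w = b / (a theta(a)) - 1 the form becomes homogeneous: a factor a^2 theta(a) splits
   off and w + theta(w) - 1 remains. *)
have [w Dw]: exists w, b = a * th a * (w + 1).
  by exists (b / (a * th a) - 1); field; rewrite nz_tha nz_a.
suffices ->: ovoid_form a b = a ^+ 2 * th a * (w + th w - 1).
  by rewrite !mulf_eq0 theta_eq0 (negPf nz_a) subr_eq0
             (negPf (add_theta_neq1 w)).
rewrite /ovoid_form Dw !thetaE; char2_ring.
Qed.

Lemma mul_mx4 (s t : seq (seq F)) :
  mx4 s *m mx4 t = mx4 (mkseq (fun i => mkseq (fun j =>
    nth 0 (nth [::] s i) 0 * nth 0 (nth [::] t 0) j +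
    nth 0 (nth [::] s i) 1 * nth 0 (nth [::] t 1) j +
    nth 0 (nth [::] s i) 2 * nth 0 (nth [::] t 2) j +
    nth 0 (nth [::] s i) 3 * nth 0 (nth [::] t 3) j) 4) 4).
Proof.
apply/matrixP=> i j; rewrite !mxE !big_ord_recl big_ord0 addr0 !addrA.
by rewrite !nth_mkseq // !mxE.
Qed.

Lemma forall_ord4 (P : 'I_4 -> Prop) : P 0 -> P 1 -> P 2 -> P 3 -> forall i, P i.
Proof.
move=> P0 P1 P2 P3 [[|[|[|[|//]]]] lti].
- by rewrite (_ : Ordinal lti = 0) //; apply: val_inj.
- by rewrite (_ : Ordinal lti = 1) //; apply: val_inj.
- by rewrite (_ : Ordinal lti = 2) //; apply: val_inj.
- by rewrite (_ : Ordinal lti = 3) //; apply: val_inj.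
Qed.

Lemma suzuki_SM a b c d : Sm a b *m Sm c d = Sm (a + c) (b + d + th a * c).
Proof.
rewrite mul_mx4; apply/matrixP; do 2!elim/forall_ord4; rewrite !mxE /= ?thetaE;
char2_ring.
Qed.

Lemma suzuki_MM l k : Mm l *m Mm k = Mm (l * k).
Proof.
rewrite mul_mx4; apply/matrixP; do 2!elim/forall_ord4; rewrite !mxE /= ?thetaE ?invfM; ring.
Qed.

Lemma suzuki_TT : Tm *m Tm = 1%:M.
Proof.
rewrite mul_mx4; apply/matrixP; do 2!elim/forall_ord4; rewrite !mxE /=; ring.
Qed.

Lemma suzuki_S0 : Sm 0 0 = 1%:M.
Proof.
apply/matrixP; do 2!elim/forall_ord4; rewrite !mxE /= ?theta0; ring.
Qed.

Lemma suzuki_M1 : Mm 1 = 1%:M.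
Proof.
apply/matrixP; do 2!elim/forall_ord4; rewrite !mxE /= ?theta1 ?mul1r ?invr1; ring.
Qed.

Lemma suzuki_TM l : Tm *m Mm l = Mm l^-1 *m Tm.
Proof.
rewrite !mul_mx4; apply/matrixP; do 2!elim/forall_ord4; rewrite !mxE /= ?thetaE ?invfM ?invrK; ring.
Qed.

Lemma suzuki_SM_conj a b l : l != 0 ->
  Sm a b *m Mm l = Mm l *m Sm (a * th l) (b * l * l * th l).
Proof.
move=> nz_l; have nz_tl : th l != 0 by rewrite theta_eq0.
rewrite !mul_mx4; apply/matrixP; do 2!elim/forall_ord4; rewrite !mxE /= ?thetaE;
 try (by ring); field; rewrite ?nz_l ?nz_tl //.
Qed.

Ltac char2_field Df Dtf :=
  apply/eqP; rewrite -subr_eq0; apply/eqP;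
  field: Df Dtf
    (@even_eq0 2 isT) (@oppr_even_eq0 2 isT) (@even_eq0 4 isT)
    (@oppr_even_eq0 4 isT) (@even_eq0 6 isT) (@oppr_even_eq0 6 isT)
    (@even_eq0 8 isT) (@oppr_even_eq0 8 isT) (@even_eq0 10 isT)
    (@oppr_even_eq0 10 isT) (@even_eq0 12 isT) (@oppr_even_eq0 12 isT)
    (@even_eq0 14 isT) (@oppr_even_eq0 14 isT) (@even_eq0 16 isT)
    (@oppr_even_eq0 16 isT).

(** Conjugation by T moves the lower left entry f to the upper right corner, where the right side
    has the corner entry l theta(l) of the diagonal factor. Hence l theta(l) = f, which is solved by
    l = theta(f) / f. *)
Lemma suzuki_TST a b (f := ovoid_form a b) (y := a * th a + b) :
  f != 0 ->
  Tm *m Sm a b *m Tm =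
    Sm (b / f) (a / f) *m (Mm (th f / f) *m Tm)
    *m Sm (y / f) (a / f + y / f * th (y / f)).
Proof.
move=> nz_f; have nz_tf : th f != 0 by rewrite theta_eq0.
have DMT : Mm (th f / f) *m Tm =
    mx4 [:: [:: 0; 0; 0; f]; [:: 0; 0; th f / f; 0];
            [:: 0; f / th f; 0; 0]; [:: f^-1; 0; 0; 0]].
  have Dl : th f / f * th (th f / f) = f.
    by rewrite thetaM thetaV thetaK; field; rewrite nz_f nz_tf.
  rewrite mul_mx4 Dl invfM invrK; apply/matrixP; do 2!elim/forall_ord4;
    rewrite !mxE /=; ring.
have Dthy : th (y / f) = (th a * a ^+ 2 + th b) / th f by rewrite /y !thetaE.
have Dtb2 : th (a / f + y / f * th (y / f)) =
    th a / th f + th (y / f) * (y ^+ 2 / f ^+ 2).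
  by rewrite thetaD (thetaM a) (thetaM (y / f)) thetaK expr_div_n thetaV.
have Dtaf : th (a / f) = th a / th f by rewrite !thetaE.
have Dtbf : th (b / f) = th b / th f by rewrite !thetaE.
have Df : f = a ^+ 2 * th a + a * b + th b by [].
have Dtf : th f = th a ^+ 2 * a ^+ 2 + th a * th b + b ^+ 2.
  by rewrite /f /ovoid_form !thetaE mulrC.
rewrite {}DMT !mul_mx4 /mkseq /= Dtb2 Dtaf Dtbf Dthy.
(* The values of theta are replaced by independent variables, of which only the two equations
   expressing f and theta(f) are kept; [field] then works modulo these. *)
move: Df Dtf; rewrite /y; move: (th f) nz_tf => tf nz_tf.
move: {Dthy Dtb2 Dtaf Dtbf y} f nz_f => f nz_f Df Dtf.
move: (th a) (th b) Df Dtf => ta tb Df Dtf.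
(* Both outer unipotent factors have lower left entry 1 / f. *)
have S1_30 : (b / f) ^+ 2 * (tb / tf) + b / f * (a / f) + ta / tf = f^-1.
  by char2_field Df Dtf; rewrite nz_f nz_tf.
have S2_30 : ((a * ta + b) / f) ^+ 2 * ((ta * a ^+ 2 + tb) / tf)
    + (a * ta + b) / f * (a / f + (a * ta + b) / f * ((ta * a ^+ 2 + tb) / tf))
    + (ta / tf + (ta * a ^+ 2 + tb) / tf * ((a * ta + b) ^+ 2 / f ^+ 2)) = f^-1.
  by char2_field Df Dtf; rewrite nz_f nz_tf.
rewrite {}S1_30 {}S2_30.
apply/matrixP; do 2!elim/forall_ord4; rewrite !mxE /=; try (by ring);
  char2_field Df Dtf; rewrite ?nz_f ?nz_tf //.
Qed.

End Matrices.

(** * The subgroups S, Z and H of matrices *)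

Section Generators.

Import GroupScope.

Variables (p : nat) (F : finFieldType).
Hypotheses (p_odd : odd p) (cardF : #|F| = (2 ^ p)%N).

Local Notation th := (theta p (F := F)).
Local Notation Sm := (suzuki_S p (F := F)).
Local Notation Mm := (suzuki_M p (F := F)).
Local Notation Tm := (suzuki_T F).
Local Notation q := (2 ^ p)%N.
Local Notation gT := {'GL_4[F]}.
Implicit Types (a b c d : F) (l k : {unit F}).

Lemma suzuki_S_unit a b : Sm a b \is a GRing.unit.
Proof.
have SSV : (Sm a b *m Sm a (b + th a * a) = 1%:M)%R.
  by rewrite (suzuki_SM p_odd cardF) (addrAC b) !(addrr2 cardF) suzuki_S0.
by have [] := mulmx1_unit SSV.
Qed.

Lemma suzuki_M_unit (l : {unit F}) : Mm (val l) \is a GRing.unit.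
Proof.
have MMV : (Mm (val l) *m Mm (val l)^-1 = 1%:M)%R.
  by rewrite suzuki_MM mulrV ?suzuki_M1 //; apply: valP.
by have [] := mulmx1_unit MMV.
Qed.

Lemma suzuki_T_unit : Tm \is a GRing.unit.
Proof. by have [] := mulmx1_unit (suzuki_TT F). Qed.

Definition elS a b : gT := FinRing.unit _ (suzuki_S_unit a b).
Definition elM l : gT := FinRing.unit _ (suzuki_M_unit l).
Definition elT : gT := FinRing.unit _ suzuki_T_unit.

Lemma val_elS a b : GLval (elS a b) = Sm a b. Proof. by []. Qed.
Lemma val_elM l : GLval (elM l) = Mm (val l). Proof. by []. Qed.
Lemma elSM a b c d : elS a b * elS c d = elS (a + c)%R (b + d + th a * c)%R.
Proof. by apply: val_inj; apply: (suzuki_SM p_odd cardF). Qed.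

Lemma elMM l k : elM (l * k) = elM l * elM k.
Proof. by apply: val_inj; apply: esym; apply: suzuki_MM. Qed.

Lemma elTT : elT * elT = 1.
Proof. by apply: val_inj; apply: suzuki_TT. Qed.

Lemma elTM l : elM l ^ elT = elM l^-1.
Proof.
apply: (mulgI elT); rewrite -conjgC; apply: val_inj.
have /esym := suzuki_TM p (val l)^-1%R; rewrite invrK; exact.
Qed.

Lemma elS_conj a b l :
  elS a b ^ elM l = elS (a * th (val l))%R (b * val l * val l * th (val l))%R.
Proof.
apply: (mulgI (elM l)); rewrite -conjgC; apply: val_inj => /=.
by apply: suzuki_SM_conj => //; rewrite -unitfE; apply: valP.
Qed.

Lemma elS_inj a b c d : elS a b = elS c d -> a = c /\ b = d.
Proof.
move/(congr1 (fun g => GLval g)); rewrite !val_elS => /matrixP eqS.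
by have := eqS 1%R 0%R; have := eqS 2%R 0%R; rewrite !mxE.
Qed.

Lemma elS0 : elS 0%R 0%R = 1.
Proof. by apply: val_inj; apply: suzuki_S0. Qed.

Definition suz_S : {set gT} := [set elS x.1 x.2 | x in [set: F * F]].
Definition suz_Z : {set gT} := [set elS 0%R b | b in [set: F]].

Lemma suz_SP g : reflect (exists a b, g = elS a b) (g \in suz_S).
Proof.
apply: (iffP imsetP) => [[[a b] _ ->]|[a [b ->]]]; first by exists a, b.
by exists (a, b).
Qed.

Lemma suz_ZP g : reflect (exists b, g = elS 0%R b) (g \in suz_Z).
Proof. by apply: (iffP imsetP) => [[b _ ->]|[b ->]]; exists b. Qed.

Lemma suz_S_group_set : group_set suz_S.
Proof.
apply/group_setP; split=> [|_ _ /suz_SP[a [b ->]] /suz_SP[c [d ->]]].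
  by apply/suz_SP; exists 0%R, 0%R; rewrite elS0.
by apply/suz_SP; rewrite elSM; do 2!eexists.
Qed.
Canonical suz_S_group := Group suz_S_group_set.

Lemma suz_Z_group_set : group_set suz_Z.
Proof.
apply/group_setP; split=> [|_ _ /suz_ZP[b ->] /suz_ZP[d ->]].
  by apply/suz_ZP; exists 0%R; rewrite elS0.
by apply/suz_ZP; rewrite elSM mulr0 !addr0; eexists.
Qed.
Canonical suz_Z_group := Group suz_Z_group_set.

Lemma card_suz_S : #|suz_S| = (q ^ 2)%N.
Proof.
rewrite card_imset ?cardsT ?card_prod ?cardF ?mulnn // => -[a b] [c d] /= eqS.
by have [-> ->] := elS_inj eqS.
Qed.

Lemma card_suz_Z : #|suz_Z| = q.
Proof.
rewrite card_imset ?cardsT ?cardF // => b d eqS.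
by have [_ ->] := elS_inj eqS.
Qed.

Canonical elM_morphism := @Morphism _ _ [set: {unit F}] elM (in2W elMM).
Definition suz_H : {group gT} := (elM_morphism @* [set: {unit F}])%G.

Lemma suz_HP g : reflect (exists l, g = elM l) (g \in suz_H).
Proof.
apply: (iffP morphimP) => [[l _ _ ->]|[l ->]]; first by exists l.
by exists l; rewrite ?inE.
Qed.

Lemma elM_inj : injective elM.
Proof.
move=> l k /(congr1 (fun g => GLval g)); rewrite !val_elM => /matrixP eqM.
by apply: val_inj; have := eqM 1%R 1%R; rewrite !mxE.
Qed.

Lemma card_suz_H : #|suz_H| = (q - 1)%N.
Proof.
rewrite card_injm ?card_finField_unit ?cardF ?subn1 //.
by apply/injmP; apply: in2W elM_inj.
Qed.

Lemma suz_H_cyclic : cyclic suz_H.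
Proof. by rewrite morphim_cyclic ?field_unit_group_cyclic. Qed.

Lemma suz_Z_subS : suz_Z \subset suz_S.
Proof. by apply/subsetP=> _ /suz_ZP[b ->]; apply/suz_SP; do 2!eexists. Qed.

Lemma elS_sqr a b : elS a b ^+ 2 = elS 0%R (th a * a)%R.
Proof. by rewrite expgS expg1 elSM !(addrr2 cardF) add0r. Qed.

Lemma suz_S_sqr : {in suz_S, forall x, x ^+ 2 \in suz_Z}.
Proof. by move=> _ /suz_SP[a [b ->]]; rewrite elS_sqr; apply/suz_ZP; eexists. Qed.

Lemma suz_Z_sqr : {in suz_S, forall x, (x ^+ 2 == 1) = (x \in suz_Z)}.
Proof.
move=> _ /suz_SP[a [b ->]]; rewrite elS_sqr; apply/eqP/suz_ZP => [|[d]].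
  rewrite -elS0 => /elS_inj[_ /eqP]; rewrite mulf_eq0 theta_eq0 orbb => /eqP->.
  by exists b.
by case/elS_inj=> -> _; rewrite mulr0 elS0.
Qed.

Lemma suz_H_norm : suz_H \subset 'N(suz_S).
Proof.
apply/subsetP=> _ /suz_HP[l ->]; rewrite inE; apply/subsetP=> _ /imsetP[x + ->].
by case/suz_SP=> a [b ->]; apply/suz_SP; rewrite elS_conj; do 2!eexists.
Qed.

Lemma suz_H_inv : {in suz_H, forall h, h ^ elT = h^-1}.
Proof. by move=> _ /suz_HP[l ->]; rewrite elTM morphV ?inE. Qed.

Lemma theta_inj : injective th.
Proof.
move=> a b eq_ab; apply/eqP; rewrite -subr_eq0 -(theta_eq0 p) (oppr2 cardF).
by rewrite (thetaD cardF) eq_ab (addrr2 cardF).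
Qed.

Lemma theta_surj a : exists c, th c = a.
Proof. by have [g _ gK] := injF_bij theta_inj; exists (g a). Qed.

Lemma theta_fix a : th a = a -> a = 0%R \/ a = 1%R.
Proof.
move=> tha; have : (a * (a - 1) = 0)%R.
  by rewrite mulrBr mulr1 -expr2 -(thetaK p_odd cardF) !tha subrr.
by move/eqP; rewrite mulf_eq0 subr_eq0 => /orP[]/eqP; [left | right].
Qed.

Lemma suz_H_regular : {in suz_H^#, forall h, 'C_suz_S[h] = 1}.
Proof.
move=> h /setD1P[nt_h /suz_HP[l Dh]]; apply/trivgP/subsetP=> x /setIP[/suz_SP[a [b Dx]]].
move=> /cent1P/commgP/conjg_fixP; rewrite Dx Dh elS_conj => /elS_inj[].
have nz_l : val l != 0%R by rewrite -unitfE; apply: valP.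
have nz_tl : th (val l) != 0%R by rewrite theta_eq0.
have [-> _|nz_a fix_a _] := eqVneq a 0%R; last first.
  case/negP: nt_h; rewrite Dh; apply/eqP; rewrite -(morph1 elM_morphism) /=; congr elM.
  apply: val_inj; apply: theta_inj; rewrite theta1.
  by apply: (mulfI nz_a); rewrite fix_a mulr1.
have [->|nz_b fix_b] := eqVneq b 0%R; first by rewrite elS0 !inE.
case/negP: nt_h; rewrite Dh; apply/eqP; rewrite -(morph1 elM_morphism) /=; congr elM.
apply: val_inj => /=.
have Dtl : (val l * val l * th (val l) = 1)%R.
  by apply: (mulfI nz_b); rewrite mulr1 !mulrA.
(* Applying theta to l^2 theta(l) = 1 gives theta(l)^2 l^2 = 1; comparison of the two yields
   theta(l) = 1. *)
have : (th (val l * val l * th (val l)) = 1)%R by rewrite Dtl theta1.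
rewrite !thetaM (thetaK p_odd cardF) => Dtl2.
have : (th (val l) = 1)%R.
  by rewrite -Dtl2 -{1}[th _]mulr1 -Dtl expr2; ring.
by rewrite -{1}(theta1 p F) => /theta_inj.
Qed.

Lemma suz_Z_conj :
  {in suz_Z^# &, forall x y, exists2 g, g \in suz_H & y = x ^ g}.
Proof.
move=> x y /setD1P[nt_x /suz_ZP[b Dx]] /setD1P[nt_y /suz_ZP[d Dy]].
have nz_b : b != 0%R by apply: contraNneq nt_x => b0; rewrite Dx b0 elS0.
have nz_d : d != 0%R by apply: contraNneq nt_y => b0; rewrite Dy b0 elS0.
pose c := (d / b)%R; have nz_c : c != 0%R by rewrite mulf_neq0 ?invr_eq0.
(* The multiplier l^2 theta(l) has to be c. As l^2 = theta(theta(l)), the choice theta(l) = theta(c)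
   / c gives l^2 = c^2 / theta(c) and the product c. *)
have [l thl] := theta_surj (th c / c)%R.
have Ul : l \is a GRing.unit.
  by rewrite unitfE -(theta_eq0 p) thl mulf_neq0 ?invr_eq0 ?theta_eq0.
exists (elM (FinRing.unit F Ul)); first by apply/suz_HP; eexists.
rewrite Dx elS_conj mul0r Dy; congr elS => /=.
have nz_tc : th c != 0%R by rewrite theta_eq0.
have -> : (b * l * l * th l = b * (l ^+ 2 * th l))%R by ring.
rewrite -(thetaK p_odd cardF) thl thetaM thetaV (thetaK p_odd cardF).
rewrite -{1}(divfK nz_b d) -/c; field; by rewrite nz_c nz_tc.
Qed.

End Generators.

(** * The Bruhat decomposition of the matrix group *)

Section Bruhat.

Import GroupScope.

Lemma conj_or_inv_trans (gT : finGroupType) (B : {group gT}) u x y :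
    (exists2 g, g \in B & x = u ^ g \/ x = u^-1 ^ g) ->
    (exists2 g, g \in B & y = u ^ g \/ y = u^-1 ^ g) ->
  exists2 g, g \in B & y = x ^ g \/ y = x^-1 ^ g.
Proof.
case=> g Bg Dx [h Bh Dy]; exists (g^-1 * h); first by rewrite groupM ?groupV.
by rewrite !conjgM; case: Dx => ->; case: Dy => ->; rewrite ?conjVg ?invgK conjgK;
  auto.
Qed.

Variables (p : nat) (F : finFieldType).
Hypotheses (p_odd : odd p) (cardF : #|F| = (2 ^ p)%N).

Local Notation th := (theta p (F := F)).
Local Notation Sm := (suzuki_S p (F := F)).
Local Notation Mm := (suzuki_M p (F := F)).
Local Notation Tm := (suzuki_T F).
Local Notation q := (2 ^ p)%N.
Local Notation gT := {'GL_4[F]}.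
Implicit Types (a b c d : F) (l k : {unit F}).

Local Notation elS := (elS p_odd cardF).
Local Notation elM := (elM p (F := F)).
Local Notation elT := (elT F).
Local Notation suz_S := (suz_S p_odd cardF).
Local Notation suz_Z := (suz_Z p_odd cardF).
Local Notation suz_H := (suz_H p F).

(** The additive map c + theta(c) has kernel {0, 1} and misses 1. [R] selects one element of each
    pair c, c + 1; adding 1 to the values at the selected elements makes the map injective, hence
    surjective on the finite field. *)
Lemma theta_artin_schreier b : exists c, b = (c + th c)%R \/ b = (1 + (c + th c))%R.
Proof.
pose R := [pred c : F | enum_rank c < enum_rank (c + 1)%R].
pose f c := ((R c)%:R + (c + th c))%R.
have phiD c d : (c + th c + (d + th d) = (c + d) + th (c + d))%R.
  by rewrite (thetaD cardF); ring.
have f_inj : injective f.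
  move=> c d eq_f; have : (f c + f d)%R = 0%R by rewrite eq_f (addrr2 cardF).
  have -> : (f c + f d = ((R c)%:R + (R d)%:R) + ((c + d) + th (c + d)))%R.
    by rewrite -phiD /f; ring.
  have cd w : (c + d)%R = w -> d = (c + w)%R.
    by move <-; rewrite addrA (addrr2 cardF) add0r.
  have [eqR | neqR] := eqVneq (R c) (R d); last first.
    have -> : ((R c)%:R + (R d)%:R = 1 :> F)%R.
      by case: (R c) (R d) neqR => [] [] //= _; rewrite ?addr0 ?add0r.
    move/eqP; rewrite addr_eq0 (oppr2 cardF) eq_sym.
    by rewrite (negPf (add_theta_neq1 p_odd cardF _)).
  rewrite eqR (addrr2 cardF) add0r => /eqP; rewrite addr_eq0 (oppr2 cardF) => /eqP/esym.
  case/(theta_fix p_odd cardF) => /cd Dd; first by rewrite Dd addr0.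
  move: eqR; rewrite /R /= Dd -addrA (addrr2 cardF) addr0.
  case: ltngtP => // /val_inj/enum_rank_inj.
  by rewrite -{1}[c]addr0 => /addrI/esym/eqP; rewrite oner_eq0.
have [g _ gK] := injF_bij f_inj; exists (g b); move: (esym (gK b)).
by rewrite /f; case: (R _); rewrite ?add0r; [right | left].
Qed.

(** A diagonal matrix brings the first coordinate to 1. Conjugation by S(c,0) then adds c + theta(c)
    to the second, which relates the element to S(1,0) or to its inverse S(1,1). *)
Lemma suz_S_conj4 :
  {in suz_S :\: suz_Z &, forall x y, exists2 g, g \in suz_S * suz_H
     & y = x ^ g \/ y = x^-1 ^ g}.
Proof.
pose u := elS 1%R 0%R.
have uV : u^-1 = elS 1%R 1%R.
  apply: (mulgI u); rewrite mulgV elSM theta1 mulr1 add0r !(addrr2 cardF).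
  by rewrite elS0.
have to_u x : x \in suz_S :\: suz_Z ->
    exists2 g, g \in suz_S * suz_H & x = u ^ g \/ x = u^-1 ^ g.
  case/setDP=> /suz_SP[a [b Dx]] Zx.
  have nz_a : a != 0%R.
    by apply: contraNneq Zx => a0; rewrite Dx a0; apply/suz_ZP; exists b.
  have [m thm] := theta_surj cardF a.
  have Um : m \is a GRing.unit by rewrite unitfE -(theta_eq0 p) thm.
  pose l := FinRing.unit F Um.
  have [c b_c] := theta_artin_schreier (b / (m ^+ 2 * a))%R.
  have nz_m : m != 0%R by rewrite -unitfE.
  have conj_c d : elS 1%R d ^ elS c 0%R = elS 1%R (d + (c + th c))%R.
    apply: (mulgI (elS c 0%R)); rewrite -conjgC !elSM; congr elS.
      by rewrite addrC.
    by rewrite addr0 add0r theta1 mul1r mulr1 -!addrA (addrr2 cardF) addr0.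
  have Dx' : x = elS 1%R (b / (m ^+ 2 * a))%R ^ elM l.
    rewrite elS_conj Dx /= thm mul1r; congr elS.
    by field; rewrite nz_m nz_a.
  exists (elS c 0%R * elM l).
    by apply: mem_mulg; [apply/suz_SP; do 2!eexists | apply/suz_HP; eexists].
  rewrite uV !conjgM !conj_c Dx'.
  by case: b_c => ->; [left; rewrite add0r | right].
have DB : suz_S * suz_H = suz_S_group p_odd cardF <*> suz_H.
  by rewrite norm_joinEr // (suz_H_norm p_odd cardF).
move=> x y /to_u u_x /to_u; rewrite DB in u_x *; exact: conj_or_inv_trans.
Qed.

Local Notation B := (suz_S_group p_odd cardF <*> suz_H).

Lemma suz_SHE : suz_S * suz_H = B.
Proof. by rewrite norm_joinEr // (suz_H_norm p_odd cardF). Qed.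

Lemma elT_V : elT^-1 = elT.
Proof. by apply: (mulgI elT); rewrite mulgV elTT. Qed.

Lemma suz_B_T : B :&: B :^ elT = suz_H.
Proof.
apply/eqP; rewrite eqEsubset; apply/andP; split; last first.
  apply/subsetP=> x Hx; rewrite inE mem_conjg elT_V (suz_H_inv Hx) groupV.
  by rewrite andbb (subsetP (joing_subr _ _)).
apply/subsetP=> x /setIP[]; rewrite mem_conjg elT_V -suz_SHE.
case/mulsgP=> _ _ /suz_SP[a [b ->]] /suz_HP[l ->] Dx.
case/mulsgP=> _ _ /suz_SP[c [d ->]] /suz_HP[k ->] DxT.
have nz_l : val l != 0%R by rewrite -unitfE; apply: valP.
have nz_tl : th (val l) != 0%R by rewrite theta_eq0.
have eqx : elS a b * elM l = elT * (elS c d * elM k) * elT.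
  by rewrite -Dx -DxT /conjg elT_V !mulgA elTT mul1g -mulgA elTT mulg1.
have /matrixP eqm : (Sm a b *m Mm (val l) =
    Tm *m (Sm c d *m Mm (val k)) *m Tm)%R.
  exact: (congr1 (fun g => GLval g) eqx).
(* The left side is lower triangular and the right side upper triangular, so a and b vanish. *)
have /eqP := eqm 1%R 0%R; have /eqP := eqm 2%R 0%R.
rewrite !mul_mx4 !mxE /= !(mulr0, mul0r, addr0, add0r, mul1r, mulr1).
rewrite !mulf_eq0 (negPf nz_l) (negPf nz_tl) !orbF => /eqP b0 /eqP a0.
by rewrite Dx a0 b0 elS0 mul1g; apply/suz_HP; exists l.
Qed.

(** The union is stable under right multiplication by every generator. For T this rests on the
    formula for T S(a,b) T, which needs f = [ovoid_form p a b] to be nonzero whenever S(a,b) is not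
    1. *)
Lemma Sz_sub_Bruhat : Sz p F \subset B :|: B :* elT * suz_S.
Proof.
have sSB : suz_S \subset B := joing_subl _ _.
have sHB : suz_H \subset B := joing_subr _ _.
have TST x : x \in suz_S -> x != 1 -> elT * x * elT \in B :* elT * suz_S.
  case/suz_SP=> a [b ->] nt_x.
  have nz_f : ovoid_form p a b != 0%R.
    rewrite (ovoid_form_eq0 p_odd cardF); apply: contraNN nt_x => /andP[/eqP-> /eqP->].
    by rewrite elS0.
  pose f := ovoid_form p a b; pose y := (a * th a + b)%R.
  have Ul : (th f / f)%R \is a GRing.unit.
    by rewrite unitfE mulf_neq0 ?invr_eq0 ?theta_eq0.
  have -> : elT * elS a b * elT =
      elS (b / f)%R (a / f)%R * (elM (FinRing.unit F Ul) * elT)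
      * elS (y / f)%R (a / f + y / f * th (y / f))%R.
    apply: val_inj; exact: (suzuki_TST p_odd cardF nz_f).
  apply: mem_mulg; last by apply/suz_SP; do 2!eexists.
  rewrite mem_rcoset mulgA mulgK groupM //.
    by apply: (subsetP sSB); apply/suz_SP; do 2!eexists.
  by apply: (subsetP sHB); apply/suz_HP; eexists.
pose D := B :|: B :* elT * suz_S.
have DB x : x \in B -> x \in D by move=> Bx; rewrite inE Bx.
have D1 : 1 \in D by rewrite DB.
have DS x s : x \in D -> s \in suz_S -> x * s \in D.
  move=> /setUP[Bx|/mulsgP[b' s' Bb Ss ->]] Sx.
    by rewrite DB // groupM // (subsetP sSB).
  by rewrite inE orbC -mulgA mem_mulg // (@groupM _ (suz_S_group p_odd cardF)).
have DH x h : x \in D -> h \in suz_H -> x * h \in D.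
  move=> /setUP[Bx|/mulsgP[_ s' /rcosetP[b' Bb ->] Ss ->]] Hh.
    by rewrite DB // groupM // (subsetP sHB).
  have -> : b' * elT * s' * h = b' * h^-1 * elT * s' ^ h.
    have hT : elT * h = h^-1 * elT by rewrite conjgCV elT_V (suz_H_inv Hh).
    by rewrite -mulgA (conjgC s') mulgA -(mulgA b') hT !mulgA.
  rewrite inE orbC mem_mulg //.
    by rewrite mem_rcoset mulgK groupM // groupV (subsetP sHB).
  by rewrite memJ_norm // (subsetP (suz_H_norm p_odd cardF)).
have DT x : x \in D -> x * elT \in D.
  move=> /setUP[Bx|/mulsgP[_ s' /rcosetP[b' Bb ->] Ss ->]].
    by rewrite inE orbC -[_ * _]mulg1 mem_mulg ?mem_rcoset ?mulgK //
      (group1 (suz_S_group p_odd cardF)).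
  have [->|nt_s] := eqVneq s' 1.
    by rewrite mulg1 -mulgA elTT mulg1 DB.
  have /mulsgP[_ s /rcosetP[b Bb0 ->] Ss0 Es] := TST _ Ss nt_s.
  have -> : b' * elT * s' * elT = b' * b * elT * s.
    by rewrite -2!(mulgA b') Es !mulgA.
  by rewrite inE orbC mem_mulg // mem_rcoset mulgK groupM.
apply/subsetP=> x /gen_prodgP[n [c gens_c ->]] {x}.
elim: n c gens_c => [|n IHn] c gens_c; first by rewrite big_ord0.
rewrite big_ord_recr /=; set y := \prod_(i < n) _.
have {IHn}: y \in D by apply: IHn => i; apply: gens_c.
have := gens_c ord_max; rewrite inE => /or3P[/existsP[a /existsP[b /eqP Dc]]|/existsP[l /andP[nz_l /eqP Dc]]|/eqP Dc] Dy.
- have -> : c ord_max = elS a b by apply: val_inj.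
  by apply: DS => //; apply/suz_SP; do 2!eexists.
- have Ul : l \is a GRing.unit by rewrite unitfE.
  have -> : c ord_max = elM (FinRing.unit F Ul) by apply: val_inj.
  by apply: DH => //; apply/suz_HP; eexists.
- have -> : c ord_max = elT by apply: val_inj.
  exact: DT.
Qed.

Lemma suz_B_Sz : B \subset Sz p F.
Proof.
rewrite join_subG; apply/andP; split; apply/subsetP=> x.
  case/suz_SP=> a [b ->]; apply: mem_gen; rewrite inE; apply/orP; left.
  by apply/existsP; exists a; apply/existsP; exists b.
case/suz_HP=> l ->; apply: mem_gen; rewrite inE; apply/or3P/Or32.
by apply/existsP; exists (val l); rewrite -unitfE eqxx andbT; apply: valP.
Qed.

Lemma suz_T_Sz : elT \in Sz p F.
Proof. by apply: mem_gen; rewrite inE; apply/or3P/Or33. Qed.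

End Bruhat.

(** * Elements of order dividing q^2 + 1 *)

Section Irreducible.

Import GroupScope.

Variables (F : fieldType) (n : nat) (x : 'M[F]_n.+1).
Local Open Scope ring_scope.
Hypothesis irr_x : forall U : 'M_n.+1, stablemx U x -> U = 0 \/ row_full U.

Lemma comm_irr_unit A : comm_mx x A -> A != 0 -> A \is a GRing.unit.
Proof.
move=> cxA nzA; have kerx : stablemx (kermx A) x.
  by apply/sub_kermxP; rewrite -mulmxA cxA mulmxA mulmx_ker mul0mx.
have [/eqP|full] := irr_x kerx.
  by rewrite kermx_eq0 row_free_unit.
case/eqP: nzA; rewrite -[A]mul1mx; apply/sub_kermxP.
by apply: submx_trans (submx_full _ full) _; rewrite submx_refl.
Qed.

(** By irreducibility any nonzero v generates the whole space over F[x], so v A = v f(x) for some f.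
    Then A - f(x) commutes with x and kills v, so it is not invertible and must be 0. *)
Lemma comm_irr_horner A : comm_mx x A -> exists f, A = horner_mx x f.
Proof.
move=> cxA; pose v : 'rV[F]_n.+1 := delta_mx 0 0.
have nz_v : v != 0.
  by apply/eqP => /matrixP/(_ 0 0)/eqP; rewrite !mxE oner_eq0.
(* The row space of [M] is the cyclic module of all v f(x), parametrised by the coefficients of f
   below the degree of the minimal polynomial. *)
pose M := lin1_mx (mulmx v \o horner_mx x \o @rVpoly F (degree_mxminpoly x)).
have inM f : (v *m horner_mx x f <= M)%MS.
  apply/submxP; exists (mxvec (horner_mx x f) *m pinvmx (powers_mx x (degree_mxminpoly x))).
  rewrite mul_rV_lin1 /=; congr (_ *m _).
  by rewrite -[LHS](mx_inv_hornerK (horner_mx_mem x f)).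
have stabM : stablemx <<M>>%MS x.
  rewrite (eqmxMr _ (genmxE M)) genmxE; apply/row_subP=> i.
  rewrite row_mul rowE mul_rV_lin1 /= -mulmxA.
  by have := inM (rVpoly (delta_mx 0 i) * 'X); rewrite rmorphM /= horner_mx_X.
have [/eqP|] := irr_x stabM.
  rewrite -submx0 genmxE => M0; case/negP: nz_v; rewrite -submx0.
  by apply: submx_trans M0; have := inM 1; rewrite rmorph1 mulmx1.
rewrite /row_full genmxE => fullM.
have /submxP[u] : (v *m A <= M)%MS by apply: submx_full.
rewrite mul_rV_lin1 /= => vA; exists (rVpoly u); apply/eqP.
rewrite -subr_eq0; apply/negPn/negP => nzA.
have /comm_irr_unit/(_ nzA) unitA : comm_mx x (A - horner_mx x (rVpoly u)).
  apply: comm_mxB => //; exact: comm_mx_horner.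
case/eqP: nz_v; rewrite -(mulmxK unitA v) mulmxBr vA subrr mul0mx //.
Qed.

Lemma comm_irr_comm A B : comm_mx x A -> comm_mx x B -> comm_mx A B.
Proof.
by move=> /comm_irr_horner[f ->] /comm_irr_horner[g ->]; apply: comm_horner_mx2.
Qed.

End Irreducible.

Section Torus.

Import GroupScope.

Variables (F : finFieldType) (p : nat) (x : {'GL_4[F]}).
Local Notation q := #|F|.
Hypotheses (p_gt0 : 0 < p) (cardF : q = (2 ^ p)%N).
Hypotheses (ox : #[x] %| (q ^ 2 + 1)%N) (nt_x : x != 1).

Local Open Scope ring_scope.

Lemma card_F_even : ~~ odd q%N.
Proof. by rewrite cardF oddX /= orbF -lt0n. Qed.

Lemma x_expr : GLval x ^+ (q ^ 2 + 1) = 1.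
Proof.
have /eqP xN : (x ^+ (q ^ 2 + 1) == 1)%g by rewrite -order_dvdn.
by rewrite -[LHS](FinRing.val_unitX (q ^ 2 + 1)) xN.
Qed.

(** q^2 + 1 divides q^6 + 1, which is odd and hence prime to q^6 - 1; and q^k - 1 divides q^6 - 1
    for k = 1, 2, 3, the exponents that occur in the order of GL_r for r < 4. *)
Lemma coprime_tower_GL r : (0 < r < 4)%N -> coprime (q ^ 2 + 1) #|'GL_r[F]|.
Proof.
case/andP=> r_gt0 r_lt4; rewrite card_GL // coprimeMr.
have q_gt0 : (0 < q)%N by apply: ltnW (finNzRing_gt1 F).
have q6_gt0 : (0 < q ^ 6)%N by rewrite expn_gt0 q_gt0.
have cop6 : coprime (q ^ 6 + 1) (q ^ 6 - 1).
  have -> : (q ^ 6 + 1 = (q ^ 6 - 1) + 2)%N by rewrite -{1}(subnK q6_gt0) -addnA.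
  by rewrite coprime_sym /coprime gcdnDl -/(coprime _ _) coprimen2 oddB // oddX (negPf (card_F_even)).
have dvd6 : (q ^ 2 + 1 %| q ^ 6 + 1)%N.
  have [m Dm] : exists m, (q ^ 2 = m.+1)%N by exists (q ^ 2).-1; rewrite prednK ?expn_gt0 ?q_gt0.
  rewrite (expnM q 2 3) Dm; apply/dvdnP; exists (m.+1 * m + 1)%N.
  by rewrite !expnS expn0 -addn1; ring.
have copX k : (k %| 6)%N -> coprime (q ^ 2 + 1) (q ^ k - 1).
  move=> k6; apply: coprime_dvdl dvd6 _; apply: coprime_dvdr cop6.
  by rewrite -(divnK k6) mulnC expnM !subn1 dvdn_pred_predX.
have cop1 : coprime (q ^ 2 + 1) q.
  rewrite addn1 coprime_sym -mulnn; apply: coprime_dvdl (coprimenS _).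
  exact: dvdn_mulr.
rewrite coprimeXr //=.
case: r r_gt0 r_lt4 => [|[|[|[|]]]] // _ _;
by rewrite big_add1 big_mkord !big_ord_recr big_ord0 /= ?coprimeMr ?coprimen1 ?mul1n ?copX.
Qed.

Lemma proper_stable_trivial r (W : 'M[F]_(r, 4)) (A : 'M_r) :
  (0 < r < 4)%N -> row_free W -> W *m GLval x = A *m W -> A = 1%:M.
Proof.
case: r => [|r] // in W A * => r_range freeW WxA.
have WxX k : W *m (GLval x) ^+ k = A ^+ k *m W.
  elim: k => [|k IHk]; first by rewrite !expr0 mulmx1 mul1mx.
  by rewrite !exprSr mulmxA IHk -mulmxA WxA mulmxA.
have AN : A ^+ (q ^ 2 + 1) = 1.
  by apply: (row_free_inj freeW); rewrite -WxX x_expr mul1mx mulmx1.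
have UA : A \is a GRing.unit by rewrite -(@unitrX_pos _ _ (q ^ 2 + 1)) ?AN ?unitr1 // addn1.
pose g : {'GL_r.+1[F]} := FinRing.unit _ UA.
suffices g1 : g = 1%g by rewrite -[A]/(GLval g) g1.
apply/eqP; rewrite -order_eq1 -dvdn1 -(eqP (coprime_tower_GL r_range)) dvdn_gcd.
rewrite order_dvdG ?inE // andbT order_dvdn; apply/eqP/val_inj.
by rewrite FinRing.val_unitX /= AN.
Qed.

(* The order of x is prime to that of GL_r(F) for r < 4, so x acts trivially on any
   proper stable subspace. *)
Lemma irr_torus (U : 'M[F]_4) : stablemx U (GLval x) -> U = 0 \/ row_full U.
Proof.
have stab_fix (V : 'M[F]_4) : stablemx V (GLval x) -> (0 < \rank V < 4)%N ->
    V *m GLval x = V.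
  move=> stabV ltV; have stabW : stablemx (row_base V) (GLval x).
    by rewrite stablemx_row_base.
  have /submxP[A WxA] := stabW.
  have A1 := proper_stable_trivial ltV (row_base_free V) WxA.
  move: WxA; rewrite A1 mul1mx => Wx.
  have /submxP[B ->] : (V <= row_base V)%MS by rewrite eq_row_base.
  by rewrite -mulmxA Wx.
move=> stabU; have [->|nzU] := eqVneq U 0; first by left.
have [|nfullU] := boolP (row_full U); [by right | exfalso].
have Ux : U *m GLval x = U.
  apply: stab_fix => //; rewrite lt0n mxrank_eq0 nzU /=.
  by rewrite ltn_neqAle nfullU rank_leq_col.
(* As x fixes the nonzero U, the matrix D is singular. Its row space is then a proper stable
   subspace, also fixed by x, so (x - 1)^2 = 0. In characteristic 2 this says x^2 = 1, against the
   odd order of x. *)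
pose D : 'M[F]_4 := GLval x - 1%:M.
have nzD : D != 0.
  by rewrite subr_eq0; apply: contraNneq nt_x => x1; apply/eqP; apply: val_inj.
have UD : U *m D = 0 by rewrite mulmxBr Ux mulmx1 subrr.
have DD : D *m GLval x = D.
  apply: stab_fix.
    by apply/submxP; exists (GLval x); rewrite mulmxBl mulmxBr mulmx1 mul1mx.
  rewrite lt0n mxrank_eq0 nzD /= ltnNge; apply: contraNN nzU => fullD.
  have unitD : D \in unitmx by rewrite -row_free_unit /row_free eqn_leq rank_leq_row.
  by rewrite -(mulmxK unitD U) UD mul0mx.
have double0 (A : 'M[F]_4) : A + A = 0.
  by rewrite -mulr2n -scaler_nat (two_eq0 cardF) scale0r.
have x2 : (x ^+ 2 = 1)%g.
  have xx : GLval x *m GLval x = GLval x - 1 + GLval x.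
    by apply/eqP; rewrite -subr_eq; move: DD; rewrite mulmxBl mul1mx => ->.
  apply: val_inj; rewrite FinRing.val_unitX /= expr2 [LHS]xx addrAC double0 add0r.
  by apply/eqP; rewrite eq_sym -addr_eq0 double0.
have cop2 : coprime #[x]%g 2.
  by apply: coprime_dvdl ox _; rewrite coprimen2 addn1 oddS oddX (negPf card_F_even).
case/negP: nt_x; move: cop2; rewrite /coprime.
by have /gcdn_idPl -> : (#[x]%g %| 2)%N; rewrite ?order_dvdn ?x2 ?order_eq1.
Qed.

(* F[x] is a field, which yields cyclicity; the conjugates of x under the normaliser are
   roots in F[x] of its characteristic polynomial, hence at most four in number. *)
Lemma cent_torus (G : {group {'GL_4[F]}}) : x \in G ->
  cyclic 'C_G[x]%g /\ (#|'N_G('C_G[x]) : 'C_G[x]| <= 4)%N.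
Proof.
move=> Gx; have cx y : y \in 'C_G[x]%g -> comm_mx (GLval x) (GLval y).
  by case/setIP=> _ /cent1P cyx; apply: (congr1 (fun g => GLval g) (esym cyx)).
have cxx y z : y \in 'C_G[x]%g -> z \in 'C_G[x]%g -> (y * z = z * y)%g.
  by move=> /cx cy /cx cz; apply: val_inj; apply: (comm_irr_comm irr_torus).
have diff_unit y z : y \in 'C_G[x]%g -> z \in 'C_G[x]%g -> y != z ->
    GLval y - GLval z \is a GRing.unit.
  move=> /cx cy /cx cz neq; apply: (comm_irr_unit irr_torus).
    exact: comm_mxB.
  by rewrite subr_eq0; apply: contraNneq neq => eqv; apply/eqP/val_inj.
split.
  apply: (div_ring_mul_group_cyclic (f := fun y : {'GL_4[F]} => GLval y : 'M[F]_4)) => //.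
    by move=> y /setD1P[nt_y Cy]; apply: (diff_unit y 1%g).
  by apply/centsP=> y Cy z Cz; apply: cxx.
set C := 'C_G[x]%g; set N := 'N_G(C)%g.
have Cx : x \in C by rewrite inE Gx cent1id.
have CxN : ('C_N[x] = C)%g.
  apply/eqP; rewrite eqEsubset (setSI _ (subsetIl _ _)) /=.
  by rewrite subsetI (subsetIr G) andbT subsetI subsetIl normG.
(* C is also the centraliser of x in N, so the index is the number of N-conjugates of x. *)
rewrite -CxN index_cent1.
have sxC y : y \in (x ^: N)%g -> y \in C.
  by case/imsetP=> g /setIP[_ nCg] ->; rewrite memJ_norm.
pose P := map_poly (@scalar_mx F 4) (char_poly (GLval x)).
have sizeP : size P = 5%N.
  by rewrite size_map_poly_id0 ?size_char_poly // (monicP (char_poly_monic _)) oner_eq0.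
rewrite -ltnS -sizeP.
rewrite cardE -(size_map (fun y : {'GL_4[F]} => GLval y : 'M[F]_4)).
(* Over a ring the degree bounds the number of roots as soon as these commute and have invertible
   differences, which holds for distinct elements of C. *)
apply: max_ring_poly_roots => //; first by rewrite -size_poly_eq0 sizeP.
  apply/allP=> _ /mapP[y + ->]; rewrite mem_enum => /imsetP[g _ ->]; apply/eqP.
  have -> : GLval (x ^ g)%g = invmx (GLval g) *m GLval x *m invmx (invmx (GLval g)).
    by rewrite invmxK; apply: mulmxA.
  have Ug : invmx (GLval g) \is a GRing.unit by rewrite unitrV; apply: (GL_unit g).
  rewrite -[LHS]/(horner_mx _ _) (horner_mx_uconj _ _ Ug).
  by rewrite Cayley_Hamilton mulmx0 mul0mx.
have := enum_uniq (x ^: N)%g.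
have : {subset enum (x ^: N)%g <= C} by move=> u; rewrite mem_enum; apply: sxC.
elim: (enum _) => //= y s IHs sC /andP[nsy Us].
rewrite IHs // ?andbT; last by move=> z sz; apply: sC; rewrite inE sz orbT.
apply/allP=> _ /mapP[z sz ->]; apply/andP; split.
  have /sC Cy : y \in y :: s by rewrite inE eqxx.
  have /sC Cz : z \in y :: s by rewrite inE sz orbT.
  by apply/eqP; apply: (congr1 (fun g => GLval g) (cxx _ _ Cy Cz)).
rewrite diff_unit ?sC ?inE ?eqxx ?sz ?orbT //.
by apply: contraNneq nsy => <-.
Qed.

End Torus.

Theorem theorem3p5 (p : nat) (F : finFieldType) (x : {'GL_4[F]}) :
  prime p -> odd p -> #|F| = 2 ^ p ->
  x \in Sz p F -> x != 1%g ->
  let q := 2 ^ p in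
  let G := Sz p F in
  (#[x]%g = 2 \/ #[x]%g = 4 \/
    (#[x]%g %| q - 1) \/ (#[x]%g %| q_plus p) \/ (#[x]%g %| q_minus p))
  /\ (forall M : {group {'GL_4[F]}}, maximal M G ->
        borel_type p G M \/ dihedral_type p M \/
        frobenius_type (q_plus p) G M \/ frobenius_type (q_minus p) G M)
  /\ solubilizer G x = \bigcup_(M in maximals_containing G x) (M : {set _})
  /\ (#[x]%g = 2 ->
        maximal_counts p G x = (1, q ^ 2 %/ 2, q ^ 2 %/ 4, q ^ 2 %/ 4)
        /\ pairwise_intersections G x (fun A => is_C 2 A \/ is_C 4 A)
        /\ #|solubilizer G x| = q ^ 2 * (4 * q - 3))
  /\ (#[x]%g = 4 ->
        maximal_counts p G x = (1, 0, q %/ 2, q %/ 2)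
        /\ pairwise_intersections G x (fun A => is_C 4 A)
        /\ #|solubilizer G x| = q ^ 2 * (q + 3))
  /\ (#[x]%g %| q - 1 ->
        maximal_counts p G x = (2, 1, 0, 0)
        /\ pairwise_intersections G x (fun A => is_C (q - 1) A)
        /\ #|solubilizer G x| = 2 * q ^ 2 * (q - 1))
  /\ (#[x]%g %| q_plus p ->
        maximal_counts p G x = (0, 0, 1, 0)
        /\ #|solubilizer G x| = 4 * q_plus p)
  /\ (#[x]%g %| q_minus p ->
        maximal_counts p G x = (0, 0, 0, 1)
        /\ #|solubilizer G x| = 4 * q_minus p).
Proof.
move=> p_pr p_odd cardF.
apply: (@suzuki_solubilizer _ (Sz p F) (suz_S_group p_odd cardF) (suz_Z_group p_odd cardF)
  (suz_H p F) (elT F) p p_pr p_odd).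
- exact: card_suz_S.
- exact: card_suz_Z.
- exact: card_suz_H.
- exact: suz_H_cyclic.
- exact: suz_Z_subS.
- exact: suz_S_sqr.
- exact: suz_Z_sqr.
- exact: suz_H_norm.
- exact: suz_H_regular.
- exact: suz_T_Sz.
- exact: elTT.
- exact: suz_H_inv.
- exact: suz_B_T.
- exact: suz_B_Sz.
- exact: Sz_sub_Bruhat.
- exact: suz_Z_conj.
- by move=> u v Su Sv; rewrite -suz_SHE; apply: suz_S_conj4.
move=> u Gu nt_u; rewrite -cardF => ou.
exact: (cent_torus (prime_gt0 p_pr) cardF ou nt_u Gu).
Qed.
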